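(* Let $h$ be a holomorphic function in $\mathbb{C}_+$. Then $h$ is the Koenigs function of a continuous semigroup in $\mathcal{G}$ if and only if $h'$ is a Dirichlet series satisfying $h'(\mathbb{C}_+)\subset\overline{\mathbb{C}_+}\setminus\{0\}$.
   Context: For $\theta\in\mathbb{R}$, $\mathbb{C}_\theta=\{s\in\mathbb{C}:\operatorname{Re}(s)>\theta\}$ and $\mathbb{C}_+=\mathbb{C}_0$. $\mathcal{D}$ denotes the space of Dirichlet series $\sum_{n\ge1}a_nn^{-s}$ that converge in some half-plane $\mathbb{C}_\theta$; a holomorphic function on a half-plane is said to be a Dirichlet series (to belong to $\mathcal{D}$) if it coincides with such a convergent series on some half-plane. Gordon-Hedenmalm class $\mathcal{G}$: an analytic $\Phi:\mathbb{C}_+\to\mathbb{C}_+$ belongs to $\mathcal{G}$ if there are $c_\Phi\in\mathbb{N}\cup\{0\}$ and $\varphi\in\mathcal{D}$ such that $\Phi(s)=c_\Phi s+\varphi(s)$ for $s\in\mathbb{C}_+$, and, in case $c_\Phi=0$, moreover $\Phi(\mathbb{C}_+)\subset\mathbb{C}_{1/2}$. A continuous semigroup in $\mathcal{G}$ is a family $\{\Phi_t\}_{t\ge0}\subset\mathcal{G}$ with $\Phi_0(s)=s$, $\Phi_t\circ\Phi_u=\Phi_{t+u}$ for all $t,u\ge0$, and $\Phi_t\to\Phi_0$ uniformly on compact subsets of $\mathbb{C}_+$ as $t\to0^+$. The Koenigs function of a non-elliptic continuous semigroup (i.e. one such that no $\Phi_t$, $t>0$, has a fixed point in $\mathbb{C}_+$)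 is the univalent function $h:\mathbb{C}_+\to\mathbb{C}$, unique up to an additive constant, such that $h\circ\Phi_t(s)=h(s)+t$ for all $s\in\mathbb{C}_+$, $t\ge0$; any such $h$ is called the Koenigs function of the semigroup. *)

(* Defs.v *)
From Stdlib Require Export Reals List.
From Coquelicot Require Export Coquelicot.
Open Scope R_scope.

(** Functions on a half-plane are total functions [C -> C]; only their values
    on that half-plane are ever used, the values elsewhere being irrelevant. *)

Definition half_plane (theta : R) (s : C) : Prop := theta < Re s.

Definition right_half_plane : C -> Prop := half_plane 0.

(** The set [U] is meant to be open. *)
Definition holomorphic_on (U : C -> Prop) (f : C -> C) : Prop :=
  forall s : C, U s -> @ex_derive C_AbsRing C_NormedModule f s.

Definition univalent_on (U : C -> Prop) (f : C -> C) : Prop :=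
  holomorphic_on U f /\
  forall s w : C, U s -> U w -> f s = f w -> s = w.

(** Open-cover compactness; the Standard Library's [compact] is for [R] only. *)
Definition Ccompact (K : C -> Prop) : Prop :=
  forall (I : Type) (U : I -> C -> Prop),
    (forall i : I, open (U i)) ->
    (forall s : C, K s -> exists i : I, U i s) ->
    exists l : list I, forall s : C, K s -> exists i : I, In i l /\ U i s.

Definition Cexp (z : C) : C := (exp (Re z) * cos (Im z), exp (Re z) * sin (Im z)).

(** [n^(-s)], for [n >= 1]. *)
Definition nat_cpow_opp (n : nat) (s : C) : C :=
  Cexp (Copp (Cmult s (RtoC (ln (INR n))))).

(** [f] coincides on some half-plane with a Dirichlet series converging there.
    The series starts at [n = 1]: [a 0] is not used. If [f] is only meaningful
    on [right_half_plane], nothing changes, since [theta] can be enlarged. *)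
Definition is_dirichlet_series (f : C -> C) : Prop :=
  exists (a : nat -> C) (theta : R),
    forall s : C, half_plane theta s ->
      @is_series C_AbsRing C_NormedModule
        (fun k : nat => Cmult (a (S k)) (nat_cpow_opp (S k) s)) (f s).

Definition gordon_hedenmalm (Phi : C -> C) : Prop :=
  holomorphic_on right_half_plane Phi /\
  (forall s : C, right_half_plane s -> right_half_plane (Phi s)) /\
  exists (c : nat) (phi : C -> C),
    is_dirichlet_series phi /\
    (forall s : C, right_half_plane s ->
       Phi s = Cplus (Cmult (RtoC (INR c)) s) (phi s)) /\
    (c = 0%nat ->
       forall s : C, right_half_plane s -> half_plane (1 / 2) (Phi s)).

(** The family is indexed by [R]; only the parameters [t >= 0] are used. *)
Definition continuous_semigroup (Phi : R -> C -> C) : Prop :=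
  (forall t : R, 0 <= t -> gordon_hedenmalm (Phi t)) /\
  (forall s : C, right_half_plane s -> Phi 0 s = s) /\
  (forall t u : R, 0 <= t -> 0 <= u ->
     forall s : C, right_half_plane s -> Phi t (Phi u s) = Phi (t + u) s) /\
  (forall K : C -> Prop,
     Ccompact K -> (forall s : C, K s -> right_half_plane s) ->
     forall eps : R, 0 < eps ->
       at_right 0 (fun t : R =>
         forall s : C, K s -> Cmod (Cminus (Phi t s) (Phi 0 s)) < eps)).

Definition non_elliptic (Phi : R -> C -> C) : Prop :=
  forall t : R, 0 < t -> forall s : C, right_half_plane s -> Phi t s <> s.

(** The normalization is only up to an additive constant. *)
Definition koenigs_function (Phi : R -> C -> C) (h : C -> C) : Prop :=
  non_elliptic Phi /\
  univalent_on right_half_plane h /\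
  (forall s : C, right_half_plane s ->
     forall t : R, 0 <= t -> h (Phi t s) = Cplus (h s) (RtoC t)).

(* Main.v *)
Require Import Defs.
From Stdlib Require Import Lra Lia ClassicalEpsilon Classical.

(* Everything rests on the Schwarz-Pick inequality on the right half-plane. Difference quotients give it
   for [h'] as soon as [Re h' >= 0], so that control of [h'] far to the right, where its series
   converges, spreads to every half-plane [Re s >= x > 0]; it also gives Julia's lemma
   [Re Phi >= c Re s].

   If [h] is a Koenigs function, then for small [t > 0] the factor [c] of [Phi_t] is 1: [Phi_t] is close to
   the identity at [1/4]. By Julia's lemma the displacement [f_t s = Phi_t s - s] has nonnegative real
   part, and [f_t / t] tends to [1 / h']. Hence [Re h' >= 0] and [h'] has no zero. Means of
   [f_t (1 + Re (om n^(i y)))] along a vertical line bound the coefficients [b_n] of [f_t] by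
   [2 n Re b_1], independently of the abscissa of convergence of [f_t]. So [1 / h'] is a limit of
   series with uniformly bounded growth, hence a Dirichlet series with nonzero constant term, and its
   inverse is one too.

   Conversely, the same coefficient bound shows that either [h'] is constant or [Re h'] has a positive
   lower bound on every half-plane [Re s >= x > 0]. Then [h] has a Lipschitz inverse there, and
   [h w = h s + t] is solved in steps of a length depending only on [Re s]. Writing
   [h s = b s + E s + const] with a Dirichlet series [E], the displacement [phi] of [Phi_t] is the fixed
   point of [phi |-> (t + E s - E (s + phi)) / b], a contraction far to the right which preserves uniform
   limits of Dirichlet polynomials. *)

(** * Complex derivatives *)

(** Complex analysis is built here on Goursat's theorem without Cauchy's formula or power series, so
    the derivative of a holomorphic function is not known to be holomorphic. Local primitives give
    second order expansions, these give the maximum principle, and Schwarz's lemma follows. For this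
    reason [h'] is handled through difference quotients of [h], and as a holomorphic function only
    where its series converges.

    The obstacle in the direct part is that membership in the class puts no common bound on the
    abscissas of convergence as [t] tends to 0, so pointwise limits alone say nothing about
    coefficients. Positivity of the real part bounds all coefficients by the first one, and the
    value at the single point 12 bounds the first one. In the limit the same inequality shows that a
    vanishing first coefficient would annihilate the whole series.

    Coefficients of products, inverses and compositions are never computed: these operations are
    carried out on uniform limits of Dirichlet polynomials, and a series is extracted only at the
    end. *)

Lemma functional_choice (A B : Type) (P : A -> B -> Prop) :
  (forall x, exists y, P x y) -> exists f, forall x, P x (f x).
Proof.
  intros H. exists (fun x => proj1_sig (constructive_indefinite_description _ (H x))).
  intros x. apply proj2_sig.
Qed.

Definition ccont (f : C -> C) (s : C) : Prop :=
  forall e, 0 < e -> exists d, 0 < d /\ forall z, Cmod (z - s) < d -> Cmod (f z - f s) < e.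

(* Caratheodory's formulation: chain and product rules become algebra. *)
Definition cderiv (f : C -> C) (s l : C) : Prop :=
  exists q : C -> C, q s = l /\ ccont q s /\ forall z, f z = (f s + q z * (z - s))%C.

Lemma C_eq (a b : C) : Re a = Re b -> Im a = Im b -> a = b.
Proof. destruct a, b; simpl; congruence. Qed.

Ltac C_ring := apply C_eq; unfold Re, Im; simpl; ring.
Ltac C_field := apply C_eq; unfold Re, Im; simpl; field.
Ltac Re_ring := unfold Re, Im; simpl; ring.

Ltac pos := repeat first [assumption | solve [lra] | apply exp_pos | apply Cmod_ge_0 | apply pow2_ge_0
  | apply Rmin_glb_lt | apply Rmult_lt_0_compat | apply Rdiv_lt_0_compat | apply Rinv_0_lt_compat
  | apply pow_lt | apply Rmult_le_pos | apply Rdiv_le_0_compat | apply lt_0_INR, Nat.lt_0_succ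
  | solve [auto] | solve [nra] | left].

Lemma Cmod_sym (a b : C) : Cmod (a - b) = Cmod (b - a).
Proof. rewrite <- Cmod_opp. f_equal. ring. Qed.

Lemma Cmod_tri (a b c : C) : Cmod (a - c) <= Cmod (a - b) + Cmod (b - c).
Proof. replace (a - c)%C with ((a - b) + (b - c))%C by ring. apply Cmod_triangle. Qed.

Lemma Cmod_sub (a b : C) : Cmod (a - b) <= Cmod a + Cmod b.
Proof. rewrite <- (Cmod_opp b). apply Cmod_triangle. Qed.

Lemma Cmod_sub_ge (a b : C) : Cmod a - Cmod b <= Cmod (a - b).
Proof. pose proof (Cmod_triangle (a - b) b). replace (a - b + b)%C with a in H by ring. lra. Qed.

Lemma Re_abs (a : C) : - Cmod a <= Re a <= Cmod a.
Proof. pose proof (re_le_Cmod a). apply Rabs_le_between. exact H. Qed.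

Lemma Re_near (a b : C) : - Cmod (a - b) <= Re a - Re b <= Cmod (a - b).
Proof. apply (Re_abs (a - b)). Qed.

Lemma Im_abs (a : C) : - Cmod a <= Im a <= Cmod a.
Proof.
  apply Rabs_le_between. pose proof (Rmax_Cmod a).
  apply Rle_trans with (2 := H). apply Rmax_r.
Qed.

Lemma Cmod_le_ReIm (a : C) : Cmod a <= Rabs (Re a) + Rabs (Im a).
Proof.
  pose proof (Cmod2_alt a). pose proof (Rabs_pos (Re a)). pose proof (Rabs_pos (Im a)).
  rewrite <- (pow2_abs (Re a)), <- (pow2_abs (Im a)) in H.
  nra.
Qed.

Lemma Cmod_near (a b : C) : Cmod a <= Cmod b + Cmod (a - b) /\ Cmod b <= Cmod a + Cmod (a - b).
Proof. pose proof (Cmod_sub_ge a b). pose proof (Cmod_sub_ge b a). rewrite Cmod_sym in H0. lra. Qed.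

Lemma Cmod_zero_le (a : C) : Cmod a <= 0 -> a = 0.
Proof. intros. apply Cmod_eq_0. pose proof (Cmod_ge_0 a). lra. Qed.

Lemma Cmod_pos_neq (a : C) : 0 < Cmod a -> a <> 0.
Proof. apply Cmod_gt_0. Qed.

Lemma Cmod_R_pos (r : R) : 0 <= r -> Cmod r = r.
Proof. rewrite Cmod_R. apply Rabs_pos_eq; auto. Qed.

Lemma Cminus_0_eq (a b : C) : (a - b)%C = 0 -> a = b.
Proof. intros H. replace a with ((a - b) + b)%C by ring. rewrite H. ring. Qed.

Lemma Cminus_neq_0 (a b : C) : a <> b -> (a - b)%C <> 0.
Proof. intros H H'. apply H, Cminus_0_eq, H'. Qed.

Lemma RtoC_neq (x : R) : x <> 0 -> RtoC x <> 0.
Proof. intros H Q. apply H. apply RtoC_inj in Q. auto. Qed.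

Lemma Im_Rabs (a : C) : Rabs (Im a) <= Cmod a.
Proof. apply Rabs_le_between, Im_abs. Qed.

Lemma Cmod_diff_0 (a : C) : Cmod (a - a) = 0.
Proof. replace (a - a)%C with (RtoC 0) by ring. apply Cmod_0. Qed.

Lemma C_of_Cmod_small (a b : C) : (forall e, 0 < e -> Cmod (a - b) <= e) -> a = b.
Proof.
  intros H. apply Cminus_0_eq, Cmod_zero_le. apply le_epsilon.
  intros e He. specialize (H e He). lra.
Qed.

Lemma ccont_const (c s : C) : ccont (fun _ => c) s.
Proof. intros e He. exists 1. split; [lra|]. rewrite Cmod_diff_0. auto. Qed.

Lemma ccont_id (s : C) : ccont (fun z => z) s.
Proof. intros e He. exists e. split; auto. Qed.

Lemma ccont_ext_loc (f g : C -> C) (s : C) (r : R) : 0 < r ->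
  (forall z, Cmod (z - s) < r -> f z = g z) -> ccont f s -> ccont g s.
Proof.
  intros Hr H Hf e He. destruct (Hf e He) as [d [Hd H1]].
  exists (Rmin d r). split. { pos. }
  intros z Hz. rewrite <- !H.
  - apply H1. apply Rlt_le_trans with (1 := Hz). apply Rmin_l.
  - rewrite Cmod_diff_0. auto.
  - apply Rlt_le_trans with (1 := Hz). apply Rmin_r.
Qed.

Lemma ccont_plus (f g : C -> C) (s : C) :
  ccont f s -> ccont g s -> ccont (fun z => f z + g z)%C s.
Proof.
  intros Hf Hg e He.
  destruct (Hf (e / 2)) as [d [Hd H1]]; [lra|].
  destruct (Hg (e / 2)) as [d' [Hd' H2]]; [lra|].
  exists (Rmin d d'). split. { pos. }
  intros z Hz.
  specialize (H1 z (Rlt_le_trans _ _ _ Hz (Rmin_l _ _))).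
  specialize (H2 z (Rlt_le_trans _ _ _ Hz (Rmin_r _ _))).
  replace (f z + g z - (f s + g s))%C with ((f z - f s) + (g z - g s))%C by ring.
  pose proof (Cmod_triangle (f z - f s) (g z - g s)). lra.
Qed.

Lemma ccont_mult (f g : C -> C) (s : C) :
  ccont f s -> ccont g s -> ccont (fun z => f z * g z)%C s.
Proof.
  intros Hf Hg e He.
  pose proof (Cmod_ge_0 (f s)) as F0. pose proof (Cmod_ge_0 (g s)) as G0.
  set (M := Cmod (f s) + Cmod (g s) + 1).
  set (e' := Rmin 1 (e / (M + 1))).
  assert (0 < M) by (unfold M; lra).
  assert (0 < e') by pos.
  assert (e' * (M+1) <= e).
  { apply Rle_trans with (e / (M + 1) * (M + 1)); [|right; field; lra].
    apply Rmult_le_compat_r; [lra|apply Rmin_r]. }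
  assert (e' <= 1) by apply Rmin_l.
  destruct (Hf e') as [d [Hd H1']]; auto.
  destruct (Hg e') as [d' [Hd' H2']]; auto.
  exists (Rmin d d'). split. { pos. }
  intros z Hz.
  specialize (H1' z (Rlt_le_trans _ _ _ Hz (Rmin_l _ _))).
  specialize (H2' z (Rlt_le_trans _ _ _ Hz (Rmin_r _ _))).
  replace (f z * g z - f s * g s)%C
    with ((f z - f s) * (g z - g s) + (f s * (g z - g s) + (f z - f s) * g s))%C by ring.
  pose proof (Cmod_triangle ((f z - f s) * (g z - g s)) (f s * (g z - g s) + (f z - f s) * g s)).
  pose proof (Cmod_triangle (f s * (g z - g s)) ((f z - f s) * g s)).
  rewrite !Cmod_mult in *.
  pose proof (Cmod_ge_0 (f z - f s)).
  unfold M in *. nra.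
Qed.

Lemma ccont_opp (f : C -> C) (s : C) : ccont f s -> ccont (fun z => - f z)%C s.
Proof.
  intros Hf e He. destruct (Hf e He) as [d [Hd H]]. exists d. split; auto. intros z Hz.
  replace (- f z - - f s)%C with (- (f z - f s))%C by ring. rewrite Cmod_opp. auto.
Qed.

Lemma ccont_conj (f : C -> C) (s : C) : ccont f s -> ccont (fun z => Cconj (f z)) s.
Proof.
  intros Hf e He. destruct (Hf e He) as [d [Hd H]]. exists d. split; auto. intros z Hz.
  replace (Cconj (f z) - Cconj (f s))%C with (Cconj (f z - f s)) by C_ring. rewrite Cmod_conj. auto.
Qed.

Lemma ccont_normsq (f : C -> C) (s : C) : ccont f s -> ccont (fun z => f z * Cconj (f z))%C s.
Proof. intros. apply ccont_mult; auto. apply ccont_conj. auto. Qed.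

Lemma Re_normsq (z : C) : Re (z * Cconj z)%C = Cmod z ^ 2.
Proof. rewrite <- Cmod2_conj. reflexivity. Qed.

Lemma ccont_inv (f : C -> C) (s : C) :
  ccont f s -> f s <> 0 -> ccont (fun z => / f z)%C s.
Proof.
  intros Hf Hn e He. apply Cmod_gt_0 in Hn.
  set (m := Cmod (f s)) in *.
  destruct (Hf (Rmin (m / 2) (e * m * m / 2))) as [d [Hd H1]].
  { pos. }
  exists d. split; auto. intros z Hz. specialize (H1 z Hz).
  assert (A1 := Rlt_le_trans _ _ _ H1 (Rmin_l _ _)).
  assert (A2 := Rlt_le_trans _ _ _ H1 (Rmin_r _ _)).
  pose proof (Cmod_sub_ge (f s) (f z)). rewrite Cmod_sym in H. fold m in H.
  assert (m / 2 < Cmod (f z)) by lra.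
  assert (f z <> 0) by (apply Cmod_pos_neq; lra).
  assert (f s <> 0) by (apply Cmod_pos_neq; auto).
  replace (/ f z - / f s)%C with (- (f z - f s) / (f z * f s))%C by (field; auto).
  rewrite Cmod_div, Cmod_opp, Cmod_mult by (apply Cmult_neq_0; auto). fold m.
  apply Rlt_div_l. { pos. }
  assert (e * m * (m / 2) < e * m * Cmod (f z)).
  { apply Rmult_lt_compat_l; auto. apply Rmult_lt_0_compat; auto. }
  nra.
Qed.

Lemma ccont_comp (f g : C -> C) (s : C) :
  ccont g s -> ccont f (g s) -> ccont (fun z => f (g z)) s.
Proof.
  intros Hg Hf e He. destruct (Hf e He) as [d [Hd H1]].
  destruct (Hg d Hd) as [d' [Hd' H2]]. exists d'. split; auto.
Qed.

Lemma cderiv_ccont f s l : cderiv f s l -> ccont f s.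
Proof.
  intros [q [_ [Hq H]]].
  apply ccont_ext_loc with (f := fun z => (f s + q z * (z - s))%C) (r := 1); [lra|auto|].
  apply ccont_plus. apply ccont_const. apply ccont_mult; auto.
  apply ccont_plus. apply ccont_id. apply ccont_const.
Qed.

Lemma cderiv_const c s : cderiv (fun _ => c) s 0.
Proof. exists (fun _ => RtoC 0). split; auto. split. apply ccont_const. intros. ring. Qed.

Lemma cderiv_id s : cderiv (fun z => z) s 1.
Proof. exists (fun _ => RtoC 1). split; auto. split. apply ccont_const. intros. ring. Qed.

Lemma cderiv_plus f g s l m : cderiv f s l -> cderiv g s m -> cderiv (fun z => f z + g z)%C s (l + m)%C.
Proof.
  intros [q [E1 [C1 H1]]] [p [E2 [C2 H2]]].
  exists (fun z => q z + p z)%C. split; [congruence|]. split; [apply ccont_plus; auto|].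
  intros z. rewrite H1, H2. ring.
Qed.

Lemma cderiv_mult f g s l m : cderiv f s l -> cderiv g s m ->
  cderiv (fun z => f z * g z)%C s (l * g s + f s * m)%C.
Proof.
  intros Hf Hg. pose proof (cderiv_ccont _ _ _ Hg).
  destruct Hf as [q [E1 [C1 H1]]]. destruct Hg as [p [E2 [C2 H2]]].
  exists (fun z => q z * g z + f s * p z)%C. split; [congruence|]. split.
  { apply ccont_plus; apply ccont_mult; auto. apply ccont_const. }
  intros z. rewrite (H1 z) at 1. rewrite (H2 z). ring.
Qed.

Lemma cderiv_eq f s l m : cderiv f s l -> l = m -> cderiv f s m.
Proof. intros H <-. exact H. Qed.

Lemma cderiv_scal c f s l : cderiv f s l -> cderiv (fun z => c * f z)%C s (c * l)%C.
Proof.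
  intros H. eapply cderiv_eq. apply cderiv_mult. apply cderiv_const. apply H. cbv beta. ring.
Qed.

Lemma cderiv_opp f s l : cderiv f s l -> cderiv (fun z => - f z)%C s (- l)%C.
Proof.
  intros [q [E1 [C1 H1]]]. exists (fun z => - q z)%C. split; [congruence|]. split.
  - apply ccont_opp. auto.
  - intros z. rewrite (H1 z). ring.
Qed.

Lemma cderiv_minus f g s l m : cderiv f s l -> cderiv g s m -> cderiv (fun z => f z - g z)%C s (l - m)%C.
Proof. intros. apply cderiv_plus; auto. apply cderiv_opp. auto. Qed.

Lemma cderiv_comp f g s l m : cderiv g s m -> cderiv f (g s) l -> cderiv (fun z => f (g z)) s (l * m)%C.
Proof.
  intros Hg Hf. pose proof (cderiv_ccont _ _ _ Hg).
  destruct Hg as [q [E1 [C1 H1]]]. destruct Hf as [p [E2 [C2 H2]]].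
  exists (fun z => p (g z) * q z)%C. split; [rewrite E1, E2; auto|]. split.
  { apply ccont_mult; auto. apply ccont_comp; auto. }
  intros z. rewrite (H2 (g z)).
  replace (g z - g s)%C with (q z * (z - s))%C by (rewrite (H1 z); ring). ring.
Qed.

(** The factorization in [cderiv] must hold at every [z]; outside the disc the slope function is
    therefore replaced by the true difference quotient, which does not affect its continuity at
    [s]. *)
Lemma cderiv_ext_loc f g s l r : 0 < r -> (forall z, Cmod (z - s) < r -> f z = g z) ->
  cderiv f s l -> cderiv g s l.
Proof.
  intros Hr H [q [E1 [C1 H1]]].
  exists (fun z => if Rlt_dec (Cmod (z - s)) r then q z else (g z - g s) / (z - s))%C.
  split; [|split].
  - destruct Rlt_dec; auto. rewrite Cmod_diff_0 in n. lra.
  - apply ccont_ext_loc with (f := q) (r := r); auto.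
    intros z Hz. destruct Rlt_dec; auto. lra.
  - intros z. rewrite <- (H s) by (rewrite Cmod_diff_0; auto). destruct Rlt_dec.
    + rewrite <- H; auto.
    + field. apply Cmod_pos_neq. lra.
Qed.

Lemma cderiv_inv f s l : cderiv f s l -> f s <> 0 -> cderiv (fun z => / f z)%C s (- l / (f s * f s))%C.
Proof.
  intros Hf Hn. pose proof (cderiv_ccont _ _ _ Hf) as Hc.
  destruct (Hc (Cmod (f s))) as [d [Hd H]]. { apply Cmod_gt_0; auto. }
  destruct Hf as [q [E1 [C1 H1]]].
  apply cderiv_ext_loc with (f := fun z => (/ f s + (- q z * / (f z * f s)) * (z - s))%C) (r := d); auto.
  { intros z Hz. specialize (H z Hz).
    assert (f z <> 0). { intros E. rewrite E in H.
      replace (0 - f s)%C with (- f s)%C in H by ring. rewrite Cmod_opp in H. lra. }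
    assert (E : (q z * (z - s) = f z - f s)%C) by (rewrite (H1 z); ring).
    transitivity (/ f s - (q z * (z - s)) * / (f z * f s))%C; [ring|].
    rewrite E. field. auto. }
  exists (fun z => - q z * / (f z * f s))%C. split.
  - rewrite E1. field. auto.
  - split.
    + apply ccont_mult.
      * apply ccont_opp. auto.
      * apply ccont_inv. apply ccont_mult; auto. apply ccont_const. apply Cmult_neq_0; auto.
    + intros z. ring.
Qed.

Lemma cderiv_div f g s l m : cderiv f s l -> cderiv g s m -> g s <> 0 ->
  cderiv (fun z => f z / g z)%C s ((l * g s - f s * m) / (g s * g s))%C.
Proof.
  intros. eapply cderiv_eq. apply cderiv_mult. apply H. apply cderiv_inv. apply H0. auto.
  cbv beta. field. auto.
Qed.

Ltac cder := repeat first [eassumption | apply cderiv_const | apply cderiv_id | apply cderiv_minus | apply cderiv_plus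
  | apply cderiv_div | apply cderiv_mult].

Lemma cderiv_pow f s n : (exists l, cderiv f s l) -> exists m, cderiv (fun z => Cpow (f z) n) s m.
Proof.
  intros [l H]. induction n as [|n [m Hm]].
  - exists 0. apply (cderiv_const 1).
  - eexists. apply cderiv_mult. apply H. apply Hm.
Qed.

Lemma cderiv_eps f s l : cderiv f s l <-> (forall e, 0 < e -> exists d, 0 < d /\
  forall z, Cmod (z - s) < d -> Cmod (f z - f s - l * (z - s)) <= e * Cmod (z - s)).
Proof.
  split.
  - intros [q [E1 [C1 H1]]] e He. destruct (C1 e He) as [d [Hd H]].
    exists d. split; auto. intros z Hz. rewrite (H1 z).
    replace (f s + q z * (z - s) - f s - l * (z - s))%C with ((q z - q s) * (z - s))%C
      by (rewrite E1; ring).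
    rewrite Cmod_mult. apply Rmult_le_compat_r. apply Cmod_ge_0. left. auto.
  - intros H.
    exists (fun z => if excluded_middle_informative (z = s) then l else ((f z - f s) / (z - s))%C).
    split; [|split].
    + destruct excluded_middle_informative; tauto.
    + intros e He. destruct (H (e / 2)) as [d [Hd H1]]; [lra|].
      exists d. split; auto. intros z Hz.
      destruct (excluded_middle_informative (s = s)); [|tauto].
      destruct excluded_middle_informative. { rewrite Cmod_diff_0. auto. }
      apply Rle_lt_trans with (e / 2); [|lra].
      assert (0 < Cmod (z - s)). { apply Cmod_gt_0. apply Cminus_neq_0; auto. }
      apply Rmult_le_reg_r with (Cmod (z - s)); auto.
      rewrite <- Cmod_mult.
      replace (((f z - f s) / (z - s) - l) * (z - s))%C with (f z - f s - l * (z - s))%C; auto.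
      field. apply Cminus_neq_0; auto.
    + intros z. destruct excluded_middle_informative.
      * subst. ring.
      * field. apply Cminus_neq_0; auto.
Qed.

Lemma cderiv_is_derive f s l : @is_derive C_AbsRing C_NormedModule f s l <-> cderiv f s l.
Proof.
  rewrite cderiv_eps. split.
  - intros [_ H] e He.
    destruct (H s (fun P HP => HP) (mkposreal e He)) as [d Hd].
    exists d. split; [apply cond_pos|]. intros z Hz.
    specialize (Hd z Hz).
    replace (f z - f s - l * (z - s))%C with ((f z - f s) - (z - s) * l)%C by ring.
    exact Hd.
  - intros H. split. { apply is_linear_scal_l. }
    intros x Hx e.
    assert (x = s) as ->.
    { symmetry. apply (is_filter_lim_locally_unique (K := C_AbsRing) (V := AbsRing_NormedModule C_AbsRing)). exact Hx. }
    destruct (H e (cond_pos e)) as [d [Hd H1]].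
    exists (mkposreal d Hd). intros z Hz. specialize (H1 z Hz).
    replace (f z - f s - l * (z - s))%C with ((f z - f s) - (z - s) * l)%C in H1 by ring.
    exact H1.
Qed.

(** * Mean value inequalities, compactness, the complex exponential *)

Definition rderiv (g : R -> C) (t : R) (v : C) : Prop :=
  is_derive (fun u => Re (g u)) t (Re v) /\ is_derive (fun u => Im (g u)) t (Im v).

Lemma rderiv_line f (a b : C) (t : R) (l : C) :
  cderiv f (a + t * b)%C l -> rderiv (fun u => f (a + u * b)%C) t (l * b)%C.
Proof.
  intros [q [<- [Hq E]]]. set (p := (a + t * b)%C) in *.
  assert (K : forall e, 0 < e -> exists d : posreal, forall x, x <> 0 -> Rabs x < d ->
    Cmod ((f (a + (t + x)%R * b) - f p) * (/ x)%R - q p * b)%C < e).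
  { intros e He. pose proof (Cmod_ge_0 b).
    destruct (Hq (e / (Cmod b + 1))) as [d [Hd H1]]; [pos|].
    assert (P : 0 < d / (Cmod b + 1)) by pos. exists (mkposreal _ P). intros x Hx Hxd.
    apply Rlt_div_r in Hxd; [|lra]. set (z := (a + (t + x)%R * b)%C).
    assert (Ez : (z - p = x * b)%C) by (unfold z, p; rewrite RtoC_plus; ring).
    rewrite (E z), Ez. replace ((f p + q z * (x * b) - f p) * (/ x)%R - q p * b)%C with ((q z - q p) * b)%C.
    2: { rewrite RtoC_inv by auto. field. apply RtoC_neq. auto. }
    specialize (H1 z). rewrite Ez, Cmod_mult, Cmod_R in H1. rewrite Cmod_mult.
    pose proof (Rabs_pos x). assert (H2 := H1 ltac:(nra)). apply Rlt_div_r in H2; [|lra].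
    pose proof (Cmod_ge_0 (q z - q p)). nra. }
  split; apply is_derive_Reals; intros e He; destruct (K e He) as [d Hd]; exists d; intros x Hx Hxd;
    (eapply Rle_lt_trans; [|apply (Hd x Hx Hxd)]).
  - eapply Rle_trans; [|apply re_le_Cmod]. right. f_equal. unfold p, Rdiv. Re_ring.
  - eapply Rle_trans; [|apply Im_Rabs]. right. f_equal. unfold p, Rdiv. Re_ring.
Qed.

(** The mean value theorem fails for complex-valued curves but holds for each real functional
    [Re (c * .)]; the intermediate point depends on [c]. *)
Lemma rderiv_MVT (g : R -> C) (v : R -> C) (a b : R) (c : C) : a <= b ->
  (forall t, a <= t <= b -> rderiv g t (v t)) ->
  exists x, a <= x <= b /\ Re (c * (g b - g a))%C = Re (c * v x)%C * (b - a).
Proof.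
  intros Hab H.
  destruct (MVT_gen (fun u => Re c * Re (g u) - Im c * Im (g u)) a b
    (fun u => Re c * Re (v u) - Im c * Im (v u))) as [x [Hx E]].
  - rewrite Rmin_left, Rmax_right by auto. intros x Hx.
    destruct (H x) as [H1 H2]; [lra|].
    apply @is_derive_minus; apply is_derive_scal; auto.
  - rewrite Rmin_left, Rmax_right by auto. intros x Hx.
    destruct (H x) as [H1 H2]; [lra|].
    apply derivable_continuous_pt. apply ex_derive_Reals_0.
    exists (Re c * Re (v x) - Im c * Im (v x)).
    apply @is_derive_minus; apply is_derive_scal; auto.
  - rewrite Rmin_left, Rmax_right in Hx by auto. exists x. split; auto.
    etransitivity; [|etransitivity; [exact E|]]; unfold Re, Im; simpl; ring.
Qed.

Lemma rderiv_MVI (g : R -> C) (v : R -> C) (a b B : R) : a <= b ->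
  (forall t, a <= t <= b -> rderiv g t (v t)) ->
  (forall t, a <= t <= b -> Cmod (v t) <= B) ->
  Cmod (g b - g a) <= B * (b - a).
Proof.
  (* The functional attached to the conjugate of the increment takes the value [Cmod z ^ 2] on
     it. *)
  intros Hab H HB. set (z := (g b - g a)%C).
  destruct (rderiv_MVT g v a b (Cconj z) Hab H) as [x [Hx E]]. fold z in E.
  assert (E1 : Re (Cconj z * z)%C = Cmod z ^ 2). { rewrite Cmod2_alt. simpl. ring. }
  rewrite E1 in E. pose proof (Re_abs (Cconj z * v x)%C) as Q.
  rewrite Cmod_mult, Cmod_conj in Q. specialize (HB x Hx).
  pose proof (Cmod_ge_0 z). pose proof (Cmod_ge_0 (v x)).
  destruct (Rle_lt_or_eq_dec _ _ H0) as [Hz|Hz].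
  - apply Rmult_le_reg_l with (Cmod z); auto.
    replace (Cmod z * Cmod z) with (Cmod z ^ 2) by ring. rewrite E.
    rewrite <- Rmult_assoc. apply Rmult_le_compat_r; [lra|].
    apply Rle_trans with (1 := proj2 Q). apply Rmult_le_compat_l; lra.
  - rewrite <- Hz. apply Rmult_le_pos; lra.
Qed.

Lemma pow_unbounded (x M : R) : 1 < x -> exists n, M < x ^ n.
Proof.
  intros Hx. destruct (Pow_x_infinity x) with (b := M + 1) as [N HN].
  - rewrite Rabs_pos_eq; lra.
  - exists N. specialize (HN N (Nat.le_refl _)). rewrite Rabs_pos_eq in HN. lra.
    apply pow_le. lra.
Qed.

Lemma pow2_small A e : 0 < e -> exists N, A / 2 ^ N < e.
Proof.
  intros He. destruct (pow_unbounded 2 (A / e)) as [N HN]; [lra|]. exists N.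
  apply Rlt_div_l in HN; auto. apply Rlt_div_l. apply pow_lt; lra. lra.
Qed.

Lemma line_0 (a b : C) : (a + 0%R * (b - a))%C = a.
Proof. ring. Qed.
Lemma line_1 (a b : C) : (a + 1%R * (b - a))%C = b.
Proof. ring. Qed.

Lemma cderiv_MVT (f f' : C -> C) (a b c : C) :
  (forall t : R, 0 <= t <= 1 -> cderiv f (a + t * (b - a))%C (f' (a + t * (b - a))%C)) ->
  exists t : R, 0 <= t <= 1 /\
    Re (c * (f b - f a))%C = Re (c * (f' (a + t * (b - a)) * (b - a)))%C.
Proof.
  intros H.
  destruct (rderiv_MVT (fun u => f (a + u * (b - a))%C) (fun u => f' (a + u * (b - a)) * (b - a))%C 0 1 c)
    as [x [Hx E]].
  - lra.
  - intros t Ht. apply rderiv_line. auto.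
  - rewrite line_0, line_1 in E. exists x. split; auto. rewrite E. ring.
Qed.

Lemma cderiv_MVI (f f' : C -> C) (a b : C) (B : R) :
  (forall t : R, 0 <= t <= 1 -> cderiv f (a + t * (b - a))%C (f' (a + t * (b - a))%C)) ->
  (forall t : R, 0 <= t <= 1 -> Cmod (f' (a + t * (b - a))%C) <= B) ->
  Cmod (f b - f a) <= B * Cmod (b - a).
Proof.
  intros H HB.
  pose proof (rderiv_MVI (fun u => f (a + u * (b - a))%C) (fun u => f' (a + u * (b - a)) * (b - a))%C 0 1
    (B * Cmod (b - a))) as Q. cbv beta in Q.
  rewrite line_0, line_1 in Q. rewrite Rminus_0_r, Rmult_1_r in Q. apply Q.
  - lra.
  - intros t Ht. apply rderiv_line. auto.
  - intros t Ht. rewrite Cmod_mult. apply Rmult_le_compat_r. apply Cmod_ge_0. auto.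
Qed.

(** Compactness in directed form: an index that works near each point can be replaced by one that
    works on all of [K]. The local hypothesis also concerns points outside [K], because a whole
    square is covered; for closed [K] it is vacuous there. *)
Lemma compact_directed (K : C -> Prop) (D : R) (W : Type) (P : C -> W -> Prop) (w0 : W) :
  (forall s, K s -> Cmod s <= D) ->
  (forall w w', exists w'', forall z, P z w \/ P z w' -> P z w'') ->
  (forall s, exists d, 0 < d /\ exists w, forall z, K z -> Cmod (z - s) < d -> P z w) ->
  exists w, forall z, K z -> P z w.
Proof.
  intros HD Hdir Hc. apply NNPP. intros Hno.
  destruct (functional_choice _ _ _ Hc) as [df Hdf].
  set (pt := fun t : Compactness.Tn 2 R => (fst t, fst (snd t)) : C).
  (* Half the radius: closeness holds in each coordinate, and the modulus is at most the sum of the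
     two. *)
  assert (Hp : forall t, 0 < df (pt t) / 2). { intros t. destruct (Hdf (pt t)). lra. }
  (* The finite cover is given under a double negation, which the goal [False] absorbs. *)
  apply (compactness_list 2 (- D, (- D, tt)) (D, (D, tt)) (fun t => mkposreal _ (Hp t))).
  intros [l Hl].
  assert (HM : exists w, forall t, In t l -> forall z, K z -> Cmod (z - pt t) < df (pt t) -> P z w).
  { clear Hl. induction l as [|t l IH].
    - exists w0. intros t [].
    - destruct IH as [w Hw]. destruct (Hdf (pt t)) as [_ [w' Hw']].
      destruct (Hdir w w') as [w'' H'']. exists w''.
      intros t' [<-|Ht] z Kz Hz; apply H''; eauto. }
  destruct HM as [w Hw]. apply Hno. exists w. intros y Ky.
  destruct (Hl (Re y, (Im y, tt))) as [t [Ht [_ Hclose]]].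
  { specialize (HD y Ky). pose proof (Re_abs y). pose proof (Im_abs y). repeat split; lra. }
  apply (Hw _ Ht); auto. destruct t as [t1 [t2 []]].
  eapply Rle_lt_trans. apply Cmod_le_ReIm.
  unfold Re, Im in *. simpl in *. unfold Rminus in *. lra.
Qed.

(** Without a maximum every point of [K] is locally beaten by some [y] in [K]; by compactness a
    single [y] beats all of [K], itself included. *)
Lemma extreme_value (K : C -> Prop) (u : C -> C) (D : R) (y0 : C) :
  K y0 -> (forall s, K s -> Cmod s <= D) ->
  (forall s, ~ K s -> exists d, 0 < d /\ forall z, Cmod (z - s) < d -> ~ K z) ->
  (forall s, K s -> ccont u s) -> exists p, K p /\ forall s, K s -> Re (u s) <= Re (u p).
Proof.
  intros H0 HD Hcl Hu. apply NNPP. intros Hno.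
  destruct (compact_directed K D {y | K y} (fun z y => Re (u z) < Re (u (proj1_sig y))) (exist _ y0 H0) HD)
    as [[y Ky] Hy].
  - intros [y Ky] [y' Ky']. destruct (Rle_dec (Re (u y)) (Re (u y'))).
    + exists (exist _ y' Ky'). simpl. intros z [Hz|Hz]; lra.
    + exists (exist _ y Ky). simpl. intros z [Hz|Hz]; lra.
  - intros s. destruct (classic (K s)) as [Ks|Ks].
    + assert (exists y, K y /\ Re (u s) < Re (u y)) as [y [Ky Hy]].
      { apply NNPP. intros Q. apply Hno. exists s. split; auto. intros z Kz.
        apply Rnot_lt_le. intros Hz. apply Q. exists z. auto. }
      destruct (Hu s Ks (Re (u y) - Re (u s))) as [d [Hd H]]; [lra|].
      exists d. split; auto. exists (exist _ y Ky). simpl. intros z Kz Hz.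
      specialize (H z Hz). pose proof (Re_near (u z) (u s)). lra.
    + destruct (Hcl s Ks) as [d [Hd H]]. exists d. split; auto.
      exists (exist _ y0 H0). intros z Kz Hz. destruct (H z Hz Kz).
  - simpl in Hy. specialize (Hy y Ky). lra.
Qed.

Lemma Cexp_0 : Cexp 0 = 1.
Proof. unfold Cexp. simpl. rewrite exp_0, cos_0, sin_0. apply C_eq; simpl; ring. Qed.

Lemma Cexp_plus (a b : C) : Cexp (a + b) = (Cexp a * Cexp b)%C.
Proof.
  unfold Cexp. apply C_eq; unfold Re, Im; simpl; rewrite exp_plus; [rewrite cos_plus|rewrite sin_plus]; ring.
Qed.

Lemma Cmod_Cexp (a : C) : Cmod (Cexp a) = exp (Re a).
Proof.
  pose proof (exp_pos (Re a)). pose proof (Cmod_ge_0 (Cexp a)).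
  assert (E : Cmod (Cexp a) ^ 2 = exp (Re a) ^ 2).
  { rewrite Cmod2_alt. simpl.
    pose proof (sin2_cos2 (Im a)) as Q. unfold Rsqr in Q.
    replace (exp (Re a) * cos (Im a) * (exp (Re a) * cos (Im a) * 1) +
      exp (Re a) * sin (Im a) * (exp (Re a) * sin (Im a) * 1)) with
      (exp (Re a) * exp (Re a) * (sin (Im a) * sin (Im a) + cos (Im a) * cos (Im a))) by ring.
    rewrite Q. ring. }
  nra.
Qed.

Lemma Cexp_opp (a : C) : (Cexp a * Cexp (- a) = 1)%C.
Proof. rewrite <- Cexp_plus. replace (a + - a)%C with (RtoC 0) by ring. apply Cexp_0. Qed.

Lemma Cexp_pow (a : C) (n : nat) : Cexp (INR n * a) = Cpow (Cexp a) n.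
Proof.
  induction n as [|n IH].
  - simpl. replace (0 * a)%C with (RtoC 0) by ring. apply Cexp_0.
  - simpl Cpow. rewrite <- IH, <- Cexp_plus, S_INR. f_equal. rewrite RtoC_plus. ring.
Qed.

Lemma rderiv_Cexp (z : C) (t : R) : rderiv (fun u => Cexp (u * z)) t (z * Cexp (t * z))%C.
Proof.
  split; unfold Cexp; simpl; auto_derive; auto; unfold Re, Im; simpl;
    unfold Rminus; rewrite ?Rmult_0_l, ?Ropp_0, ?Rplus_0_r; ring.
Qed.

Lemma exp_le (a b : R) : a <= b -> exp a <= exp b.
Proof. intros [H|H]; [left; apply exp_increasing; auto|right; rewrite H; auto]. Qed.

Lemma Cexp_lin (z : C) : Cmod (Cexp z - 1) <= Cmod z * exp (Cmod z).
Proof.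
  pose proof (rderiv_MVI (fun u => Cexp (u * z)) (fun u => z * Cexp (u * z))%C 0 1
    (Cmod z * exp (Cmod z))) as Q. cbv beta in Q.
  replace (1%R * z)%C with z in Q by ring. replace (0%R * z)%C with (RtoC 0) in Q by ring.
  rewrite Cexp_0, Rminus_0_r, Rmult_1_r in Q. apply Q.
  - lra.
  - intros. apply rderiv_Cexp.
  - intros t Ht. rewrite Cmod_mult, Cmod_Cexp. apply Rmult_le_compat_l. apply Cmod_ge_0.
    apply exp_le. pose proof (Re_abs z).
    replace (Re (t * z)%C) with (t * Re z) by Re_ring. nra.
Qed.

Lemma Cexp_quad (z : C) : Cmod (Cexp z - 1 - z) <= Cmod z ^ 2 * exp (Cmod z).
Proof.
  pose proof (rderiv_MVI (fun u => Cexp (u * z) - u * z)%C (fun u => z * (Cexp (u * z) - 1))%C 0 1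
    (Cmod z ^ 2 * exp (Cmod z))) as Q. cbv beta in Q.
  replace (1%R * z)%C with z in Q by ring. replace (0%R * z)%C with (RtoC 0) in Q by ring.
  rewrite Cexp_0, Rminus_0_r, Rmult_1_r in Q.
  replace (Cexp z - 1 - z)%C with (Cexp z - z - (1 - 0))%C by ring. apply Q.
  - lra.
  - intros t _. split; unfold Cexp; simpl; auto_derive; auto; unfold Re, Im; simpl;
      unfold Rminus; rewrite ?Rmult_0_l, ?Ropp_0, ?Rplus_0_r; ring.
  - intros t Ht. rewrite Cmod_mult. pose proof (Cmod_ge_0 z).
    replace (Cmod z ^ 2 * exp (Cmod z)) with (Cmod z * (Cmod z * exp (Cmod z))) by ring.
    apply Rmult_le_compat_l; auto.
    assert (Cmod (t * z) <= Cmod z).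
    { rewrite Cmod_mult, Cmod_R, Rabs_pos_eq by lra. nra. }
    apply Rle_trans with (1 := Cexp_lin _).
    apply Rmult_le_compat; auto. apply Cmod_ge_0. left; apply exp_pos. apply exp_le; auto.
Qed.

Lemma cderiv_Cexp (s : C) : cderiv Cexp s (Cexp s).
Proof.
  apply cderiv_eps. intros e He.
  pose proof (exp_pos (Re s)). pose proof (exp_pos 1).
  set (M := exp (Re s) * exp 1). assert (0 < M) by pos.
  exists (Rmin 1 (e / M)). split. { pos. }
  intros z Hz. set (w := (z - s)%C) in *.
  destruct (Rmin_Rgt_l _ _ _ Hz) as [A1 A2].
  replace (Cexp z - Cexp s - Cexp s * w)%C with (Cexp s * (Cexp w - 1 - w))%C.
  2: { replace z with (s + w)%C by (unfold w; ring). rewrite Cexp_plus. ring. }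
  rewrite Cmod_mult, Cmod_Cexp.
  pose proof (Cexp_quad w). pose proof (Cmod_ge_0 w).
  assert (exp (Cmod w) <= exp 1) by (apply exp_le; lra).
  assert (M * Cmod w <= e). { rewrite Rmult_comm. apply Rle_div_r; lra. }
  apply Rle_trans with (exp (Re s) * (Cmod w ^ 2 * exp 1)).
  { apply Rmult_le_compat_l; [lra|]. eapply Rle_trans; [exact H2|].
    apply Rmult_le_compat_l; auto. apply pow2_ge_0. }
  replace (exp (Re s) * (Cmod w ^ 2 * exp 1)) with ((M * Cmod w) * Cmod w) by (unfold M; ring).
  apply Rmult_le_compat_r; auto.
Qed.

(** * Goursat's theorem and primitives *)

Lemma rderiv_affine (g : R -> C) (al be t : R) (v : C) :
  rderiv g (al + be * t) v -> rderiv (fun u => g (al + be * u)) t (be * v)%C.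
Proof.
  intros [H1 H2]. split.
  - replace (Re (be * v)%C) with (be * Re v) by Re_ring.
    apply (is_derive_comp (fun u => Re (g u)) (fun u => al + be * u)); auto.
    auto_derive; auto; ring.
  - replace (Im (be * v)%C) with (be * Im v) by Re_ring.
    apply (is_derive_comp (fun u => Im (g u)) (fun u => al + be * u)); auto.
    auto_derive; auto; ring.
Qed.

Lemma rderiv_minus (g h : R -> C) (t : R) (v w : C) :
  rderiv g t v -> rderiv h t w -> rderiv (fun u => g u - h u)%C t (v - w)%C.
Proof. intros [H1 H2] [H3 H4]. split; apply @is_derive_minus; auto. Qed.

Definition seg (a b : C) (u : R) : C := (a + u * (b - a))%C.

Definition seg_prim (f : C -> C) (a b : C) (G : R -> C) : Prop :=
  forall t, 0 <= t <= 1 -> rderiv G t (f (seg a b t) * (b - a))%C.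

Definition seg_cont (f : C -> C) (a b : C) : Prop :=
  forall t, 0 <= t <= 1 -> ccont f (seg a b t).

(* Clamping makes the integrand continuous on the whole line, as [is_derive_RInt] needs at 0 and 1. *)
Definition clamp (u : R) : R := Rmax 0 (Rmin 1 u).

Lemma clamp_01 u : 0 <= clamp u <= 1.
Proof. split. apply Rmax_l. apply Rmax_lub; [lra|apply Rmin_l]. Qed.

Lemma clamp_id u : 0 <= u <= 1 -> clamp u = u.
Proof. intros. unfold clamp. rewrite Rmin_right, Rmax_right; lra. Qed.

Lemma clamp_lip u v : Rabs (clamp u - clamp v) <= Rabs (u - v).
Proof.
  unfold clamp, Rmax, Rmin.
  repeat destruct Rle_dec; apply Rabs_le_between; unfold Rabs; destruct Rcase_abs; lra.
Qed.

Definition seg_path (f : C -> C) (a b : C) (u : R) : C := (f (seg a b (clamp u)) * (b - a))%C.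

Definition segint (f : C -> C) (a b : C) : C :=
  (RInt (fun u => Re (seg_path f a b u)) 0 1, RInt (fun u => Im (seg_path f a b u)) 0 1).

Lemma seg_dist a b u v : Cmod (seg a b u - seg a b v) = Rabs (u - v) * Cmod (b - a).
Proof.
  replace (seg a b u - seg a b v)%C with ((u - v)%R * (b - a))%C.
  rewrite Cmod_mult, Cmod_R. auto. unfold seg. rewrite RtoC_minus. ring.
Qed.

Lemma seg_path_cont f a b : seg_cont f a b -> forall t e, 0 < e -> exists d, 0 < d /\
  forall u, Rabs (u - t) < d -> Cmod (seg_path f a b u - seg_path f a b t) < e.
Proof.
  intros H t e He. pose proof (Cmod_ge_0 (b - a)) as P.
  destruct (H (clamp t) (clamp_01 t) (e / (Cmod (b - a) + 1))) as [d [Hd H1]].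
  { pos. }
  exists (d / (Cmod (b - a) + 1)). split. { pos. }
  intros u Hu. unfold seg_path.
  replace (f (seg a b (clamp u)) * (b - a) - f (seg a b (clamp t)) * (b - a))%C
    with ((f (seg a b (clamp u)) - f (seg a b (clamp t))) * (b - a))%C by ring.
  rewrite Cmod_mult.
  pose proof (clamp_lip u t). pose proof (Rabs_pos (u - t)).
  assert (Rabs (u - t) * (Cmod (b - a) + 1) < d) by (apply Rlt_div_r; lra).
  specialize (H1 (seg a b (clamp u))). rewrite seg_dist in H1.
  assert (Rabs (clamp u - clamp t) * Cmod (b - a) < d) by nra.
  specialize (H1 H4). apply Rlt_div_r in H1; [|lra].
  nra.
Qed.

Lemma seg_path_parts_cont f a b : seg_cont f a b -> forall t,
  continuous (fun u => Re (seg_path f a b u)) t /\ continuous (fun u => Im (seg_path f a b u)) t.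
Proof.
  intros H t. split; apply continuity_pt_filterlim; intros e He;
  destruct (seg_path_cont f a b H t e He) as [d [Hd H1]]; exists d; (split; [auto|]);
  intros u [_ Hu]; specialize (H1 u Hu); unfold dist; simpl; unfold R_dist;
  (eapply Rle_lt_trans; [|exact H1]).
  - apply (re_le_Cmod (seg_path f a b u - seg_path f a b t)).
  - apply Rabs_le_between. apply (Im_abs (seg_path f a b u - seg_path f a b t)).
Qed.

Lemma seg_prim_ex f a b : seg_cont f a b ->
  exists G, seg_prim f a b G /\ (G 1 - G 0)%C = segint f a b.
Proof.
  intros H. pose proof (seg_path_parts_cont f a b H) as Hc.
  exists (fun t => (RInt (fun u => Re (seg_path f a b u)) 0 t, RInt (fun u => Im (seg_path f a b u)) 0 t)).
  split.
  - intros t Ht.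
    replace (f (seg a b t) * (b - a))%C with (seg_path f a b t)
      by (unfold seg_path; rewrite clamp_id; auto).
    split.
    + apply (is_derive_RInt (fun u => Re (seg_path f a b u))
        (fun t => RInt (fun u => Re (seg_path f a b u)) 0 t) 0 t).
      * apply filter_forall. intros x. apply @RInt_correct, @ex_RInt_continuous.
        intros z _. exact (proj1 (Hc z)).
      * exact (proj1 (Hc t)).
    + apply (is_derive_RInt (fun u => Im (seg_path f a b u))
        (fun t => RInt (fun u => Im (seg_path f a b u)) 0 t) 0 t).
      * apply filter_forall. intros x. apply @RInt_correct, @ex_RInt_continuous.
        intros z _. exact (proj2 (Hc z)).
      * exact (proj2 (Hc t)).
  - rewrite !RInt_point. apply C_eq; unfold Re, Im; simpl; unfold zero; simpl; ring.
Qed.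

(** Estimates the integral of [f - g] without integrating [g]: along the segment, a primitive of [f]
    minus [A] has a derivative bounded by [B * Cmod (b - a)]. *)
Lemma seg_approx f g A a b B : seg_cont f a b ->
  (forall t, 0 <= t <= 1 -> cderiv A (seg a b t) (g (seg a b t))) ->
  (forall t, 0 <= t <= 1 -> Cmod (f (seg a b t) - g (seg a b t)) <= B) ->
  Cmod (segint f a b - (A b - A a)) <= B * Cmod (b - a).
Proof.
  intros Hf HA HB. destruct (seg_prim_ex f a b Hf) as [G [HG <-]].
  pose proof (rderiv_MVI (fun t => G t - A (seg a b t))%C
    (fun t => f (seg a b t) * (b - a) - g (seg a b t) * (b - a))%C 0 1 (B * Cmod (b - a))) as Q.
  cbv beta in Q. replace (seg a b 1) with b in Q by (unfold seg; ring).
  replace (seg a b 0) with a in Q by (unfold seg; ring).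
  rewrite Rminus_0_r, Rmult_1_r in Q.
  replace (G 1 - G 0 - (A b - A a))%C with (G 1 - A b - (G 0 - A a))%C by ring.
  apply Q; [lra| |].
  - intros t Ht. apply rderiv_minus. apply HG; auto. apply rderiv_line. apply HA. auto.
  - intros t Ht.
    replace (f (seg a b t) * (b - a) - g (seg a b t) * (b - a))%C
      with ((f (seg a b t) - g (seg a b t)) * (b - a))%C by ring.
    rewrite Cmod_mult. apply Rmult_le_compat_r. apply Cmod_ge_0. auto.
Qed.

(** Reduces identities between integrals, such as reversal and halving of a segment, to the
    reparametrization of one primitive. *)
Lemma seg_prim_unique f a b G : seg_cont f a b -> seg_prim f a b G -> (G 1 - G 0)%C = segint f a b.
Proof.
  intros Hf HG. destruct (seg_prim_ex f a b Hf) as [G' [HG' <-]].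
  apply Cminus_0_eq, Cmod_zero_le.
  replace (G 1 - G 0 - (G' 1 - G' 0))%C with (G 1 - G' 1 - (G 0 - G' 0))%C by ring.
  apply Rle_trans with (0 * (1 - 0)); [|right; ring].
  apply (rderiv_MVI (fun t => G t - G' t)%C
    (fun t => f (seg a b t) * (b - a) - f (seg a b t) * (b - a))%C); [lra| |].
  - intros t Ht. apply rderiv_minus; auto.
  - intros t Ht. rewrite Cmod_diff_0. lra.
Qed.

Definition mid (a b : C) : C := ((a + b) * (/ 2)%R)%C.

Lemma segint_rev f a b : seg_cont f a b -> segint f b a = (- segint f a b)%C.
Proof.
  intros Hf. destruct (seg_prim_ex f a b Hf) as [G [HG <-]].
  assert (E : forall t, seg b a t = seg a b (1 + -1 * t)).
  { intros t. C_ring. }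
  rewrite <- (seg_prim_unique f b a (fun t => G (1 + -1 * t))).
  - replace (1 + -1 * 1) with 0 by ring. replace (1 + -1 * 0) with 1 by ring. ring.
  - intros t Ht. rewrite E. apply Hf. lra.
  - intros t Ht. rewrite E.
    replace (f (seg a b (1 + -1 * t)) * (a - b))%C
      with ((-1)%R * (f (seg a b (1 + -1 * t)) * (b - a)))%C.
    apply rderiv_affine. apply HG. lra. C_ring.
Qed.

Lemma segint_mid f a b : seg_cont f a b ->
  segint f a b = (segint f a (mid a b) + segint f (mid a b) b)%C.
Proof.
  intros Hf. destruct (seg_prim_ex f a b Hf) as [G [HG <-]].
  assert (E1 : forall t, seg a (mid a b) t = seg a b (0 + /2 * t)).
  { intros t. C_field. }
  assert (E2 : forall t, seg (mid a b) b t = seg a b (/2 + /2 * t)).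
  { intros t. C_field. }
  rewrite <- (seg_prim_unique f a (mid a b) (fun t => G (0 + /2 * t))).
  rewrite <- (seg_prim_unique f (mid a b) b (fun t => G (/2 + /2 * t))).
  - replace (/2 + /2 * 1) with 1 by field. replace (0 + /2 * 0) with 0 by ring.
    replace (0 + /2 * 1) with (/2) by ring. replace (/2 + /2 * 0) with (/2) by ring. ring.
  - intros t Ht. rewrite E2. apply Hf. lra.
  - intros t Ht. rewrite E2.
    replace (f (seg a b (/2 + /2 * t)) * (b - mid a b))%C
      with ((/2)%R * (f (seg a b (/2 + /2 * t)) * (b - a)))%C.
    apply rderiv_affine. apply HG. lra. C_field.
  - intros t Ht. rewrite E1. apply Hf. lra.
  - intros t Ht. rewrite E1.
    replace (f (seg a b (0 + /2 * t)) * (mid a b - a))%C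
      with ((/2)%R * (f (seg a b (0 + /2 * t)) * (b - a)))%C.
    apply rderiv_affine. apply HG. lra. C_field.
Qed.

(** * Limits of complex sequences, closed and convex sets *)

Definition Ccvg (x : nat -> C) (l : C) : Prop :=
  forall e, 0 < e -> exists N, forall n, (N <= n)%nat -> Cmod (x n - l) < e.

Lemma Ccvg_bound x l c B : Ccvg x l -> (exists N0, forall n, (N0 <= n)%nat -> Cmod (x n - c) <= B) -> Cmod (l - c) <= B.
Proof.
  intros Hx [N0 H0]. apply le_epsilon. intros e He. destruct (Hx e He) as [N HN].
  specialize (HN (max N N0) ltac:(lia)). specialize (H0 (max N N0) ltac:(lia)).
  pose proof (Cmod_tri l (x (max N N0)) c). rewrite (Cmod_sym l (x (max N N0))) in H. lra.
Qed.

Lemma Ccvg_cauchy x : (forall e, 0 < e -> exists N, forall n, (N <= n)%nat -> Cmod (x n - x N) <= e) ->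
  exists l, Ccvg x l.
Proof.
  intros H.
  assert (HR : forall g : C -> R, (forall a b, Rabs (g a - g b) <= Cmod (a - b)) ->
    exists l, Un_cv (fun n => g (x n)) l).
  { intros g Hg. destruct (Rcomplete.R_complete (fun n => g (x n))) as [l Hl]; [|exists l; auto].
    intros e He. destruct (H (e / 3)) as [N HN]; [lra|]. exists N. intros n m Hn Hm.
    eapply Rle_lt_trans. apply Hg. pose proof (HN n Hn). pose proof (HN m Hm).
    pose proof (Cmod_tri (x n) (x N) (x m)). rewrite (Cmod_sym (x N)) in H2. lra. }
  destruct (HR Re) as [l1 H1]. { intros. apply (re_le_Cmod (a - b)). }
  destruct (HR Im) as [l2 H2]. { intros. apply Rabs_le_between. apply (Im_abs (a - b)). }
  exists (l1, l2). intros e He. destruct (H1 (e / 2)) as [N HN]; [lra|].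
  destruct (H2 (e / 2)) as [N' HN']; [lra|]. exists (max N N'). intros n Hn.
  specialize (HN n ltac:(lia)). specialize (HN' n ltac:(lia)). unfold R_dist in *.
  eapply Rle_lt_trans. apply Cmod_le_ReIm.
  change (Rabs (Re (x n) - l1) + Rabs (Im (x n) - l2) < e). lra.
Qed.

Lemma C_geom_cauchy (x : nat -> C) (A : R) : 0 <= A ->
  (forall n, Cmod (x (S n) - x n) <= A / 2 ^ n) ->
  exists l, forall n, Cmod (x n - l) <= 2 * A / 2 ^ n.
Proof.
  intros HA H.
  assert (P2 : forall n, 0 < 2 ^ n) by (intros; pos).
  assert (D : forall n k, Cmod (x (n + k)%nat - x n) <= 2 * A / 2 ^ n - 2 * A / 2 ^ (n + k)).
  { intros n k. induction k as [|k IH].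
    - rewrite Nat.add_0_r, Cmod_diff_0. lra.
    - rewrite Nat.add_succ_r. specialize (H (n + k)%nat).
      pose proof (Cmod_tri (x (S (n + k))) (x (n + k)%nat) (x n)).
      replace (2 * A / 2 ^ S (n + k)) with (A / 2 ^ (n + k))
        by (simpl; field; apply Rgt_not_eq, P2).
      lra. }
  assert (D' : forall n m, (n <= m)%nat -> Cmod (x m - x n) <= 2 * A / 2 ^ n).
  { intros n m Hm. replace m with (n + (m - n))%nat by lia. eapply Rle_trans. apply D.
    assert (0 <= 2 * A / 2 ^ (n + (m - n))) by pos. lra. }
  destruct (Ccvg_cauchy x) as [l Hl].
  { intros e He. destruct (pow2_small (2 * A) e He) as [N HN]. exists N. intros n Hn.
    specialize (D' N n Hn). lra. }
  exists l. intros n. rewrite Cmod_sym. eapply Ccvg_bound. apply Hl. exists n. auto.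
Qed.

Definition Cconvex (K : C -> Prop) : Prop :=
  forall a b t, K a -> K b -> 0 <= t <= 1 -> K (seg a b t).

Definition Cclosed (K : C -> Prop) : Prop :=
  forall s, ~ K s -> exists d, 0 < d /\ forall z, Cmod (z - s) < d -> ~ K z.

Lemma Cclosed_lim K p : Cclosed K -> (forall e, 0 < e -> exists z, K z /\ Cmod (z - p) < e) -> K p.
Proof.
  intros H Hp. apply NNPP. intros Hn. destruct (H p Hn) as [d [Hd H1]].
  destruct (Hp d Hd) as [z [Kz Hz]]. destruct (H1 z Hz Kz).
Qed.

Lemma mid_seg a b : mid a b = seg a b (/2).
Proof. C_field. Qed.

Section Goursat.
Variables (K : C -> Prop) (f : C -> C).
Hypothesis (Kconv : Cconvex K) (Kclosed : Cclosed K).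
Hypothesis Hf : forall s, K s -> exists l, cderiv f s l.

Let tri := (C * C * C)%type.
Let TI (T : tri) : C := let '(a, b, c) := T in (segint f a b + segint f b c + segint f c a)%C.
Let per (T : tri) : R := let '(a, b, c) := T in Cmod (b - a) + Cmod (c - b) + Cmod (a - c).
Let inK (T : tri) : Prop := let '(a, b, c) := T in K a /\ K b /\ K c.
Let pa (T : tri) : C := fst (fst T).

Lemma K_seg_cont a b : K a -> K b -> seg_cont f a b.
Proof. intros Ha Hb t Ht. destruct (Hf (seg a b t)) as [l Hl]. auto. eapply cderiv_ccont; eauto. Qed.

Lemma K_mid a b : K a -> K b -> K (mid a b).
Proof. intros. rewrite mid_seg. apply Kconv; auto. lra. Qed.

Lemma Cmod_half (z : C) : Cmod (z * (/ 2)%R)%C = Cmod z / 2.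
Proof. rewrite Cmod_mult, Cmod_R, Rabs_pos_eq by lra. reflexivity. Qed.

Ltac half := rewrite <- Cmod_half; apply (f_equal Cmod); unfold mid; C_field.

(** The midpoints cut the triangle into four and the inner sides cancel, so one of the four pieces
    carries at least a quarter of the integral. *)
Lemma goursat_step T : inK T -> exists T', inK T' /\ Cmod (TI T) <= 4 * Cmod (TI T') /\
  per T' = per T / 2 /\ Cmod (pa T' - pa T) <= per T.
Proof.
  destruct T as [[a b] c]. intros [Ka [Kb Kc]].
  pose proof (Cmod_ge_0 (b - a)) as Ga. pose proof (Cmod_ge_0 (c - b)) as Gb.
  pose proof (Cmod_ge_0 (a - c)) as Gc.
  set (x := mid a b). set (y := mid b c). set (z := mid c a).
  assert (Kx : K x) by (apply K_mid; auto). assert (Ky : K y) by (apply K_mid; auto).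
  assert (Kz : K z) by (apply K_mid; auto).
  assert (Hxy : Cmod (y - x) = Cmod (a - c) / 2) by (rewrite Cmod_sym; half).
  assert (Hyz : Cmod (z - y) = Cmod (b - a) / 2) by (rewrite Cmod_sym; half).
  assert (Hzx : Cmod (x - z) = Cmod (c - b) / 2) by (rewrite Cmod_sym; half).
  assert (Hxa : Cmod (x - a) = Cmod (b - a) / 2) by half.
  assert (Hbx : Cmod (b - x) = Cmod (b - a) / 2) by half.
  assert (Hyb : Cmod (y - b) = Cmod (c - b) / 2) by half.
  assert (Hcy : Cmod (c - y) = Cmod (c - b) / 2) by half.
  assert (Hzc : Cmod (z - c) = Cmod (a - c) / 2) by half.
  assert (Haz : Cmod (a - z) = Cmod (a - c) / 2) by half.
  assert (E : TI (a, b, c) = (TI (a, x, z) + TI (x, b, y) + TI (z, y, c) + TI (x, y, z))%C).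
  { unfold TI.
    rewrite (segint_mid f a b), (segint_mid f b c), (segint_mid f c a) by (apply K_seg_cont; auto).
    fold x y z.
    rewrite (segint_rev f x z), (segint_rev f y x), (segint_rev f z y) by (apply K_seg_cont; auto).
    ring. }
  assert (Q : Cmod (TI (a, b, c)) <= Cmod (TI (a, x, z)) + Cmod (TI (x, b, y)) + Cmod (TI (z, y, c)) + Cmod (TI (x, y, z))).
  { rewrite E. eapply Rle_trans. apply Cmod_triangle. apply Rplus_le_compat_r.
    eapply Rle_trans. apply Cmod_triangle. apply Rplus_le_compat_r. apply Cmod_triangle. }
  assert (Hx0 : Cmod (x - a) <= per (a, b, c)) by (unfold per; lra).
  assert (Hz0 : Cmod (z - a) <= per (a, b, c)) by (rewrite Cmod_sym; unfold per; lra).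
  destruct (Rle_dec (Cmod (TI (a, b, c))) (4 * Cmod (TI (a, x, z)))) as [C1|C1].
  { exists (a, x, z). split; [simpl; auto|]. split; auto. split. unfold per. rewrite (Cmod_sym z x). lra.
    cbn [fst]. rewrite Cmod_diff_0. lra. }
  destruct (Rle_dec (Cmod (TI (a, b, c))) (4 * Cmod (TI (x, b, y)))) as [C2|C2].
  { exists (x, b, y). split; [simpl; auto|]. split; auto. split. unfold per. rewrite (Cmod_sym x y). lra. auto. }
  destruct (Rle_dec (Cmod (TI (a, b, c))) (4 * Cmod (TI (z, y, c)))) as [C3|C3].
  { exists (z, y, c). split; [simpl; auto|]. split; auto. split. unfold per. rewrite (Cmod_sym y z). lra. auto. }
  exists (x, y, z). split; [simpl; auto|]. split. lra. split. unfold per. lra. auto.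
Qed.

(** The nested triangles shrink to a point [p] of [K]. With [r = P / 2 ^ N] the perimeter, each side
    lies within [5 * r] of [p], so [f] differs from its linearization by at most [e * (5 * r)] and
    the integral is at most [5 * e * r * r]. The factor [4 ^ N] lost in the subdivision turns this
    into [5 * e * P * P]. *)
Lemma goursat a b c : K a -> K b -> K c -> (segint f a b + segint f b c + segint f c a = 0)%C.
Proof.
  intros Ka Kb Kc.
  destruct (functional_choice _ _ (fun T T' => inK T -> inK T' /\ Cmod (TI T) <= 4 * Cmod (TI T') /\
    per T' = per T / 2 /\ Cmod (pa T' - pa T) <= per T)) as [nxt Hn].
  { intros T. destruct (classic (inK T)) as [HT|HT]; [|exists T; tauto].
    destruct (goursat_step T HT) as [T' H]. exists T'. auto. }
  set (sq := fix sq n := match n with O => (a, b, c) | S n => nxt (sq n) end : tri).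
  set (P := per (a, b, c)).
  assert (P2 : forall n, 0 < 2 ^ n) by (intros; pos).
  assert (HP : 0 <= P). { unfold P, per. pose proof (Cmod_ge_0 (b - a)). pose proof (Cmod_ge_0 (c - b)).
    pose proof (Cmod_ge_0 (a - c)). lra. }
  assert (HK : forall n, inK (sq n)). { induction n. simpl; auto. apply Hn. auto. }
  assert (Hper : forall n, per (sq n) = P / 2 ^ n).
  { induction n. unfold P. simpl. field. simpl sq. destruct (Hn _ (HK n)) as [_ [_ [-> _]]].
    rewrite IHn. simpl. field. apply Rgt_not_eq, P2. }
  assert (HT : forall n, Cmod (TI (a, b, c)) <= 2 ^ n * 2 ^ n * Cmod (TI (sq n))).
  { induction n. simpl sq. lra. simpl sq. destruct (Hn _ (HK n)) as [_ [H _]].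
    eapply Rle_trans. apply IHn. simpl pow.
    replace (2 * 2 ^ n * (2 * 2 ^ n) * Cmod (TI (nxt (sq n)))) with (2 ^ n * 2 ^ n * (4 * Cmod (TI (nxt (sq n))))) by ring.
    apply Rmult_le_compat_l; auto. nra. }
  destruct (C_geom_cauchy (fun n => pa (sq n)) P HP) as [p Hp].
  { intros n. rewrite <- Hper. apply Hn. auto. }
  assert (Kp : K p).
  { apply Cclosed_lim; auto. intros e He. destruct (pow2_small (2 * P) e He) as [N HN].
    exists (pa (sq N)). split. specialize (HK N). destruct (sq N) as [[a' b'] c']. apply HK.
    eapply Rle_lt_trans; [apply Hp|]. auto. }
  destruct (Hf p Kp) as [l Hl]. rewrite cderiv_eps in Hl.
  apply Cmod_zero_le. apply le_epsilon. intros e0 He0.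
  set (e := e0 / (5 * P * P + 1)). assert (He : 0 < e) by pos.
  destruct (Hl e He) as [d [Hd Hd']].
  destruct (pow2_small (5 * P) d Hd) as [N HN].
  assert (HTN : Cmod (TI (sq N)) <= 5 * e * (P / 2 ^ N) * (P / 2 ^ N)).
  { specialize (HK N). specialize (Hp N). specialize (Hper N). set (r := P / 2 ^ N) in *.
    assert (Hr : 0 <= r) by pos.
    replace (2 * P / 2 ^ N) with (2 * r) in Hp by (unfold r; field; apply Rgt_not_eq, P2).
    replace (5 * P / 2 ^ N) with (5 * r) in HN by (unfold r; field; apply Rgt_not_eq, P2).
    destruct (sq N) as [[u v] w]. destruct HK as [Ku [Kv Kw]]. unfold per in Hper.
    unfold pa in Hp; cbn [fst] in Hp.
    pose proof (Cmod_ge_0 (v - u)). pose proof (Cmod_ge_0 (w - v)). pose proof (Cmod_ge_0 (u - w)).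
    (* A primitive of the linearization of [f] at [p]; its increments cancel around the triangle. *)
    set (A := fun z => (f p * z + l * ((z - p) * (z - p) * (/2)%R))%C).
    assert (HA : forall z, cderiv A z (f p + l * (z - p))%C).
    { intros z. eapply cderiv_eq. cder.
      cbv beta. C_field. }
    assert (S1 : forall x y, K x -> K y -> (forall t, 0 <= t <= 1 -> Cmod (seg x y t - p) <= 5 * r) ->
      Cmod (segint f x y - (A y - A x)) <= (e * (5 * r)) * Cmod (y - x)).
    { intros x y Kx Ky Hxy. apply seg_approx with (g := fun z => (f p + l * (z - p))%C).
      apply K_seg_cont; auto. intros; apply HA. intros t Ht. specialize (Hxy t Ht).
      replace (f (seg x y t) - (f p + l * (seg x y t - p)))%C with (f (seg x y t) - f p - l * (seg x y t - p))%C by ring.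
      eapply Rle_trans. apply Hd'. lra. apply Rmult_le_compat_l; lra. }
    assert (S2 : forall x y, Cmod (x - u) <= r -> Cmod (y - u) <= r -> forall t, 0 <= t <= 1 -> Cmod (seg x y t - p) <= 5 * r).
    { intros x y Hx Hy t Ht. pose proof (Cmod_tri (seg x y t) u p).
      replace (seg x y t - u)%C with ((1 - t)%R * (x - u) + t * (y - u))%C in H2
        by (unfold seg; rewrite RtoC_minus; ring).
      pose proof (Cmod_triangle ((1 - t)%R * (x - u)) (t * (y - u))) as H3.
      rewrite !Cmod_mult, !Cmod_R, !Rabs_pos_eq in H3 by lra. nra. }
    assert (Du : Cmod (u - u) <= r) by (rewrite Cmod_diff_0; auto).
    assert (Dv : Cmod (v - u) <= r) by lra.
    assert (Dw : Cmod (w - u) <= r) by (rewrite Cmod_sym; lra).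
    pose proof (S1 u v Ku Kv (S2 u v Du Dv)) as B1.
    pose proof (S1 v w Kv Kw (S2 v w Dv Dw)) as B2.
    pose proof (S1 w u Kw Ku (S2 w u Dw Du)) as B3.
    replace (TI (u, v, w)) with ((segint f u v - (A v - A u)) + (segint f v w - (A w - A v)) + (segint f w u - (A u - A w)))%C
      by (unfold TI; ring).
    eapply Rle_trans. apply Cmod_triangle.
    pose proof (Cmod_triangle (segint f u v - (A v - A u)) (segint f v w - (A w - A v))).
    replace (5 * e * r * r) with (e * (5 * r) * (Cmod (v - u) + Cmod (w - v) + Cmod (u - w)))
      by pos. lra. }
  eapply Rle_trans. apply HT.
  apply Rle_trans with (5 * e * P * P).
  { apply Rle_trans with (2 ^ N * 2 ^ N * (5 * e * (P / 2 ^ N) * (P / 2 ^ N))).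
    apply Rmult_le_compat_l; auto. specialize (P2 N); nra. right. field. apply Rgt_not_eq, P2. }
  assert (e * (5 * P * P + 1) = e0) by (unfold e; field; nra). nra.
Qed.

Lemma goursat_diff p a b : K p -> K a -> K b -> (segint f p b - segint f p a = segint f a b)%C.
Proof.
  intros Kp Ka Kb. pose proof (goursat p a b Kp Ka Kb) as G.
  rewrite (segint_rev f p b) in G by (apply K_seg_cont; auto).
  apply Cminus_0_eq.
  replace (segint f p b - segint f p a - segint f a b)%C with
   (- (segint f p a + segint f a b + - segint f p b))%C by ring. rewrite G. ring.
Qed.

Lemma segint_cderiv p a r : K p -> 0 < r -> (forall z, Cmod (z - a) < r -> K z) ->
  cderiv (fun z => segint f p z) a (f a).
Proof.
  intros Kp Hr Hb.
  assert (Ka : K a) by (apply Hb; rewrite Cmod_diff_0; auto).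
  apply cderiv_eps. intros e He. destruct (Hf a Ka) as [l Hl]. apply cderiv_ccont in Hl.
  destruct (Hl e He) as [d [Hd H]]. exists (Rmin d r). split. apply Rmin_glb_lt; auto.
  intros z Hz.
  destruct (Rmin_Rgt_l _ _ _ Hz) as [Z1 Z2].
  rewrite goursat_diff by auto.
  replace (f a * (z - a))%C with (f a * z - f a * a)%C by ring.
  apply (seg_approx f (fun _ => f a) (fun w => f a * w)%C).
  - apply K_seg_cont; auto.
  - intros. eapply cderiv_eq. apply cderiv_scal, cderiv_id. ring.
  - intros t Ht. left. apply H.
    replace (seg a z t - a)%C with (t * (z - a))%C by (unfold seg; ring).
    rewrite Cmod_mult, Cmod_R, Rabs_pos_eq by lra. pose proof (Cmod_ge_0 (z - a)). nra.
Qed.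

End Goursat.

(** * The maximum principle *)

Lemma cball_convex p r : Cconvex (fun z => Cmod (z - p) <= r).
Proof.
  intros a b t Ha Hb Ht.
  replace (seg a b t - p)%C with ((1 - t)%R * (a - p) + t * (b - p))%C
    by (unfold seg; rewrite RtoC_minus; ring).
  eapply Rle_trans. apply Cmod_triangle.
  rewrite !Cmod_mult, !Cmod_R, !Rabs_pos_eq by lra. nra.
Qed.

Lemma cball_closed p r : Cclosed (fun z => Cmod (z - p) <= r).
Proof.
  intros s Hs. apply Rnot_le_lt in Hs. exists (Cmod (s - p) - r). split; [lra|].
  intros z Hz Q. pose proof (Cmod_tri s z p). rewrite (Cmod_sym s z) in H. lra.
Qed.

Lemma cball_bounded p r z : Cmod (z - p) <= r -> Cmod z <= r + Cmod p.
Proof. intros H. pose proof (Cmod_sub_ge z p). lra. Qed.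

Lemma local_primitive g p r : 0 < r ->
  (forall z, Cmod (z - p) <= r -> exists l, cderiv g z l) ->
  exists G, forall z, Cmod (z - p) < r -> cderiv G z (g z).
Proof.
  intros Hr Hg. exists (segint g p). intros z Hz.
  apply (segint_cderiv (fun z => Cmod (z - p) <= r) g (cball_convex p r) (cball_closed p r) Hg p z (r - Cmod (z - p))).
  - rewrite Cmod_diff_0. lra.
  - lra.
  - intros y Hy. pose proof (Cmod_tri y z p). lra.
Qed.

(** [g] is differentiated at [s] only, yet its primitive has a second order expansion there: the
    first order remainder of [g] is carried over by the mean value inequality. *)
Lemma peano2 G g s r l : 0 < r -> (forall z, Cmod (z - s) < r -> cderiv G z (g z)) -> cderiv g s l ->
  forall e, 0 < e -> exists d, 0 < d /\ forall z, Cmod (z - s) < d ->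
   Cmod (G z - G s - (g s * (z - s) + l * ((z - s) * (z - s) * (/2)%R))) <= e * Cmod (z - s) ^ 2.
Proof.
  intros Hr HG Hg e He. rewrite cderiv_eps in Hg. destruct (Hg e He) as [d [Hd H]].
  exists (Rmin d r). split. apply Rmin_glb_lt; auto.
  intros z Hz.
  destruct (Rmin_Rgt_l _ _ _ Hz) as [Z1 Z2].
  set (A := fun y => (G y - (g s * (y - s) + l * ((y - s) * (y - s) * (/2)%R)))%C).
  assert (Hseg : forall t, 0 <= t <= 1 -> Cmod (s + t * (z - s) - s)%C <= Cmod (z - s)).
  { intros t Ht. replace (s + t * (z - s) - s)%C with (t * (z - s))%C by ring.
    rewrite Cmod_mult, Cmod_R, Rabs_pos_eq by lra. pose proof (Cmod_ge_0 (z - s)). nra. }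
  replace (G z - G s - (g s * (z - s) + l * ((z - s) * (z - s) * (/2)%R)))%C with (A z - A s)%C.
  2: { unfold A. ring. }
  replace (e * Cmod (z - s) ^ 2) with (e * Cmod (z - s) * Cmod (z - s)) by ring.
  apply cderiv_MVI with (f' := fun y => (g y - (g s + l * (y - s)))%C).
  - intros t Ht. specialize (Hseg t Ht).
    apply cderiv_minus. apply HG. lra.
    eapply cderiv_eq. cder.
    C_field.
  - intros t Ht. specialize (Hseg t Ht). set (y := (s + t * (z - s))%C) in *.
    replace (g y - (g s + l * (y - s)))%C with (g y - g s - l * (y - s))%C by ring.
    eapply Rle_trans. apply H. lra. apply Rmult_le_compat_l; lra.
Qed.

(* The four points [p + i^k t] annihilate the first and second order terms. *)
Lemma no_max_C2 (q : C -> C) (p p0 al be : C) (e r : R) : 0 < e -> 0 < r ->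
  (forall c, 0 < c -> exists d, 0 < d /\ forall z, Cmod (z - p) < d ->
    Cmod (q z - q p - (al * (z - p) + be * ((z - p) * (z - p)))) <= c * Cmod (z - p) ^ 2) ->
  (forall z, Cmod (z - p) < r -> Re (q z) + e * Cmod (z - p0) ^ 2 <= Re (q p) + e * Cmod (p - p0) ^ 2) ->
  False.
Proof.
  intros He Hr Hq Hm. destruct (Hq (e / 2)) as [d [Hd H]]; [lra|].
  set (t := Rmin d r / 2).
  assert (Ht : 0 < t /\ t < d /\ t < r).
  { unfold t. assert (0 < Rmin d r) by pos.
    pose proof (Rmin_l d r). pose proof (Rmin_r d r). lra. }
  assert (K : forall w : C, Cmod w = 1 ->
    - (e / 2) * t ^ 2 <= Re (q (p + w * t)%C - q p - (al * (w * t) + be * ((w * t) * (w * t))))%C /\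
    Re (q (p + w * t)%C) + e * Cmod (p + w * t - p0) ^ 2 <= Re (q p) + e * Cmod (p - p0) ^ 2).
  { intros w Hw. assert (E : (p + w * t - p = w * t)%C) by ring.
    assert (Ew : Cmod (p + w * t - p)%C = t) by (rewrite E, Cmod_mult, Hw, Cmod_R_pos; lra).
    split; [|apply Hm; lra]. specialize (H (p + w * t)%C). rewrite Ew, E in H.
    specialize (H (proj1 (proj2 Ht))).
    match type of H with Cmod ?x <= _ => pose proof (Re_abs x) end. lra. }
  assert (M1 : Cmod (- (1)) = 1) by apply Cmod_m1.
  assert (M2 : Cmod (- Ci) = 1) by (rewrite Cmod_opp; apply Cmod_Ci).
  destruct (K 1%R Cmod_1) as [A1 B1]. destruct (K _ Cmod_Ci) as [A2 B2].
  destruct (K _ M1) as [A3 B3]. destruct (K _ M2) as [A4 B4].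
  rewrite !Cmod2_alt in B1, B2, B3, B4.
  clear K H Hm Hq.
  generalize dependent (q (p + 1%R * t)%C). generalize dependent (q (p + Ci * t)%C).
  generalize dependent (q (p + - (1) * t)%C). generalize dependent (q (p + - Ci * t)%C).
  generalize dependent (q p). intros y0 y4 A4 B4 y3 A3 B3 y2 A2 B2 y1 A1 B1.
  unfold Re, Im, Cminus, Cplus, Copp, Cmult, Ci, RtoC in *. cbn [fst snd] in *. assert (0 < e * (t * t)) by pos. nra.
Qed.

(* A primitive [G] of [g] has second order expansions, so the difference quotients of [G] have no
   such maximum; they converge to [g]. *)
Lemma no_max (g : C -> C) (p : C) (r e : R) : 0 < r -> 0 < e ->
  (forall z, Cmod (z - p) < r -> exists l, cderiv g z l) ->
  (forall z, Cmod (z - p) < r -> Re (g z) + e * Cmod (z - p) ^ 2 <= Re (g p)) -> False.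
Proof.
  intros Hr He Hg Hm.
  destruct (local_primitive g p (3 * r / 4)) as [G HG]; [lra|intros; apply Hg; lra|].
  set (rho := r / 2). assert (Hrho : 0 < rho) by pos.
  set (K := fun z => Cmod (z - p) <= rho).
  set (eta := e * rho ^ 2 / 16).
  assert (Heta : 0 < eta) by pos.
  set (q := fun (d : R) z => ((G (z + d) - G z) * (/ d)%R)%C).
  (* Uniform convergence on the disc of the difference quotients of [G] to [g]. *)
  destruct (compact_directed K (rho + Cmod p) {t | 0 < t}
    (fun z t => forall d, 0 < d -> d < proj1_sig t -> Cmod (q d z - g z) <= eta) (exist _ 1 Rlt_0_1))
    as [[tau Htau] Hq].
  - apply cball_bounded.
  - intros [t Ht] [t' Ht']. exists (exist _ (Rmin t t') (Rmin_glb_lt _ _ _ Ht Ht')).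
    intros z [H|H] d Hd Hd'; apply H; auto; eapply Rlt_le_trans; eauto; [apply Rmin_l|apply Rmin_r].
  - intros s. destruct (classic (K s)) as [Ks|Ks].
    2: { destruct (cball_closed p rho s Ks) as [d [Hd H]]. exists d. split; auto.
         exists (exist _ 1 Rlt_0_1). intros z Kz Hz. destruct (H z Hz Kz). }
    destruct (Hg s) as [l Hl]. { unfold K, rho in Ks. lra. }
    apply cderiv_ccont in Hl. destruct (Hl (eta / 2)) as [d0 [Hd0 H0]]; [lra|].
    set (d := Rmin (d0 / 2) (r / 8)).
    assert (Hd : 0 < d) by pos.
    assert (d <= d0 / 2) by apply Rmin_l. assert (d <= r / 8) by apply Rmin_r.
    exists d. split; auto. exists (exist _ d Hd). simpl. intros z Kz Hz c Hc Hcd.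
    assert (Eq : (z + c - z = c)%C) by ring.
    assert (P1 : Cmod ((G (z + c) - g s * (z + c)) - (G z - g s * z))%C <= eta / 2 * Cmod (z + c - z)%C).
    { refine (cderiv_MVI (fun y => G y - g s * y)%C (fun y => g y - g s)%C z (z + c)%C (eta / 2) _ _);
        rewrite Eq; intros t Ht.
      - apply cderiv_minus. apply HG. pose proof (Cmod_tri (z + t * c) z p) as T.
        replace (z + t * c - z)%C with (t * c)%C in T by ring.
        rewrite Cmod_mult, !Cmod_R, !Rabs_pos_eq in T by lra. unfold K, rho in Kz. nra.
        eapply cderiv_eq. apply cderiv_scal, cderiv_id. ring.
      - left. apply H0. pose proof (Cmod_tri (z + t * c) z s) as T.
        replace (z + t * c - z)%C with (t * c)%C in T by ring.
        rewrite Cmod_mult, !Cmod_R, !Rabs_pos_eq in T by lra. nra. }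
    rewrite Eq, Cmod_R_pos in P1 by lra.
    specialize (H0 z). assert (P2 := H0 ltac:(lra)).
    pose proof (Cmod_tri (q c z) (g s) (g z)) as T. rewrite (Cmod_sym (g s)) in T.
    replace (q c z - g s)%C with ((G (z + c) - g s * (z + c) - (G z - g s * z)) * (/c)%R)%C in T.
    2: { unfold q. rewrite RtoC_inv by lra. field. intros Q. apply RtoC_inj in Q. lra. }
    rewrite Cmod_mult, (Cmod_R_pos (/c)) in T. 2: pos.
    assert (Cmod (G (z + c) - g s * (z + c) - (G z - g s * z))%C * / c <= eta / 2).
    { apply Rle_div_l; auto. } lra.
  - simpl in Hq. set (d := Rmin (tau / 2) (r / 8)).
    assert (Hd : 0 < d) by pos.
    assert (d <= tau / 2) by apply Rmin_l. assert (d <= r / 8) by apply Rmin_r.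
    assert (Hqd : forall z, K z -> Cmod (q d z - g z) <= eta). { intros. apply Hq; auto. lra. }
    assert (Hshift : forall z, K z -> Cmod (z + d - p) < 3 * r / 4).
    { intros z Kz. unfold K, rho in Kz. pose proof (Cmod_tri (z + d) z p) as T.
      replace (z + d - z)%C with (RtoC d) in T by ring. rewrite Cmod_R_pos in T by lra. lra. }
    (* Only half of the quadratic term enters [u]. The other half, [e * rho ^ 2 / 2] on the circle,
       outweighs the two errors [eta] and forces the maximum of [u] into the open disc. *)
    set (u := fun z => (q d z + (e / 2)%R * ((z - p) * Cconj (z - p)))%C).
    assert (Hu : forall z, Re (u z) = Re (q d z) + e / 2 * Cmod (z - p) ^ 2).
    { intros z. rewrite <- Re_normsq. Re_ring. }
    assert (Kp : K p) by (unfold K; rewrite Cmod_diff_0; lra).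
    assert (Kb : forall z, K z -> Cmod (z - p) < 3 * r / 4) by (unfold K, rho; intros; lra).
    destruct (extreme_value K u (rho + Cmod p) p Kp (cball_bounded p rho) (cball_closed p rho)) as [p' [Kp' Hp']].
    { intros s Ks. apply ccont_plus.
      - apply (ccont_mult (fun z => G (z + d) - G z)%C (fun _ => RtoC (/ d))); [|apply ccont_const].
        apply (ccont_plus (fun z => G (z + d)%C) (fun z => - G z)%C).
        + apply (ccont_comp G (fun z => z + d)%C).
          * apply ccont_plus; [apply ccont_id|apply ccont_const].
          * eapply cderiv_ccont, HG. auto.
        + eapply cderiv_ccont, cderiv_opp, HG. auto.
      - apply ccont_mult. apply ccont_const. apply (ccont_normsq (fun z => z - p)%C).
        apply ccont_plus; [apply ccont_id|apply ccont_const]. }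
    assert (Hin : Cmod (p' - p) < rho).
    { apply Rnot_le_lt. intros Q. specialize (Hp' p Kp). rewrite !Hu in Hp'.
      pose proof (Hqd p Kp) as Q1. pose proof (Hqd p' Kp') as Q2.
      specialize (Hm p'). unfold K in Kp'.
      assert (Hm' := Hm ltac:(unfold rho in *; lra)).
      assert (Eqr : Cmod (p' - p) = rho) by lra.
      pose proof (Re_abs (q d p - g p)%C) as R1. pose proof (Re_abs (q d p' - g p')%C) as R2.
      replace (Re (q d p - g p)%C) with (Re (q d p) - Re (g p)) in R1 by Re_ring.
      replace (Re (q d p' - g p')%C) with (Re (q d p') - Re (g p')) in R2 by Re_ring.
      unfold eta in *. nra. }
    destruct (Hg p') as [l1 Hl1]; [unfold rho in *; lra|].
    destruct (Hg (p' + d)%C) as [l2 Hl2]; [specialize (Hshift p' Kp'); lra|].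
    apply (no_max_C2 (q d) p' p ((g (p' + d) - g p') * (/d)%R)%C ((l2 - l1) * (/2)%R * (/d)%R)%C
      (e / 2) (rho - Cmod (p' - p))); [lra|lra| |].
    + intros c Hc.
      assert (HG1 : forall z, Cmod (z - p') < r / 8 -> cderiv G z (g z)).
      { intros z Hz. apply HG. pose proof (Cmod_tri z p' p). unfold rho in *. lra. }
      assert (HG2 : forall z, Cmod (z - (p' + d)) < r / 8 -> cderiv G z (g z)).
      { intros z Hz. apply HG. pose proof (Cmod_tri z (p' + d) p).
        pose proof (Cmod_tri (p' + d) p' p) as T.
        replace (p' + d - p')%C with (RtoC d) in T by ring. rewrite Cmod_R_pos in T by lra.
        unfold rho in *. lra. }
      assert (Hcd : 0 < c * d / 2) by nra. assert (Hr8 : 0 < r / 8) by lra.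
      destruct (peano2 G g p' (r / 8) l1 Hr8 HG1 Hl1 (c * d / 2) Hcd) as [d1 [Hd1 H1]].
      destruct (peano2 G g (p' + d) (r / 8) l2 Hr8 HG2 Hl2 (c * d / 2) Hcd) as [d2 [Hd2 H2]].
      exists (Rmin d1 d2). split. apply Rmin_glb_lt; auto.
      intros z Hz.
      destruct (Rmin_Rgt_l _ _ _ Hz) as [Z1 Z2].
      specialize (H1 z Z1). specialize (H2 (z + d)%C).
      replace (z + d - (p' + d))%C with (z - p')%C in H2 by ring. specialize (H2 Z2).
      match type of H1 with Cmod ?x <= _ => set (X1 := x) in * end.
      match type of H2 with Cmod ?x <= _ => set (X2 := x) in * end.
      match goal with |- Cmod ?x <= _ => replace x with ((X2 - X1) * (/d)%R)%C end.
      2: { unfold X1, X2, q. ring. }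
      rewrite Cmod_mult, (Cmod_R_pos (/d)). 2: pos.
      apply Rle_div_l; auto. pose proof (Cmod_sub X2 X1). nra.
    + intros z Hz. rewrite <- !Hu. apply Hp'. unfold K. pose proof (Cmod_tri z p' p). lra.
Qed.

(** If the bound failed, [|k|^2 + e |s|^2] would attain its maximum over [K] at a point where
    [|k| > B], hence at an interior point of [K]. Linearizing [|k|^2] and recentering [e |s|^2]
    there produces the situation excluded by [no_max]. *)
Lemma max_principle (K : C -> Prop) (D B : R) (k : C -> C) : 0 <= B ->
  (forall s, K s -> Cmod s <= D) -> Cclosed K ->
  (forall s, K s -> ccont k s) ->
  (forall p, K p -> Cmod (k p) <= B \/
     exists r, 0 < r /\ forall z, Cmod (z - p) < r -> K z /\ exists l, cderiv k z l) ->
  forall s, K s -> Cmod (k s) <= B.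
Proof.
  intros HB HD Hcl Hc Hk s0 Ks0. apply Rnot_lt_le. intros Hlt.
  set (M := Cmod (k s0)) in *.
  (* So small that [e * D ^ 2] cannot compensate for the excess [M ^ 2 - B ^ 2]. *)
  set (e := (M ^ 2 - B ^ 2) / (2 * (D ^ 2 + 1))).
  assert (He : 0 < e) by pos.
  assert (HeD : e * D ^ 2 < M ^ 2 - B ^ 2).
  { assert (e * (2 * (D ^ 2 + 1)) = M ^ 2 - B ^ 2) by (unfold e; field; nra). nra. }
  set (u := fun s => (k s * Cconj (k s) + e * (s * Cconj s))%C).
  assert (Hu : forall s, Re (u s) = Cmod (k s) ^ 2 + e * Cmod s ^ 2).
  { intros s. rewrite <- !Re_normsq. Re_ring. }
  destruct (extreme_value K u D s0 Ks0 HD Hcl) as [p [Kp Hp]].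
  { intros s Ks. apply ccont_plus. apply ccont_normsq; auto.
    apply ccont_mult. apply ccont_const. apply ccont_normsq, ccont_id. }
  assert (Hbig : B < Cmod (k p)).
  { apply Rnot_le_lt. intros Q. specialize (Hp s0 Ks0). rewrite !Hu in Hp. fold M in Hp.
    specialize (HD p Kp). pose proof (Cmod_ge_0 (k p)). pose proof (Cmod_ge_0 p).
    assert (Cmod p ^ 2 <= D ^ 2) by nra. nra. }
  destruct (Hk p Kp) as [Q|[r [Hr H]]]; [lra|].
  (* [|k|^2 >= 2 Re (conj (k p) k) - |k p|^2], with equality at [p]. *)
  apply (no_max (fun z => 2%R * Cconj (k p) * k z + 2%R * e * Cconj p * (z - p))%C p r e); auto.
  - intros z Hz. destruct (H z Hz) as [_ [l Hl]]. eexists.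
    cder.
  - intros z Hz. destruct (H z Hz) as [Kz _]. specialize (Hp z Kz).
    rewrite !Cmod2_alt in *. unfold Re, Im in *; simpl in *.
    destruct (k z) as [a b]. destruct (k p) as [a' b'].
    simpl in *. pose proof (pow2_ge_0 (a - a')). pose proof (pow2_ge_0 (b - b')). nra.
Qed.

(** * The Schwarz-Pick inequality *)

Lemma Cmod_conj_sum_sq (a b : C) :
  Cmod (a + Cconj b) ^ 2 = Cmod (a - b) ^ 2 + 4 * Re a * Re b.
Proof. rewrite !Cmod2_alt. unfold Re, Im; simpl. ring. Qed.

Lemma Cmod_conj_sum_gt (a b : C) : 0 < Re a -> 0 < Re b -> Cmod (a - b) < Cmod (a + Cconj b).
Proof.
  intros Ha Hb. pose proof (Cmod_conj_sum_sq a b).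
  pose proof (Cmod_ge_0 (a + Cconj b)).
  nra.
Qed.

(* Dividing [A^(n+1)] by [B^n], where [B s = (s - w) / (s + conj w)], keeps the quotient small
   near [w], so the maximum principle applies without removing the singularity. *)
Lemma schwarz_lemma (A : C -> C) (w : C) : 0 < Re w -> A w = 0 ->
  (forall s, 0 < Re s -> exists l, cderiv A s l) -> (forall s, 0 < Re s -> Cmod (A s) <= 1) ->
  forall s, 0 < Re s -> Cmod (A s) * Cmod (s + Cconj w) <= Cmod (s - w).
Proof.
  intros Hw Aw HA Hb s1 Hs1. apply Rnot_lt_le. intros Hlt.
  set (b := Cmod (A s1)) in *.
  assert (Hb1 : b <= 1) by (apply Hb; auto).
  pose proof (Cmod_conj_sum_gt s1 w Hs1 Hw) as Hgt. pose proof (Cmod_ge_0 (s1 - w)) as Hge.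
  assert (Hb0 : 0 < b) by pos.
  assert (Hs1w : 0 < Cmod (s1 - w)).
  { destruct (Rle_lt_or_eq_dec _ _ Hge) as [|E]; auto. symmetry in E. apply Cmod_eq_0 in E.
    apply Cminus_0_eq in E. subst s1. unfold b in Hb0. rewrite Aw, Cmod_0 in Hb0. lra. }
  set (T := Cmod (s1 + Cconj w)) in *. set (N1 := Cmod (s1 - w)) in *.
  (* If the inequality fails at [s1], then [|B s1| / b = N1 / (b * T)] is less than 1, and [r] lies
     halfway between this ratio and 1. The curve [|B| = r] is the outer boundary. *)
  set (r := (1 + N1 / (b * T)) / 2).
  assert (Hq : N1 / (b * T) < 1) by (apply Rlt_div_l; lra).
  assert (Hq0 : 0 < N1 / (b * T)) by pos.
  assert (Hr : N1 / (b * T) < r < 1) by (unfold r; lra).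
  assert (HN1r : N1 < r * (b * T)) by (apply Rlt_div_l; lra).
  (* This [n] makes the quotient at [s1] exceed [/ r ^ n], its bound on the outer boundary. *)
  destruct (pow_unbounded (r * (b * T) / N1) (/ b)) as [n Hn].
  { apply Rlt_div_r; lra. }
  destruct (HA w Hw) as [l Hl]. rewrite cderiv_eps in Hl.
  destruct (Hl 1 Rlt_0_1) as [d [Hd HAw]].
  set (Cl := Cmod l + 1).
  assert (HCl : 0 < Cl) by (pose proof (Cmod_ge_0 l); unfold Cl; lra).
  assert (HAC : forall z, Cmod (z - w) < d -> Cmod (A z) <= Cl * Cmod (z - w)).
  { intros z Hz. specialize (HAw z Hz). rewrite Aw in HAw.
    replace (A z) with ((A z - 0 - l * (z - w)) + l * (z - w))%C by ring.
    eapply Rle_trans. apply Cmod_triangle. rewrite Cmod_mult. unfold Cl. lra. }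
  (* From [|s - w| <= r |s + conj w|] one gets [|s| <= |w| (1 + r) / (1 - r)]: the region is bounded
     although the half-plane is not. [D'] then bounds [|s + conj w|]. *)
  set (D := Cmod w * (1 + r) / (1 - r)). set (D' := D + Cmod w + 1).
  assert (HW : 0 < Cmod w) by (pose proof (Re_abs w); lra).
  assert (HD : 0 < D) by pos.
  assert (HD' : 0 < D') by (unfold D'; lra).
  (* The inner boundary is [|B| = eta]. It has to leave [s1] in the region, to lie where
     [|A z| <= Cl |z - w|], and to make [(Cl * D') ^ S n * eta], the bound of the quotient there, at
     most 1. *)
  set (eta := Rmin (Rmin 1 (N1 / T)) (Rmin (d / (2 * D')) (/ ((Cl * D') ^ S n)))).
  assert (HT : 0 < T) by lra.
  assert (HCD : 0 < (Cl * D') ^ S n) by pos.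
  assert (Heta : 0 < eta) by pos.
  assert (E1 : eta <= 1). { eapply Rle_trans; [apply Rmin_l|apply Rmin_l]. }
  assert (E2 : eta <= N1 / T). { eapply Rle_trans; [apply Rmin_l|apply Rmin_r]. }
  assert (E3 : eta <= d / (2 * D')). { eapply Rle_trans; [apply Rmin_r|apply Rmin_l]. }
  assert (E4 : eta <= / ((Cl * D') ^ S n)). { eapply Rle_trans; [apply Rmin_r|apply Rmin_r]. }
  apply Rle_div_r in E2; auto. apply Rle_div_r in E3; [|lra].
  set (K := fun s => eta * Cmod (s + Cconj w) <= Cmod (s - w) /\ Cmod (s - w) <= r * Cmod (s + Cconj w)).
  set (k := fun s => (Cpow (A s) (S n) * / Cpow ((s - w) / (s + Cconj w)) n)%C).
  assert (KD : forall s, K s -> Cmod s <= D).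
  { intros s [_ Hs]. pose proof (Cmod_sub_ge s w). pose proof (Cmod_triangle s (Cconj w)) as Q.
    rewrite Cmod_conj in Q. apply Rle_div_r. lra. nra. }
  assert (Kne : forall s, K s -> (s + Cconj w)%C <> 0).
  { intros s [_ Hs] E. rewrite E, Cmod_0 in Hs. pose proof (Cmod_conj_sum_sq s w) as Q.
    assert (Z : (s - w)%C = 0) by (apply Cmod_zero_le; lra). apply Cminus_0_eq in Z. subst s.
    rewrite E, Cmod_diff_0, Cmod_0 in Q. nra. }
  assert (KT : forall s, K s -> 0 < Cmod (s + Cconj w)). { intros s Ks. apply Cmod_gt_0. auto. }
  assert (KN : forall s, K s -> 0 < Cmod (s - w)).
  { intros s Ks. specialize (KT s Ks). destruct Ks as [Ks _]. nra. }
  assert (KR : forall s, K s -> 0 < Re s).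
  { intros s Ks. pose proof (KN s Ks). destruct Ks as [_ Hs].
    pose proof (Cmod_conj_sum_sq s w). assert (Cmod (s - w) < Cmod (s + Cconj w)) by nra.
    nra. }
  assert (Kcd : forall s, K s -> exists m, cderiv k s m).
  { intros s Ks. destruct (cderiv_pow A s (S n) (HA s (KR s Ks))) as [a' Ha'].
    destruct (cderiv_pow (fun s => (s - w) / (s + Cconj w))%C s n) as [c' Hc']; [eexists; cder; auto|].
    eexists. apply cderiv_mult. apply Ha'. apply cderiv_inv. apply Hc'.
    apply Cmod_gt_0. rewrite Cmod_pow, Cmod_div by auto. apply pow_lt. apply Rdiv_lt_0_compat; auto. }
  assert (Kmod : forall s, K s -> Cmod (k s) = Cmod (A s) ^ S n / (Cmod (s - w) / Cmod (s + Cconj w)) ^ n).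
  { intros s Ks. unfold k. rewrite Cmod_mult, Cmod_inv, !Cmod_pow, Cmod_div; auto.
    apply Cmod_gt_0. rewrite Cmod_pow, Cmod_div by auto. apply pow_lt. apply Rdiv_lt_0_compat; auto. }
  assert (Knear : forall s z, (Cmod (z - w) <= Cmod (s - w) + Cmod (z - s) /\ Cmod (s - w) <= Cmod (z - w) + Cmod (z - s)) /\
    (Cmod (z + Cconj w) <= Cmod (s + Cconj w) + Cmod (z - s) /\ Cmod (s + Cconj w) <= Cmod (z + Cconj w) + Cmod (z - s))).
  { intros s z. replace (z - s)%C with ((z - w) - (s - w))%C at 1 2 by ring.
    replace (z - s)%C with ((z + Cconj w) - (s + Cconj w))%C by ring. split; apply Cmod_near. }
  assert (Hrn : 0 < r ^ n) by pos.
  assert (Hrn1 : r ^ n <= 1). { rewrite <- (pow1 n). apply pow_incr. lra. }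
  assert (HBB : 1 <= / r ^ n). { rewrite <- Rinv_1. apply Rinv_le_contravar; auto. }
  assert (Ks1 : K s1).
  { split. auto. fold N1 T. nra. }
  assert (MP : Cmod (k s1) <= / r ^ n).
  { apply (max_principle K D (/ r ^ n) k); auto.
    - lra.
    - intros s Hs. apply not_and_or in Hs.
      pose proof (Knear s) as G.
      destruct Hs as [Hs|Hs]; apply Rnot_le_lt in Hs.
      + exists ((eta * Cmod (s + Cconj w) - Cmod (s - w)) / 2). split; [lra|].
        intros z Hz [Q _]. destruct (G z). nra.
      + exists ((Cmod (s - w) - r * Cmod (s + Cconj w)) / 2). split; [lra|].
        intros z Hz [_ Q]. destruct (G z). nra.
    - intros s Ks. destruct (Kcd s Ks) as [m Hm]. eapply cderiv_ccont; eauto.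
    - intros s Ks. pose proof (KT s Ks) as KTs. pose proof (KD s Ks) as KDs.
      assert (HTD : Cmod (s + Cconj w) <= D').
      { eapply Rle_trans. apply Cmod_triangle. rewrite Cmod_conj. unfold D'. lra. }
      destruct (Rle_lt_or_eq_dec _ _ (proj1 Ks)) as [L1|L1].
      destruct (Rle_lt_or_eq_dec _ _ (proj2 Ks)) as [L2|L2].
      + right. set (t := Rmin ((Cmod (s - w) - eta * Cmod (s + Cconj w)) / 2) ((r * Cmod (s + Cconj w) - Cmod (s - w)) / 2)).
        exists t. split. { pos. }
        intros z Hz.
        destruct (Rmin_Rgt_l _ _ _ Hz) as [Z1 Z2].
        assert (Kz : K z).
        { destruct (Knear s z).
          split; nra. }
        split; auto.
      + left. rewrite Kmod by auto. rewrite L2. unfold Rdiv at 2.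
        rewrite Rmult_assoc, Rinv_r, Rmult_1_r by lra.
        unfold Rdiv. rewrite <- (Rmult_1_l (/ r ^ n)) at 2. apply Rmult_le_compat_r; [lra|].
        rewrite <- (pow1 (S n)). apply pow_incr. split. apply Cmod_ge_0. apply Hb, KR; auto.
      + left. apply Rle_trans with 1; [|auto]. rewrite Kmod by auto. rewrite <- L1 at 1.
        unfold Rdiv at 2. rewrite Rmult_assoc, Rinv_r, Rmult_1_r by lra.
        apply Rle_div_l. apply pow_lt; auto. rewrite Rmult_1_l.
        apply Rle_trans with ((Cl * D' * eta) ^ S n).
        { apply pow_incr. split. apply Cmod_ge_0. eapply Rle_trans. apply HAC. nra.
          rewrite Rmult_assoc. apply Rmult_le_compat_l; nra. }
        rewrite Rpow_mult_distr. simpl (eta ^ S n).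
        rewrite <- (Rmult_1_l (eta ^ n)) at 2. rewrite <- Rmult_assoc.
        apply Rmult_le_compat_r. apply pow_le; lra.
        apply Rle_trans with ((Cl * D') ^ S n * / (Cl * D') ^ S n); [|right; field; lra].
        apply Rmult_le_compat_l; lra. }
  rewrite Kmod in MP by auto. fold b N1 T in MP.
  assert (E5 : (r * (b * T) / N1) ^ n * r ^ n = 0 -> False).
  { intros Z. apply Rmult_integral in Z.
    assert (0 < (r * (b * T) / N1) ^ n); [|lra]. apply pow_lt. apply Rdiv_lt_0_compat; nra. }
  assert (E6 : b ^ S n / (N1 / T) ^ n = b * (r * (b * T) / N1) ^ n * / r ^ n).
  { replace ((N1 / T) ^ n) with (N1 ^ n * / T ^ n) by (unfold Rdiv; rewrite Rpow_mult_distr, pow_inv; auto).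
    replace ((r * (b * T) / N1) ^ n) with (r ^ n * b ^ n * T ^ n * / N1 ^ n)
      by (unfold Rdiv; rewrite <- pow_inv, <- !Rpow_mult_distr; f_equal; ring).
    simpl (b ^ S n). field. repeat split; apply Rgt_not_eq; try lra; apply pow_lt; lra. }
  assert (1 < b * (r * (b * T) / N1) ^ n).
  { apply Rmult_lt_reg_l with (/ b). apply Rinv_0_lt_compat; auto.
    rewrite <- Rmult_assoc, Rinv_l by lra. lra. }
  nra.
Qed.

Definition hol_rhp (f : C -> C) : Prop := forall s, 0 < Re s -> exists l, cderiv f s l.

(** Schwarz's lemma for the Cayley image [(f s - f w) / (f s + conj (f w))]. The identity
    [|a + conj b|^2 = |a - b|^2 + 4 Re a Re b], applied to both pairs, then eliminates the
    differences. *)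
Lemma schwarz_pick_pos (f : C -> C) : hol_rhp f -> (forall s, 0 < Re s -> 0 < Re (f s)) ->
  forall s w, 0 < Re s -> 0 < Re w ->
  Re s * Re w * Cmod (f s + Cconj (f w)) ^ 2 <= Re (f s) * Re (f w) * Cmod (s + Cconj w) ^ 2.
Proof.
  intros Hf Hp s w Hs Hw.
  assert (Hgt : forall s, 0 < Re s -> Cmod (f s - f w) < Cmod (f s + Cconj (f w))).
  { intros z Hz. apply Cmod_conj_sum_gt; auto. }
  assert (Hne : forall s, 0 < Re s -> (f s + Cconj (f w))%C <> 0).
  { intros z Hz. apply Cmod_gt_0. specialize (Hgt z Hz). pose proof (Cmod_ge_0 (f z - f w)). lra. }
  pose proof (schwarz_lemma (fun s => (f s - f w) / (f s + Cconj (f w)))%C w Hw) as S.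
  assert (Q : Cmod ((f s - f w) / (f s + Cconj (f w))) * Cmod (s + Cconj w) <= Cmod (s - w)).
  { apply S; auto.
    - unfold Cdiv. ring.
    - intros z Hz. destruct (Hf z Hz) as [l Hl]. eexists. cder. auto.
    - intros z Hz. rewrite Cmod_div by auto. apply Rle_div_l. apply Cmod_gt_0; auto.
      specialize (Hgt z Hz). lra. }
  rewrite Cmod_div in Q by auto. specialize (Hne s Hs). apply Cmod_gt_0 in Hne.
  pose proof (Cmod_conj_sum_sq (f s) (f w)) as E1. pose proof (Cmod_conj_sum_sq s w) as E2.
  set (X := Cmod (f s - f w)) in *. set (Y := Cmod (f s + Cconj (f w))) in *.
  set (x := Cmod (s - w)) in *. set (y := Cmod (s + Cconj w)) in *.
  assert (Q' : X * y <= x * Y).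
  { apply Rmult_le_reg_r with (/ Y). apply Rinv_0_lt_compat; auto.
    rewrite (Rmult_assoc x), Rinv_r by lra. lra. }
  assert (0 <= X) by apply Cmod_ge_0. assert (0 <= y) by apply Cmod_ge_0.
  assert (X ^ 2 * y ^ 2 <= x ^ 2 * Y ^ 2).
  { rewrite <- !Rpow_mult_distr. apply pow_incr. split; auto. apply Rmult_le_pos; auto. }
  nra.
Qed.

Lemma Rle_quadratic_limit (a b c d e0 : R) : 0 < e0 ->
  (forall e, 0 < e -> e < e0 -> a <= b + c * e + d * (e * e)) -> a <= b.
Proof.
  intros He0 H. apply Rnot_lt_le. intros Hlt.
  set (M := Rabs c + Rabs d + 1). pose proof (Rabs_pos c). pose proof (Rabs_pos d).
  pose proof (Rle_abs c). pose proof (Rle_abs d).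
  set (e := Rmin (Rmin (/ 2) (e0 / 2)) ((a - b) / (2 * M))).
  assert (0 < M) by (unfold M; lra).
  assert (He : 0 < e) by pos.
  assert (e <= /2) by (eapply Rle_trans; apply Rmin_l).
  assert (e <= e0 / 2) by (eapply Rle_trans; [apply Rmin_l|apply Rmin_r]).
  assert (e <= (a - b) / (2 * M)) by apply Rmin_r.
  apply Rle_div_r in H7; [|lra]. specialize (H e He ltac:(lra)).
  unfold M in *. nra.
Qed.

(** Written without denominators: the inequality keeps its meaning when real parts vanish and passes
    to pointwise limits. *)
Definition pick_ineq (f : C -> C) : Prop := forall s w, 0 < Re s -> 0 < Re w ->
  Re s * Re w * Cmod (f s + Cconj (f w)) ^ 2 <= Re (f s) * Re (f w) * Cmod (s + Cconj w) ^ 2.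

(** * Consequences of the Schwarz-Pick inequality *)

Definition nonneg_rhp (f : C -> C) : Prop := forall s, 0 < Re s -> 0 <= Re (f s).

Lemma Cmod_conj_sum_ge_Re (a b : C) : (Re a + Re b) ^ 2 <= Cmod (a + Cconj b) ^ 2.
Proof.
  rewrite Cmod2_alt. pose proof (pow2_ge_0 (Im (a + Cconj b)%C)).
  replace (Re (a + Cconj b)%C) with (Re a + Re b) by Re_ring. lra.
Qed.

(** A Harnack inequality: [|f s + conj (f w)|^2] is at least [Re (f w) ^ 2], and one factor
    [Re (f w)] cancels. *)
Lemma pick_lower f s w : pick_ineq f -> nonneg_rhp f -> 0 < Re s -> 0 < Re w ->
  Re s * Re w * Re (f w) <= Re (f s) * Cmod (s + Cconj w) ^ 2.
Proof.
  intros Hp Hn Hs Hw. specialize (Hp s w Hs Hw).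
  pose proof (Hn s Hs) as N1. pose proof (Hn w Hw) as N2.
  pose proof (Cmod_conj_sum_ge_Re (f s) (f w)) as Q.
  pose proof (pow2_ge_0 (Cmod (s + Cconj w))) as P.
  assert (0 < Re s * Re w) by pos.
  destruct (Rle_lt_or_eq_dec _ _ N2) as [L|L].
  - apply Rmult_le_reg_r with (Re (f w)); auto.
    apply Rle_trans with (Re s * Re w * Cmod (f s + Cconj (f w)) ^ 2); [|lra].
    rewrite Rmult_assoc. apply Rmult_le_compat_l; [lra|]. nra.
  - rewrite <- L. rewrite Rmult_0_r. apply Rmult_le_pos; auto.
Qed.

(** The minimum principle: a zero of the real part makes the right side vanish, and this forces both
    parts of [f s] to agree with those of [f w]. *)
Lemma pick_zero f s w : pick_ineq f -> nonneg_rhp f -> 0 < Re s -> 0 < Re w ->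
  Re (f w) = 0 -> f s = f w.
Proof.
  intros Hp Hn Hs Hw E. specialize (Hp s w Hs Hw).
  assert (0 < Re s * Re w) by pos.
  rewrite Cmod2_alt in Hp.
  assert (E1 : Re (f s + Cconj (f w))%C = Re (f s) + Re (f w)) by Re_ring.
  assert (E2 : Im (f s + Cconj (f w))%C = Im (f s) - Im (f w)) by pos.
  rewrite E1, E2, E in Hp.
  assert (Z : Re (f s) ^ 2 + (Im (f s) - Im (f w)) ^ 2 <= 0) by nra.
  pose proof (pow2_ge_0 (Im (f s) - Im (f w))).
  assert (Z1 : Re (f s) = 0) by pos.
  assert (Z2 : Im (f s) - Im (f w) = 0) by pos.
  apply C_eq; lra.
Qed.

(** Harnack's inequality for the modulus. With [F = |f s|], [W = |f w|] and [T] the quotient in the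
    statement, [(F - W) ^ 2 <= F * W * T] when [F > W], whence [F <= (T + 2) * W]. *)
Lemma pick_upper f s w : pick_ineq f -> nonneg_rhp f -> 0 < Re s -> 0 < Re w ->
  Cmod (f s) <= (Cmod (s + Cconj w) ^ 2 / (Re s * Re w) + 2) * Cmod (f w).
Proof.
  intros Hp Hn Hs Hw. specialize (Hp s w Hs Hw).
  assert (P : 0 < Re s * Re w) by pos.
  set (T := Cmod (s + Cconj w) ^ 2 / (Re s * Re w)).
  assert (HT : T * (Re s * Re w) = Cmod (s + Cconj w) ^ 2) by (unfold T; field; lra).
  assert (HT0 : 0 <= T) by pos.
  rewrite <- HT in Hp.
  assert (Hp' : Cmod (f s + Cconj (f w)) ^ 2 <= Re (f s) * Re (f w) * T) by pos.
  pose proof (Re_abs (f s)). pose proof (Re_abs (f w)). pose proof (Hn s Hs). pose proof (Hn w Hw).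
  pose proof (Cmod_sub_ge (f s) (- Cconj (f w))) as Q. rewrite Cmod_opp, Cmod_conj in Q.
  replace (f s - - Cconj (f w))%C with (f s + Cconj (f w))%C in Q by ring.
  destruct (Rle_dec (Cmod (f s)) (Cmod (f w))) as [L|L]. nra.
  set (F := Cmod (f s)) in *. set (W := Cmod (f w)) in *.
  assert ((F - W) ^ 2 <= F * W * T).
  { apply Rle_trans with (Re (f s) * Re (f w) * T).
    eapply Rle_trans; [|exact Hp']. apply pow_incr. lra.
    apply Rmult_le_compat_r; auto. apply Rmult_le_compat; lra. }
  apply Rmult_le_reg_l with F. lra. nra.
Qed.

(** Stability of the Schwarz-Pick inequality under perturbation, used to pass from strictly positive
    to nonnegative real parts and from difference quotients to derivatives. *)
Lemma pick_limit (A B : R) (x0 y0 : C) : 0 <= A -> 0 <= B ->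
  (forall e, 0 < e -> exists x y : C, Cmod (x - x0) <= e /\ Cmod (y - y0) <= e /\
     0 <= Re x /\ 0 <= Re y /\ A * Cmod (x + Cconj y) ^ 2 <= Re x * Re y * B) ->
  A * Cmod (x0 + Cconj y0) ^ 2 <= Re x0 * Re y0 * B.
Proof.
  intros HA HB H. set (L := Cmod (x0 + Cconj y0)).
  apply Rle_quadratic_limit with (e0 := 1) (c := B * (Re x0 + Re y0) + 4 * A * L) (d := B + 12 * A); [lra|].
  intros e He _. destruct (H e He) as [x [y [H1 [H2 [H3 [H4 H5]]]]]].
  pose proof (Re_abs (x - x0)%C) as R1. pose proof (Re_abs (y - y0)%C) as R2.
  replace (Re (x - x0)%C) with (Re x - Re x0) in R1 by Re_ring.
  replace (Re (y - y0)%C) with (Re y - Re y0) in R2 by Re_ring.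
  assert (Q : Rabs (Cmod (x + Cconj y) - L) <= 2 * e).
  { assert (Q1 : Cmod ((x + Cconj y) - (x0 + Cconj y0)) <= 2 * e).
    { replace ((x + Cconj y) - (x0 + Cconj y0))%C with ((x - x0) + Cconj (y - y0))%C.
      eapply Rle_trans. apply Cmod_triangle. rewrite Cmod_conj. lra.
      C_ring. }
    pose proof (Cmod_near (x + Cconj y) (x0 + Cconj y0)) as Q2.
    apply Rabs_le_between. fold L in Q2. lra. }
  apply Rabs_le_between in Q. assert (0 <= L) by apply Cmod_ge_0.
  set (l := Cmod (x + Cconj y)) in *.
  assert (L ^ 2 <= l ^ 2 + 4 * e * L + 12 * (e * e)) by nra.
  assert (Re x * Re y * B <= (Re x0 + e) * (Re y0 + e) * B).
  { apply Rmult_le_compat_r; auto. apply Rmult_le_compat; lra. }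
  nra.
Qed.

Lemma schwarz_pick (f : C -> C) : hol_rhp f -> nonneg_rhp f -> pick_ineq f.
Proof.
  intros Hf Hp s w Hs Hw. apply pick_limit; [apply Rmult_le_pos; lra|apply pow2_ge_0|].
  intros e He. exists (f s + e)%C, (f w + e)%C.
  assert (E : forall z, Cmod (z + e - z) = e).
  { intros z. replace (z + e - z)%C with (RtoC e) by ring. apply Cmod_R_pos. lra. }
  assert (Hpe : forall z, 0 < Re z -> 0 < Re (f z + e)%C).
  { intros z Hz. specialize (Hp z Hz). unfold Re in *; simpl. lra. }
  rewrite !E. do 2 (split; [lra|]). do 2 (split; [left; auto|]).
  apply (schwarz_pick_pos (fun z => f z + e)%C); auto. intros z Hz. destruct (Hf z Hz) as [l Hl].
  eexists. cder.
Qed.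

Lemma diff_quot_lim h l s e : cderiv h s l -> 0 < e -> exists d0, 0 < d0 /\ forall d, 0 < d -> d < d0 ->
  Cmod ((h (s + d)%C - h s) * (/ d)%R - l) <= e.
Proof.
  intros H He. rewrite cderiv_eps in H. destruct (H e He) as [d0 [Hd0 Hd]].
  exists d0. split; auto. intros d H1 H2. specialize (Hd (s + d)%C).
  replace (s + d - s)%C with (RtoC d) in Hd by ring. rewrite Cmod_R_pos in Hd by lra.
  replace ((h (s + d)%C - h s) * (/ d)%R - l)%C with ((h (s + d)%C - h s - l * d) * (/ d)%R)%C.
  - rewrite Cmod_mult, Cmod_R_pos. apply Rle_div_l; auto. left. apply Rinv_0_lt_compat; auto.
  - rewrite RtoC_inv by lra. field. intros Q. apply RtoC_inj in Q. lra.
Qed.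

(* [h'] is not yet known to be holomorphic: the inequality comes from difference quotients of [h]. *)
Lemma pick_derivative (h h' : C -> C) : (forall s, 0 < Re s -> cderiv h s (h' s)) ->
  nonneg_rhp h' -> pick_ineq h'.
Proof.
  intros Hh Hn s w Hs Hw. apply pick_limit.
  - apply Rmult_le_pos; lra.
  - apply pow2_ge_0.
  - intros e He.
    destruct (diff_quot_lim h (h' s) s e (Hh s Hs) He) as [d1 [Hd1 H1]].
    destruct (diff_quot_lim h (h' w) w e (Hh w Hw) He) as [d2 [Hd2 H2]].
    set (d := Rmin d1 d2 / 2).
    assert (Hd : 0 < d /\ d < d1 /\ d < d2).
    { assert (0 < Rmin d1 d2) by pos. unfold d.
      pose proof (Rmin_l d1 d2). pose proof (Rmin_r d1 d2). lra. }
    set (q := fun z => ((h (z + d)%C - h z) * (/ d)%R)%C).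
    assert (Hq : nonneg_rhp q).
    { intros z Hz.
      destruct (cderiv_MVT h h' z (z + d)%C (/ d)%R) as [t [Ht E]].
      { intros t Ht. apply Hh.
        unfold Re in *; simpl. nra. }
      unfold q. rewrite Cmult_comm, E. replace (z + d - z)%C with (RtoC d) by ring.
      replace ((/ d)%R * (h' (z + t * d) * d))%C with (h' (z + t * d)%C).
      apply Hn. unfold Re in *; simpl. nra.
      rewrite RtoC_inv by lra. field. apply RtoC_neq; lra. }
    exists (q s), (q w). split; [apply H1; lra|]. split; [apply H2; lra|]. split; auto. split; auto.
    apply schwarz_pick; auto. intros z Hz.
    eexists. apply cderiv_mult; [|apply cderiv_const]. apply cderiv_minus; [|apply Hh; auto].
    apply (cderiv_comp h (fun z => z + d)%C). apply cderiv_plus. apply cderiv_id. apply cderiv_const.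
    apply Hh. unfold Re in *; simpl. lra.
Qed.

(** Near [w] the function vanishes identically, so Schwarz's lemma can divide it by the Blaschke
    factor of [w] again and again without losing the bound [M + 1]. Since [B], the inverse of that
    factor, has modulus greater than 1, its powers force [D s] to be 0. *)
Lemma identity_rhp (D : C -> C) (M S : R) : hol_rhp D -> 0 < S ->
  (forall s, 0 < Re s -> Cmod (D s) <= M) -> (forall s, S < Re s -> D s = 0) ->
  forall s, 0 < Re s -> D s = 0.
Proof.
  intros HD HS HM HZ.
  set (w := RtoC (S + 1)). assert (Rw : Re w = S + 1) by reflexivity.
  assert (HM' : 0 < M + 1).
  { pose proof (HM w). pose proof (Cmod_ge_0 (D w)). lra. }
  set (B := fun s => ((s + Cconj w) / (s - w))%C).
  assert (Bw : forall s, s <> w -> (s - w)%C <> 0) by (intros; apply Cminus_neq_0; auto).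
  assert (HN : forall N s, 0 < Re s -> Cmod (D s) * Cmod (B s) ^ N <= M + 1).
  { induction N as [|N IH]; intros s Hs.
    - specialize (HM s Hs). lra.
    - destruct (excluded_middle_informative (s = w)) as [E|E].
      { rewrite HZ, Cmod_0. lra. subst s. lra. }
      pose proof (schwarz_lemma (fun s => D s * (Cpow (B s) N * (/ (M + 1))%R))%C w) as Sc.
      assert (Q : Cmod (D s * (Cpow (B s) N * (/ (M + 1))%R)) * Cmod (s + Cconj w) <= Cmod (s - w)).
      { apply Sc; auto.
        - lra.
        - rewrite HZ by pos. ring.
        (* The pole of [B] at [w] is harmless: the product is zero on a neighbourhood of [w]. *)
        - intros z Hz. destruct (excluded_middle_informative (z = w)) as [Ez|Ez].
          + exists 0. apply cderiv_ext_loc with (f := fun _ => RtoC 0) (r := 1); [lra| |apply cderiv_const].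
            intros y Hy. rewrite HZ. ring. subst z. pose proof (Re_near y w) as Q. lra.
          + destruct (HD z Hz) as [l Hl].
            destruct (cderiv_pow B z N) as [m Hm]; [unfold B; eexists; cder; auto|].
            eexists. cder.
        - intros z Hz. specialize (IH z Hz). rewrite !Cmod_mult, Cmod_pow, Cmod_R_pos.
          rewrite <- Rmult_assoc. apply Rle_div_l; auto. lra. left. apply Rinv_0_lt_compat; auto. }
      rewrite !Cmod_mult, Cmod_pow, Cmod_R_pos in Q. 2: pos.
      simpl pow. unfold B at 1. rewrite Cmod_div by auto.
      assert (P : 0 < Cmod (s - w)) by (apply Cmod_gt_0; auto).
      set (X := Cmod (D s) * Cmod (B s) ^ N) in *.
      replace (Cmod (D s) * (Cmod (s + Cconj w) / Cmod (s - w) * Cmod (B s) ^ N))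
        with (X * Cmod (s + Cconj w) / Cmod (s - w)) by (unfold X; field; lra).
      apply Rle_div_l; auto.
      replace (Cmod (D s) * (Cmod (B s) ^ N * / (M + 1)) * Cmod (s + Cconj w))
        with (X * Cmod (s + Cconj w) / (M + 1)) in Q by (unfold X; field; lra).
      apply Rle_div_l in Q; auto. lra. }
  intros s Hs. destruct (excluded_middle_informative (s = w)) as [E|E].
  { apply HZ. subst s. lra. }
  apply Cmod_zero_le. apply Rnot_lt_le. intros Hlt.
  assert (P : 0 < Cmod (s - w)) by (apply Cmod_gt_0; auto).
  assert (HB : 1 < Cmod (B s)).
  { unfold B. rewrite Cmod_div by auto. apply Rlt_div_r; auto. rewrite Rmult_1_l.
    apply Cmod_conj_sum_gt; auto. lra. }
  destruct (pow_unbounded (Cmod (B s)) ((M + 1) / Cmod (D s)) HB) as [N H].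
  apply Rlt_div_l in H; auto. specialize (HN N s Hs). lra.
Qed.

(** [pick_lower] between [s] and a large real [x], multiplied by [e ^ 2] with [e = / x]; letting [e]
    tend to 0 leaves the claim. *)
Lemma julia_lemma (Phi : C -> C) (c M X : R) : pick_ineq Phi -> (forall s, 0 < Re s -> 0 < Re (Phi s)) ->
  (forall x : R, X < x -> Cmod (Phi x - c * x) <= M) ->
  forall s, 0 < Re s -> c * Re s <= Re (Phi s).
Proof.
  intros Hp Hpos HM s Hs.
  pose proof (Rabs_pos X) as AX. pose proof (Rle_abs X) as AX'.
  apply Rle_quadratic_limit with (e0 := / (Rabs X + 1)) (c := Re s * M + 2 * Re (Phi s) * Re s) (d := Re (Phi s) * Cmod s ^ 2).
  { pos. }
  intros e He He'. set (x := / e).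
  assert (Hx : X < x).
  { apply Rle_lt_trans with (Rabs X + 1). lra.
    rewrite <- (Rinv_inv (Rabs X + 1)). apply Rinv_lt_contravar; auto.
    apply Rmult_lt_0_compat; auto. apply Rinv_0_lt_compat. lra. }
  assert (Hx0 : 0 < x) by pos.
  assert (Hxe : x * e = 1) by (unfold x; field; lra).
  specialize (HM x Hx).
  assert (Rx : Re x = x) by reflexivity.
  pose proof (pick_lower Phi s x Hp) as L.
  assert (Hn : nonneg_rhp Phi) by pos. specialize (L Hn Hs Hx0).
  pose proof (Re_abs (Phi x - c * x)%C) as Q.
  replace (Re (Phi x - c * x)%C) with (Re (Phi x) - c * x) in Q by Re_ring.
  assert (E : Cmod (s + Cconj x) ^ 2 = x ^ 2 + 2 * Re s * x + Cmod s ^ 2).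
  { rewrite !Cmod2_alt. unfold Re, Im; simpl. ring. }
  rewrite E in L.
  assert (L2 : Re s * x * (c * x - M) <= Re (Phi s) * (x ^ 2 + 2 * Re s * x + Cmod s ^ 2)).
  { eapply Rle_trans; [|exact L]. apply Rmult_le_compat_l; nra. }
  apply Rmult_le_compat_r with (r := e * e) in L2; [|nra].
  replace (Re s * x * (c * x - M) * (e * e)) with (Re s * (x * e) * (c * (x * e) - M * e)) in L2 by ring.
  replace (Re (Phi s) * (x ^ 2 + 2 * Re s * x + Cmod s ^ 2) * (e * e)) with
    (Re (Phi s) * ((x * e) ^ 2 + 2 * Re s * (x * e) * e + Cmod s ^ 2 * (e * e))) in L2 by ring.
  rewrite Hxe in L2. nra.
Qed.

(** * Dirichlet polynomials and their mean values *)

Definition cis (y : R) : C := Cexp (0, y).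

Lemma cis_plus x y : cis (x + y) = (cis x * cis y)%C.
Proof. unfold cis. rewrite <- Cexp_plus. f_equal. apply C_eq; simpl; ring. Qed.

Lemma Cmod_cis y : Cmod (cis y) = 1.
Proof. unfold cis. rewrite Cmod_Cexp. apply exp_0. Qed.

Lemma cis_0 : cis 0 = 1.
Proof. apply Cexp_0. Qed.

Lemma rderiv_plus (g h : R -> C) (t : R) (v w : C) :
  rderiv g t v -> rderiv h t w -> rderiv (fun u => g u + h u)%C t (v + w)%C.
Proof. intros [H1 H2] [H3 H4]. split; apply @is_derive_plus; auto. Qed.

Lemma rderiv_scal (c : C) (g : R -> C) (t : R) (v : C) : rderiv g t v -> rderiv (fun u => c * g u)%C t (c * v)%C.
Proof.
  intros [H1 H2]. split.
  - apply (is_derive_ext (fun u => Re c * Re (g u) - Im c * Im (g u))); [reflexivity|].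
    apply @is_derive_minus; apply is_derive_scal; auto.
  - apply (is_derive_ext (fun u => Re c * Im (g u) + Im c * Re (g u))); [reflexivity|].
    apply @is_derive_plus; apply is_derive_scal; auto.
Qed.

Lemma rderiv_const (c : C) (t : R) : rderiv (fun _ => c) t 0.
Proof. split; apply @is_derive_const. Qed.

Lemma rderiv_cis (la t : R) : rderiv (fun y => cis (la * y)) t (Ci * la * cis (la * t)%R)%C.
Proof.
  unfold cis, Cexp, rderiv, Ci, RtoC, Re, Im, Cmult; simpl.
  split; auto_derive; auto; ring.
Qed.

Definition tpoly := list (C * R).

Fixpoint teval (l : tpoly) (y : R) : C :=
  match l with nil => RtoC 0 | p :: l => (fst p * cis (snd p * y)%R + teval l y)%C end.

Fixpoint tcoef (l : tpoly) (mu : R) : C :=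
  match l with nil => RtoC 0
  | p :: l => ((if Req_EM_T (snd p) mu then fst p else RtoC 0) + tcoef l mu)%C end.

(** Terms of nonzero frequency have bounded primitives; only frequency 0 contributes linear
    growth. *)
Lemma tprim (l : tpoly) : exists (P : R -> C) (M : R), (forall y, rderiv P y (teval l y)) /\
  forall y, Cmod (P y - y * tcoef l 0) <= M.
Proof.
  induction l as [|[c la] l [P [M [HP HM]]]].
  - exists (fun _ => RtoC 0), 0. split. intros y. apply rderiv_const.
    intros y. simpl. replace (0 - y * 0)%C with (RtoC 0) by ring. rewrite Cmod_0. lra.
  - simpl. destruct (Req_EM_T la 0) as [E|E].
    + subst la. exists (fun y : R => y * c + P y)%C, M. split.
      * intros y. apply rderiv_plus; auto. rewrite Rmult_0_l, cis_0.
        unfold rderiv, Re, Im, Cmult, RtoC; simpl. split; auto_derive; auto; ring.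
      * intros y. replace (y * c + P y - y * (c + tcoef l 0))%C with (P y - y * tcoef l 0)%C by ring. auto.
    +
      exists (fun y : R => (c / (Ci * la)) * cis (la * y)%R + P y)%C, (Cmod (c / (Ci * la)) + M). split.
      * intros y. apply rderiv_plus; auto.
        replace (c * cis (la * y)%R)%C with (c / (Ci * la) * (Ci * la * cis (la * y)%R))%C.
        apply rderiv_scal. apply rderiv_cis. field. split; [apply RtoC_neq; auto|].
        intros Q. apply (f_equal Im) in Q. simpl in Q. lra.
      * intros y. rewrite Cplus_0_l.
        replace (c / (Ci * la) * cis (la * y)%R + P y - y * tcoef l 0)%C
          with (c / (Ci * la) * cis (la * y)%R + (P y - y * tcoef l 0))%C by ring.
        eapply Rle_trans. apply Cmod_triangle. rewrite Cmod_mult, Cmod_cis, Rmult_1_r.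
        specialize (HM y). lra.
Qed.

(** Mean values in primitive form: instead of a limit of averages, the primitive at [T] is compared
    with [T] times the mean, and [linear_bound] reads off the inequality between the slopes. *)
Lemma tmean_approx (l : tpoly) (G g : R -> C) (e : R) :
  (forall y, 0 <= y -> rderiv G y (g y)) -> (forall y, 0 <= y -> Cmod (g y - teval l y) <= e) ->
  exists M, forall T, 0 <= T -> Cmod (G T - T * tcoef l 0) <= e * T + M.
Proof.
  intros HG Hg. destruct (tprim l) as [P [M [HP HM]]].
  exists (M + Cmod (G 0 - P 0)). intros T HT.
  pose proof (rderiv_MVI (fun y => G y - P y)%C (fun y => g y - teval l y)%C 0 T e HT) as Q.
  assert (Q' : Cmod (G T - P T - (G 0 - P 0)) <= e * (T - 0)).
  { apply Q; intros; [apply rderiv_minus; auto; apply HG; lra|apply Hg; lra]. }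
  replace (G T - T * tcoef l 0)%C with ((G T - P T - (G 0 - P 0)) + ((P T - T * tcoef l 0) + (G 0 - P 0)))%C by ring.
  eapply Rle_trans. apply Cmod_triangle.
  pose proof (Cmod_triangle (P T - T * tcoef l 0) (G 0 - P 0)). specialize (HM T). lra.
Qed.

Lemma linear_bound (a b M : R) : (forall T, 0 <= T -> a * T <= b * T + M) -> a <= b.
Proof.
  intros H. apply Rnot_lt_le. intros Hlt.
  pose proof (Rabs_pos M). pose proof (Rle_abs M).
  specialize (H ((Rabs M + 1) / (a - b))).
  assert (0 <= (Rabs M + 1) / (a - b)) by pos.
  assert (E : (a - b) * ((Rabs M + 1) / (a - b)) = Rabs M + 1) by (field; lra). lra.
Qed.

Lemma tmean_bound (l : tpoly) (B : R) : (forall y, Cmod (teval l y) <= B) -> Cmod (tcoef l 0) <= B.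
Proof.
  intros HB.
  destruct (tmean_approx l (fun _ => RtoC 0) (fun _ => RtoC 0) B) as [M HM].
  - intros. apply rderiv_const.
  - intros y _. replace (0 - teval l y)%C with (- teval l y)%C by ring. rewrite Cmod_opp. auto.
  - apply linear_bound with M. intros T HT. specialize (HM T HT).
    replace (0 - T * tcoef l 0)%C with (- (T * tcoef l 0))%C in HM by ring.
    rewrite Cmod_opp, Cmod_mult, Cmod_R_pos in HM; auto. lra.
Qed.

Definition tscale (c : C) (mu : R) (l : tpoly) : tpoly :=
  map (fun p => ((c * fst p)%C, snd p + mu)) l.

Lemma teval_tscale c mu l y : teval (tscale c mu l) y = (c * cis (mu * y)%R * teval l y)%C.
Proof.
  induction l as [|[a la] l IH]; simpl. ring.
  rewrite IH. replace ((la + mu) * y) with (mu * y + la * y) by ring. rewrite cis_plus. ring.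
Qed.

Lemma tcoef_tscale c mu l nu : tcoef (tscale c mu l) nu = (c * tcoef l (nu - mu)%R)%C.
Proof.
  induction l as [|[a la] l IH]; simpl. ring.
  rewrite IH. destruct (Req_EM_T (la + mu) nu), (Req_EM_T la (nu - mu)); try lra; ring.
Qed.

Lemma teval_app l l' y : teval (l ++ l') y = (teval l y + teval l' y)%C.
Proof. induction l as [|p l IH]; simpl. ring. rewrite IH. ring. Qed.

Lemma tcoef_app l l' y : tcoef (l ++ l') y = (tcoef l y + tcoef l' y)%C.
Proof. induction l as [|p l IH]; simpl. ring. rewrite IH. ring. Qed.

(** * The powers of integers and Dirichlet polynomials *)

Definition lnS (n : nat) : R := ln (INR (S n)).

Lemma INR_S_pos n : 0 < INR (S n).
Proof. apply lt_0_INR. lia. Qed.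

Lemma INR_S_ge1 n : 1 <= INR (S n).
Proof. rewrite S_INR. pose proof (pos_INR n). lra. Qed.

Lemma lnS_0 : lnS 0 = 0.
Proof. apply ln_1. Qed.

Lemma lnS_ge0 n : 0 <= lnS n.
Proof.
  unfold lnS. rewrite <- ln_1. pose proof (INR_S_ge1 n).
  destruct (Rle_lt_or_eq_dec _ _ H) as [L|L]. left. apply ln_increasing; lra. rewrite <- L. lra.
Qed.

Lemma lnS_inj n m : lnS n = lnS m -> n = m.
Proof.
  intros H. apply ln_inv in H; try apply INR_S_pos. apply INR_eq in H. lia.
Qed.

Lemma lnS_pos n : (1 <= n)%nat -> 0 < lnS n.
Proof.
  intros H. pose proof (lnS_ge0 n). destruct (Rle_lt_or_eq_dec _ _ H0) as [L|L]; auto.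
  rewrite <- lnS_0 in L. apply lnS_inj in L. lia.
Qed.

(* [(n + 1)^(-s)]: indices are shifted so that series start at [0]. *)
Definition npow (n : nat) (s : C) : C := nat_cpow_opp (S n) s.

Lemma npow_exp n s : npow n s = Cexp (- (s * lnS n)).
Proof. reflexivity. Qed.

Lemma npow_0 s : npow 0 s = 1.
Proof. rewrite npow_exp, lnS_0. replace (- (s * 0))%C with (RtoC 0) by ring. apply Cexp_0. Qed.

Lemma npow_plus n s z : npow n (s + z) = (npow n s * npow n z)%C.
Proof. rewrite !npow_exp, <- Cexp_plus. f_equal. ring. Qed.

Lemma Cmod_npow n s : Cmod (npow n s) = exp (- (Re s * lnS n)).
Proof. rewrite npow_exp, Cmod_Cexp. f_equal. unfold Re; simpl. ring. Qed.

Lemma npow_vert n (x y : R) : npow n (x, y) = (npow n x * cis (- lnS n * y)%R)%C.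
Proof. rewrite !npow_exp. unfold cis. rewrite <- Cexp_plus. f_equal. apply C_eq; simpl; ring. Qed.

(** With shifted indices, [n * m + n + m] stands for the integer [(n + 1) (m + 1)]. *)
Lemma npow_mult n m s : npow (n * m + n + m) s = (npow n s * npow m s)%C.
Proof.
  rewrite !npow_exp, <- Cexp_plus. f_equal.
  assert (E : lnS (n * m + n + m) = lnS n + lnS m).
  { unfold lnS. rewrite <- ln_mult by apply INR_S_pos. f_equal.
    rewrite <- mult_INR. f_equal. lia. }
  rewrite E, RtoC_plus. ring.
Qed.

(** Exponents may be repeated, so a sum is a concatenation and products need no normalization;
    [dcoef] collects the repetitions. *)
Definition dpoly := list (C * nat).

Fixpoint deval (l : dpoly) (s : C) : C :=
  match l with nil => RtoC 0 | p :: l => (fst p * npow (snd p) s + deval l s)%C end.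

Fixpoint dcoef (l : dpoly) (n : nat) : C :=
  match l with nil => RtoC 0
  | p :: l => ((if Nat.eq_dec (snd p) n then fst p else RtoC 0) + dcoef l n)%C end.

Definition dline (l : dpoly) (x : R) : tpoly :=
  map (fun p => ((fst p * npow (snd p) x)%C, - lnS (snd p))) l.

Lemma teval_dline l x y : teval (dline l x) y = deval l (x, y).
Proof.
  induction l as [|[c n] l IH]; simpl; auto. rewrite IH, (npow_vert n x y). ring.
Qed.

Lemma tcoef_dline l x n : tcoef (dline l x) (- lnS n) = (dcoef l n * npow n x)%C.
Proof.
  induction l as [|[c m] l IH]; simpl. ring. rewrite IH.
  destruct (Req_EM_T (- lnS m) (- lnS n)) as [E|E], (Nat.eq_dec m n) as [E'|E'].
  - subst. ring.
  - exfalso. apply E', lnS_inj. lra.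
  - subst. tauto.
  - ring.
Qed.

Lemma tcoef_dline_pos l x mu : 0 < mu -> tcoef (dline l x) mu = 0.
Proof.
  intros H. induction l as [|[c m] l IH]; simpl; auto. rewrite IH.
  destruct Req_EM_T as [E|E]. pose proof (lnS_ge0 m). lra. ring.
Qed.

(** The coefficient is recovered as the mean value of the polynomial times the conjugate oscillation
    along the line [Re s = x]. *)
Lemma dcoef_bound l x n B : (forall s, Re s = x -> Cmod (deval l s) <= B) ->
  Cmod (dcoef l n) * exp (- (x * lnS n)) <= B.
Proof.
  intros H. replace (exp (- (x * lnS n))) with (Cmod (npow n x)) by apply Cmod_npow.
  rewrite <- Cmod_mult, <- tcoef_dline.
  replace (- lnS n) with (0 - lnS n) by ring.
  replace (tcoef (dline l x) (0 - lnS n)) with (tcoef (tscale 1 (lnS n) (dline l x)) 0)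
    by (rewrite tcoef_tscale; ring).
  apply tmean_bound. intros y. rewrite teval_tscale, teval_dline, !Cmod_mult, Cmod_cis, Cmod_1.
  rewrite !Rmult_1_l. apply H. reflexivity.
Qed.

Fixpoint csum (f : nat -> C) (n : nat) : C :=
  match n with O => RtoC 0 | S n => (csum f n + f n)%C end.

Lemma csum_ext f g n : (forall k, (k < n)%nat -> f k = g k) -> csum f n = csum g n.
Proof. induction n as [|n IH]; intros H; simpl; auto. rewrite IH, H by auto. auto. Qed.

Lemma csum_plus f g n : csum (fun k => f k + g k)%C n = (csum f n + csum g n)%C.
Proof. induction n as [|n IH]; simpl. ring. rewrite IH. ring. Qed.

Lemma csum_scal c f n : csum (fun k => c * f k)%C n = (c * csum f n)%C.
Proof. induction n as [|n IH]; simpl. ring. rewrite IH. ring. Qed.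

Lemma csum_minus f g n : csum (fun k => f k - g k)%C n = (csum f n - csum g n)%C.
Proof. induction n as [|n IH]; simpl. ring. rewrite IH. ring. Qed.

Lemma csum_0 n : csum (fun _ => RtoC 0) n = 0.
Proof. induction n as [|n IH]; simpl; auto. rewrite IH. ring. Qed.

Lemma csum_single c k n : (k < n)%nat -> csum (fun j => if Nat.eq_dec k j then c else RtoC 0) n = c.
Proof.
  induction n as [|n IH]; intros H. lia. simpl. destruct (Nat.eq_dec k n).
  - rewrite (csum_ext _ (fun _ => RtoC 0)), csum_0. ring.
    intros j Hj. destruct Nat.eq_dec; auto. lia.
  - rewrite IH by lia. ring.
Qed.

Lemma deval_csum l : exists N0, forall N, (N0 <= N)%nat -> forall s,
  deval l s = csum (fun n => dcoef l n * npow n s)%C N.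
Proof.
  induction l as [|[c m] l [N0 IH]].
  - exists O. intros N _ s. simpl. rewrite (csum_ext _ (fun _ => RtoC 0)), csum_0; auto. intros; ring.
  - exists (S (max N0 m)). intros N HN s. simpl. rewrite (IH N) by lia.
    symmetry. etransitivity.
    + apply csum_ext with (g := fun n => ((if Nat.eq_dec m n then c * npow m s else RtoC 0) + dcoef l n * npow n s)%C).
      intros k _. destruct Nat.eq_dec; subst; ring.
    + rewrite csum_plus, csum_single by lia. auto.
Qed.

Fixpoint dtrunc (b : nat -> C) (N : nat) : dpoly :=
  match N with O => nil | S N => (b N, N) :: dtrunc b N end.

Lemma deval_dtrunc b N s : deval (dtrunc b N) s = csum (fun n => b n * npow n s)%C N.
Proof. induction N as [|N IH]; simpl; auto. rewrite IH. ring. Qed.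

Lemma dcoef_dtrunc b N n : (n < N)%nat -> dcoef (dtrunc b N) n = b n.
Proof.
  induction N as [|N IH]; intros H. lia. simpl. destruct Nat.eq_dec as [E|E].
  - subst. assert (Z : forall M, (M <= n)%nat -> dcoef (dtrunc b M) n = 0).
    { induction M as [|M IHM]; intros HM; simpl; auto. rewrite IHM by lia.
      destruct Nat.eq_dec. lia. ring. }
    rewrite Z by auto. ring.
  - rewrite IH by lia. ring.
Qed.

Lemma deval_app l l' s : deval (l ++ l') s = (deval l s + deval l' s)%C.
Proof. induction l as [|p l IH]; simpl. ring. rewrite IH. ring. Qed.

Fixpoint dmul (l l' : dpoly) : dpoly :=
  match l with nil => nil
  | p :: l => map (fun q => ((fst p * fst q)%C, (snd p * snd q + snd p + snd q)%nat)) l' ++ dmul l l' end.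

Lemma deval_dmul l l' s : deval (dmul l l') s = (deval l s * deval l' s)%C.
Proof.
  induction l as [|[c n] l IH]; simpl. ring. rewrite deval_app, IH.
  assert (E : deval (map (fun q => ((c * fst q)%C, (n * snd q + n + snd q)%nat)) l') s = (c * npow n s * deval l' s)%C).
  { clear IH. induction l' as [|[c' m] l' IH]; simpl. ring. rewrite IH, npow_mult. ring. }
  rewrite E. ring.
Qed.

Lemma deval_bounded l : exists M, 0 <= M /\ forall s, 0 <= Re s -> Cmod (deval l s) <= M.
Proof.
  induction l as [|[c n] l [M [HM IH]]].
  - exists 0. split. lra. intros. simpl. rewrite Cmod_0. lra.
  - exists (Cmod c + M). split. pose proof (Cmod_ge_0 c). lra. intros s Hs. simpl.
    eapply Rle_trans. apply Cmod_triangle. specialize (IH s Hs). rewrite Cmod_mult, Cmod_npow.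
    pose proof (lnS_ge0 n). assert (exp (- (Re s * lnS n)) <= 1).
    { rewrite <- exp_0. apply exp_le. nra. }
    pose proof (Cmod_ge_0 c). nra.
Qed.

(** Uniform limits of Dirichlet polynomials on a closed half-plane with [0 <= x] form an algebra
    stable under the exponential, under inversion near a nonzero constant and under uniform limits.
    [dunif_dirichlet] turns membership into a convergent series further to the right. *)
Definition dunif (x : R) (f : C -> C) : Prop :=
  forall e, 0 < e -> exists l, forall s, x <= Re s -> Cmod (f s - deval l s) <= e.

Section Dunif.
Variable x : R.
Hypothesis Hx : 0 <= x.

Lemma dunif_ext f g : (forall s, x <= Re s -> f s = g s) -> dunif x f -> dunif x g.
Proof. intros E H e He. destruct (H e He) as [l Hl]. exists l. intros s Hs. rewrite <- E; auto. Qed.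

Lemma dunif_lim f : (forall e, 0 < e -> exists g, dunif x g /\ forall s, x <= Re s -> Cmod (f s - g s) <= e) ->
  dunif x f.
Proof.
  intros H e He. destruct (H (e / 2)) as [g [Hg H1]]; [lra|].
  destruct (Hg (e / 2)) as [l Hl]; [lra|]. exists l. intros s Hs.
  pose proof (Cmod_tri (f s) (g s) (deval l s)). specialize (H1 s Hs). specialize (Hl s Hs). lra.
Qed.

Lemma dunif_deval l : dunif x (deval l).
Proof. intros e He. exists l. intros. rewrite Cmod_diff_0. lra. Qed.

Lemma dunif_npow n : dunif x (npow n).
Proof.
  apply dunif_ext with (f := deval ((RtoC 1, n) :: nil)); [|apply dunif_deval].
  intros. simpl. ring.
Qed.

Lemma dunif_const c : dunif x (fun _ => c).
Proof.
  apply dunif_ext with (f := deval ((c, O) :: nil)); [|apply dunif_deval].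
  intros. simpl. rewrite npow_0. ring.
Qed.

Lemma dunif_plus f g : dunif x f -> dunif x g -> dunif x (fun s => f s + g s)%C.
Proof.
  intros Hf Hg e He. destruct (Hf (e / 2)) as [l Hl]; [lra|]. destruct (Hg (e / 2)) as [l' Hl']; [lra|].
  exists (l ++ l'). intros s Hs. rewrite deval_app.
  replace (f s + g s - (deval l s + deval l' s))%C with ((f s - deval l s) + (g s - deval l' s))%C by ring.
  eapply Rle_trans. apply Cmod_triangle. specialize (Hl s Hs). specialize (Hl' s Hs). lra.
Qed.

Lemma dunif_bounded f : dunif x f -> exists M, 0 < M /\ forall s, x <= Re s -> Cmod (f s) <= M.
Proof.
  intros H. destruct (H 1 Rlt_0_1) as [l Hl]. destruct (deval_bounded l) as [M [HM H1]].
  exists (M + 1). split. lra. intros s Hs. specialize (Hl s Hs). specialize (H1 s ltac:(lra)).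
  pose proof (Cmod_sub_ge (f s) (deval l s)). lra.
Qed.

Lemma dunif_mult f g : dunif x f -> dunif x g -> dunif x (fun s => f s * g s)%C.
Proof.
  intros Hf Hg e He. destruct (dunif_bounded g Hg) as [M [HM HgM]].
  destruct (Hf (e / (2 * M))) as [l Hl]. { pos. }
  destruct (deval_bounded l) as [M' [HM' H1]].
  destruct (Hg (e / (2 * (M' + 1)))) as [l' Hl']. { pos. }
  exists (dmul l l'). intros s Hs. rewrite deval_dmul.
  replace (f s * g s - deval l s * deval l' s)%C
    with ((f s - deval l s) * g s + deval l s * (g s - deval l' s))%C by ring.
  eapply Rle_trans. apply Cmod_triangle. rewrite !Cmod_mult.
  specialize (Hl s Hs). specialize (Hl' s Hs). specialize (H1 s ltac:(lra)). specialize (HgM s Hs).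
  apply Rle_div_r in Hl; [|lra]. apply Rle_div_r in Hl'; [|lra].
  pose proof (Cmod_ge_0 (f s - deval l s)). pose proof (Cmod_ge_0 (g s - deval l' s)).
  nra.
Qed.

Lemma dunif_minus f g : dunif x f -> dunif x g -> dunif x (fun s => f s - g s)%C.
Proof.
  intros Hf Hg. apply dunif_ext with (f := fun s => (f s + (-1)%R * g s)%C).
  intros. C_ring.
  apply dunif_plus; auto. apply dunif_mult; auto. apply dunif_const.
Qed.

Lemma dunif_pow f n : dunif x f -> dunif x (fun s => Cpow (f s) n).
Proof.
  intros Hf. induction n as [|n IH]; simpl. apply (dunif_const 1). apply dunif_mult; auto.
Qed.

Lemma dunif_csum (f : nat -> C -> C) n : (forall k, dunif x (f k)) -> dunif x (fun s => csum (fun k => f k s) n).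
Proof.
  intros Hf. induction n as [|n IH]; simpl. apply dunif_const. apply dunif_plus; auto.
Qed.

(** The usual telescoping estimate; the extra factor [M] on the left avoids the exponent [n - 1]. *)
Lemma Cpow_diff (a b : C) (M : R) n : Cmod a <= M -> Cmod b <= M ->
  Cmod (Cpow a n - Cpow b n) * M <= INR n * M ^ n * Cmod (a - b).
Proof.
  intros Ha Hb. assert (HM : 0 <= M) by (pose proof (Cmod_ge_0 a); lra).
  induction n as [|n IH].
  - simpl. rewrite Cmod_diff_0. lra.
  - rewrite S_INR. cbn [Cpow pow].
    replace (a * a ^ n - b * b ^ n)%C with (a * (a ^ n - b ^ n) + (a - b) * b ^ n)%C by ring.
    pose proof (Cmod_triangle (a * (a ^ n - b ^ n)) ((a - b) * b ^ n)) as T.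
    rewrite !Cmod_mult, Cmod_pow in T.
    assert (Cmod b ^ n <= M ^ n) by (apply pow_incr; split; auto; apply Cmod_ge_0).
    pose proof (Cmod_ge_0 (a ^ n - b ^ n)). pose proof (Cmod_ge_0 (a - b)).
    pose proof (Cmod_ge_0 a).
    apply Rle_trans with ((Cmod a * Cmod (a ^ n - b ^ n) + Cmod (a - b) * Cmod b ^ n) * M).
    { pos. }
    assert (Cmod a * (Cmod (a ^ n - b ^ n) * M) <= M * (INR n * M ^ n * Cmod (a - b))).
    { apply Rmult_le_compat; auto. apply Rmult_le_pos; auto. }
    assert (Cmod (a - b) * Cmod b ^ n * M <= Cmod (a - b) * M ^ n * M).
    { apply Rmult_le_compat_r; auto. apply Rmult_le_compat_l; auto. }
    lra.
Qed.

(** The approximants are [(1 + f / N) ^ N]. [Cexp_quad] bounds the error of one factor and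
    [Cpow_diff] that of the power, for a total of [B / N]. *)
Lemma dunif_exp f : dunif x f -> dunif x (fun s => Cexp (f s)).
Proof.
  intros Hf. destruct (dunif_bounded f Hf) as [M [HM HfM]].
  apply dunif_lim. intros e He.
  set (B := M ^ 2 * exp M * exp M).
  assert (HB : 0 < B) by pos.
  destruct (nfloor_ex (B / e + 1)) as [n [_ Hn]].
  { assert (0 < B / e) by pos. lra. }
  set (N := INR (S n)).
  assert (HN : B / e < N). { unfold N. rewrite S_INR. lra. }
  assert (HN1 : 1 <= N) by apply INR_S_ge1.
  exists (fun s => Cpow (1 + (/ N)%R * f s) (S n)). split.
  { apply dunif_pow, dunif_plus. apply dunif_const. apply dunif_mult; auto. apply dunif_const. }
  intros s Hs. specialize (HfM s Hs). set (z := ((/ N)%R * f s)%C).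
  assert (HiN : 0 < / N) by pos.
  assert (Hz : Cmod z <= M / N).
  { unfold z. rewrite Cmod_mult, Cmod_R_pos by lra. rewrite Rmult_comm.
    apply Rmult_le_compat_r; lra. }
  assert (Ez : f s = (INR (S n) * z)%C).
  { unfold z. fold N. rewrite RtoC_inv by lra. field. apply RtoC_neq; lra. }
  rewrite Ez, Cexp_pow.
  assert (HMN : M / N <= M). { apply Rle_div_l; nra. }
  assert (A1 : Cmod (Cexp z) <= exp (M / N)).
  { rewrite Cmod_Cexp. apply exp_le. pose proof (Re_abs z). lra. }
  assert (A2 : Cmod (1 + z) <= exp (M / N)).
  { eapply Rle_trans. apply Cmod_triangle. rewrite Cmod_1. pose proof (exp_ineq1_le (M / N)). lra. }
  pose proof (Cpow_diff (Cexp z) (1 + z) (exp (M / N)) (S n) A1 A2) as P.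
  assert (Ep : exp (M / N) ^ S n = exp M).
  { rewrite <- Rpower_pow by apply exp_pos. unfold Rpower. rewrite ln_exp. fold N. f_equal. field. lra. }
  rewrite Ep in P. fold N in P.
  pose proof (Cexp_quad z) as Q. replace (Cexp z - 1 - z)%C with (Cexp z - (1 + z))%C in Q by ring.
  assert (E1 : 1 <= exp (M / N)). { rewrite <- exp_0. apply exp_le. apply Rdiv_le_0_compat; lra. }
  pose proof (Cmod_ge_0 (Cexp z ^ S n - (1 + z) ^ S n)).
  assert (Q1 : Cmod (Cexp z - (1 + z)) <= (M / N) ^ 2 * exp M).
  { eapply Rle_trans. apply Q. apply Rmult_le_compat. apply pow2_ge_0. left; apply exp_pos.
    apply pow_incr. split; auto. apply Cmod_ge_0. apply exp_le. lra. }
  apply Rle_trans with (Cmod (Cexp z ^ S n - (1 + z) ^ S n) * exp (M / N)). nra.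
  eapply Rle_trans. apply P.
  apply Rle_trans with (N * exp M * ((M / N) ^ 2 * exp M)).
  { apply Rmult_le_compat_l; auto. pose proof (exp_pos M). nra. }
  replace (N * exp M * ((M / N) ^ 2 * exp M)) with (B / N) by (unfold B; field; lra).
  apply Rle_div_l. lra. apply Rlt_div_l in HN; auto. lra.
Qed.

(** A geometric series in [g = 1 - f / c], whose modulus is at most [/ 2]. *)
Lemma dunif_inv f (c : C) : c <> 0 -> dunif x f -> (forall s, x <= Re s -> Cmod (f s - c) <= Cmod c / 2) ->
  dunif x (fun s => / f s)%C.
Proof.
  intros Hc Hf Hb. pose proof Hc as Hc0. apply Cmod_gt_0 in Hc0.
  set (g := fun s => (1 - f s * / c)%C).
  assert (Hg : forall s, x <= Re s -> Cmod (g s) <= / 2).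
  { intros s Hs. replace (g s) with ((c - f s) * / c)%C by (unfold g; field; auto).
    rewrite Cmod_mult, Cmod_sym, Cmod_inv by auto.
    apply Rle_trans with (Cmod c / 2 * / Cmod c). apply Rmult_le_compat_r; auto. left.
    apply Rinv_0_lt_compat; auto. right. field. lra. }
  assert (Ug : dunif x g).
  { apply dunif_minus. apply dunif_const. apply dunif_mult; auto. apply dunif_const. }
  apply dunif_lim. intros e He.
  destruct (pow_lt_1_zero (/2)) with (y := e * Cmod c / 2) as [N HN].
  - rewrite Rabs_pos_eq; lra.
  - apply Rmult_lt_0_compat; [|lra]. apply Rmult_lt_0_compat; auto.
  - exists (fun s => / c * csum (fun k => Cpow (g s) k) N)%C. split.
    + apply dunif_mult. apply dunif_const. apply (dunif_csum (fun k s => Cpow (g s) k)).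
      intros. apply dunif_pow. auto.
    + intros s Hs. specialize (Hg s Hs). specialize (HN N (Nat.le_refl _)).
      rewrite Rabs_pos_eq in HN by pos.
      assert (Geo : forall z n, ((1 - z) * csum (fun k => Cpow z k) n = 1 - Cpow z n)%C).
      { intros z n. induction n as [|n IH]. simpl. ring. simpl csum.
        replace ((1 - z) * (csum (fun k => z ^ k) n + z ^ n))%C
          with ((1 - z) * csum (fun k => z ^ k) n + (1 - z) * z ^ n)%C by ring.
        rewrite IH. simpl. ring. }
      assert (Ef : f s = (c * (1 - g s))%C) by (unfold g; field; auto).
      assert (Hg1 : / 2 <= Cmod (1 - g s)).
      { pose proof (Cmod_sub_ge 1 (g s)) as Q. rewrite Cmod_1 in Q. lra. }
      assert (Hn1 : (1 - g s)%C <> 0) by (apply Cmod_pos_neq; lra).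
      rewrite Ef.
      replace (/ (c * (1 - g s)) - / c * csum (fun k => g s ^ k) N)%C
        with (Cpow (g s) N / (c * (1 - g s)))%C.
      2: { assert (G := Geo (g s) N).
           assert (G' : (Cpow (g s) N = 1 - (1 - g s) * csum (fun k => g s ^ k) N)%C) by (rewrite G; ring).
           rewrite G' at 1. field. auto. }
      rewrite Cmod_div, Cmod_mult, Cmod_pow by (apply Cmult_neq_0; auto).
      apply Rle_div_l. nra.
      apply Rle_trans with ((/2) ^ N). apply pow_incr. split; auto. apply Cmod_ge_0.
      assert (e * Cmod c * / 2 <= e * Cmod c * Cmod (1 - g s)) by (apply Rmult_le_compat_l; auto; nra). nra.
Qed.

End Dunif.

(** * Dirichlet series with polynomially bounded coefficients *)

Lemma Ccvg_const c : Ccvg (fun _ => c) c.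
Proof. intros e He. exists O. rewrite Cmod_diff_0. auto. Qed.

Lemma Ccvg_plus x y l m : Ccvg x l -> Ccvg y m -> Ccvg (fun n => x n + y n)%C (l + m)%C.
Proof.
  intros Hx Hy e He. destruct (Hx (e / 2)) as [N HN]; [lra|]. destruct (Hy (e / 2)) as [N' HN']; [lra|].
  exists (max N N'). intros n Hn. specialize (HN n ltac:(lia)). specialize (HN' n ltac:(lia)).
  replace (x n + y n - (l + m))%C with ((x n - l) + (y n - m))%C by ring.
  pose proof (Cmod_triangle (x n - l) (y n - m)). lra.
Qed.

Lemma Ccvg_scal c x l : Ccvg x l -> Ccvg (fun n => c * x n)%C (c * l)%C.
Proof.
  intros Hx e He. pose proof (Cmod_ge_0 c).
  destruct (Hx (e / (Cmod c + 1))) as [N HN]. { pos. }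
  exists N. intros n Hn. specialize (HN n Hn). apply Rlt_div_r in HN; [|lra].
  replace (c * x n - c * l)%C with (c * (x n - l))%C by ring. rewrite Cmod_mult.
  nra.
Qed.

Lemma Ccvg_ext x y l : (forall n, x n = y n) -> Ccvg x l -> Ccvg y l.
Proof. intros E H e He. destruct (H e He) as [N HN]. exists N. intros n Hn. rewrite <- E. auto. Qed.

Lemma Ccvg_csum (x : nat -> nat -> C) (l : nat -> C) N :
  (forall k, (k < N)%nat -> Ccvg (fun j => x j k) (l k)) -> Ccvg (fun j => csum (x j) N) (csum l N).
Proof.
  induction N as [|N IH]; intros H; simpl. apply Ccvg_const. apply Ccvg_plus; auto.
Qed.

Lemma Ccvg_unique x l m : Ccvg x l -> Ccvg x m -> l = m.
Proof.
  intros Hl Hm. apply C_of_Cmod_small. intros e He. eapply Ccvg_bound. apply Hl.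
  destruct (Hm e He) as [N HN]. exists N. intros n Hn. left. auto.
Qed.

Lemma sum_n_csum (t : nat -> C) n : sum_n (G := C_AbelianMonoid) t n = csum t (S n).
Proof.
  induction n as [|n IH].
  - rewrite sum_O. simpl. ring.
  - rewrite sum_Sn, IH. reflexivity.
Qed.

Lemma is_series_Ccvg (t : nat -> C) (l : C) :
  @is_series C_AbsRing C_NormedModule t l <-> Ccvg (csum t) l.
Proof.
  unfold is_series. rewrite (filterlim_locally_ball_norm (K := C_AbsRing) (U := C_NormedModule)). split.
  - intros H e He. destruct (H (mkposreal e He)) as [N HN]. exists (S N).
    intros n Hn. destruct n as [|n]. lia. specialize (HN n ltac:(lia)).
    rewrite <- sum_n_csum. exact HN.
  - intros H e. destruct (H e (cond_pos e)) as [N HN]. exists N. intros n Hn.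
    specialize (HN (S n) ltac:(lia)). rewrite <- sum_n_csum in HN. exact HN.
Qed.

Lemma exp_m2_lnS n : exp (- (2 * lnS n)) = / INR (S n) ^ 2.
Proof.
  replace (- (2 * lnS n)) with (- lnS n + - lnS n) by ring. rewrite exp_plus, exp_Ropp.
  unfold lnS. rewrite exp_ln by apply INR_S_pos. pose proof (INR_S_pos n). field. lra.
Qed.

(** The weight is [u ^ (-2)] with [u] the integer of the term, and [u ^ (-2) <= 2 / u - 2 / (u + 1)]
    telescopes. *)
Lemma csum_tail (t : nat -> C) (Q : R) (N N' : nat) : (N <= N')%nat -> 0 <= Q ->
  (forall n, (N <= n)%nat -> Cmod (t n) <= Q * exp (- (2 * lnS n))) ->
  Cmod (csum t N' - csum t N) <= 2 * Q / INR (S N).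
Proof.
  intros HN HQ Ht.
  assert (H : forall m, Cmod (csum t (N + m) - csum t N) <= 2 * Q / INR (S N) - 2 * Q / INR (S (N + m))).
  { induction m as [|m IH].
    - rewrite Nat.add_0_r, Cmod_diff_0. lra.
    - rewrite Nat.add_succ_r. simpl csum.
      replace (csum t (N + m) + t (N + m)%nat - csum t N)%C with ((csum t (N + m) - csum t N) + t (N + m)%nat)%C by ring.
      eapply Rle_trans. apply Cmod_triangle. specialize (Ht (N + m)%nat ltac:(lia)).
      rewrite exp_m2_lnS in Ht. rewrite (S_INR (S (N + m))).
      pose proof (INR_S_ge1 (N + m)). set (u := INR (S (N + m))) in *.
      assert (Q * / u ^ 2 <= 2 * Q / u - 2 * Q / (u + 1)).
      { replace (2 * Q / u - 2 * Q / (u + 1)) with (Q * (2 / (u * (u + 1)))) by (field; lra).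
        apply Rmult_le_compat_l; auto. apply Rle_div_r. nra.
        replace (/ u ^ 2 * (u * (u + 1))) with (1 + / u) by (field; lra).
        assert (/ u <= 1). { rewrite <- Rinv_1. apply Rinv_le_contravar; lra. } lra. }
      lra. }
  specialize (H (N' - N)%nat). replace (N + (N' - N))%nat with N' in H by lia.
  assert (0 <= 2 * Q / INR (S N')) by pos. lra.
Qed.

Lemma csum_bound2 (t : nat -> C) (Q : R) (N : nat) : 0 <= Q ->
  (forall n, Cmod (t n) <= Q * exp (- (2 * lnS n))) -> Cmod (csum t N) <= 2 * Q.
Proof.
  intros HQ Ht. pose proof (csum_tail t Q 0 N (Nat.le_0_l _) HQ (fun n _ => Ht n)) as H.
  simpl in H. replace (csum t N - 0)%C with (csum t N) in H by ring. lra.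
Qed.

Definition poly_bound (b : nat -> C) (M k : R) : Prop := forall n, Cmod (b n) <= M * exp (k * lnS n).

(** The growth [M (n + 1)^k] of the coefficients is recorded so that estimates are uniform over
    families. At abscissa [k + 2] the terms are dominated by [M (n + 1)^(-2)], and convergence is
    absolute and uniform. *)
Definition dseries (b : nat -> C) (M k : R) (f : C -> C) : Prop :=
  poly_bound b M k /\ forall z, k + 2 <= Re z -> Ccvg (csum (fun n => b n * npow n z)%C) (f z).

Lemma poly_bound_M b M k : poly_bound b M k -> 0 <= M.
Proof.
  intros H. specialize (H O). rewrite lnS_0, Rmult_0_r, exp_0 in H. pose proof (Cmod_ge_0 (b O)). lra.
Qed.

Lemma poly_bound_term b M k n z : poly_bound b M k ->
  Cmod (b n * npow n z) <= M * exp (- ((Re z - k - 2) * lnS n)) * exp (- (2 * lnS n)).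
Proof.
  intros H. rewrite Cmod_mult, Cmod_npow, Rmult_assoc, <- exp_plus.
  replace (- ((Re z - k - 2) * lnS n) + - (2 * lnS n)) with (k * lnS n + - (Re z * lnS n)) by ring.
  rewrite exp_plus, <- Rmult_assoc. apply Rmult_le_compat_r; auto. left. apply exp_pos.
Qed.

Lemma lnS_le n m : (n <= m)%nat -> lnS n <= lnS m.
Proof.
  intros H. destruct (Nat.eq_dec n m) as [->|E]. lra.
  left. apply ln_increasing. apply INR_S_pos. apply lt_INR. lia.
Qed.

Lemma poly_bound_tail b M k z N N' : poly_bound b M k -> k + 2 <= Re z -> (N <= N')%nat ->
  Cmod (csum (fun n => b n * npow n z)%C N' - csum (fun n => b n * npow n z)%C N) <=
  2 * (M * exp (- ((Re z - k - 2) * lnS N))) / INR (S N).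
Proof.
  intros H Hz HN. pose proof (poly_bound_M _ _ _ H). apply csum_tail; auto.
  { pos. }
  intros n Hn. eapply Rle_trans. apply poly_bound_term; eauto.
  apply Rmult_le_compat_r. left; apply exp_pos. apply Rmult_le_compat_l; auto.
  apply exp_le. pose proof (lnS_le N n Hn). nra.
Qed.

Lemma dseries_tail b M k f z N : dseries b M k f -> k + 2 <= Re z ->
  Cmod (f z - csum (fun n => b n * npow n z)%C N) <= 2 * (M * exp (- ((Re z - k - 2) * lnS N))) / INR (S N).
Proof.
  intros [H1 H2] Hz. eapply Ccvg_bound. apply H2; auto. exists N. intros n Hn.
  apply poly_bound_tail; auto.
Qed.

Lemma dseries_tail_weak b M k f z N : dseries b M k f -> k + 2 <= Re z ->
  Cmod (f z - csum (fun n => b n * npow n z)%C N) <= 2 * M / INR (S N).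
Proof.
  intros H Hz. pose proof (poly_bound_M _ _ _ (proj1 H)).
  eapply Rle_trans. eapply dseries_tail; eauto.
  apply Rmult_le_compat_r. left. apply Rinv_0_lt_compat, INR_S_pos.
  assert (exp (- ((Re z - k - 2) * lnS N)) <= 1).
  { rewrite <- exp_0. apply exp_le. pose proof (lnS_ge0 N). nra. }
  nra.
Qed.

Lemma dseries_bounded b M k f z : dseries b M k f -> k + 2 <= Re z -> Cmod (f z) <= 2 * M.
Proof.
  intros H Hz. pose proof (dseries_tail_weak b M k f z 0 H Hz) as Q. simpl in Q.
  replace (f z - 0)%C with (f z) in Q by ring. lra.
Qed.

Lemma small_inv A e : 0 <= A -> 0 < e -> exists N, forall n, (N <= n)%nat -> A / INR (S n) < e.
Proof.
  intros HA He. destruct (nfloor_ex (A / e)) as [N [_ HN]].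
  { pos. }
  exists N. intros n Hn. apply Rlt_div_l. apply INR_S_pos.
  apply Rlt_div_l in HN; auto. rewrite S_INR. apply le_INR in Hn. nra.
Qed.

Lemma dseries_exists b M k : poly_bound b M k -> exists f, dseries b M k f.
Proof.
  intros H. assert (HM := poly_bound_M _ _ _ H).
  assert (E : forall z, exists l, k + 2 <= Re z -> Ccvg (csum (fun n => b n * npow n z)%C) l).
  { intros z. destruct (Rle_dec (k + 2) (Re z)) as [L|L].
    2: { exists 0. intros; lra. }
    destruct (Ccvg_cauchy (csum (fun n => b n * npow n z)%C)) as [l Hl]; [|exists l; auto].
    intros e He. set (A := 2 * (M * exp 0)).
    destruct (small_inv A e) as [N HN]; auto. { pos. }
    exists N. intros n Hn. eapply Rle_trans. apply poly_bound_tail; eauto.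
    specialize (HN N (Nat.le_refl _)). eapply Rle_trans; [|left; exact HN].
    apply Rmult_le_compat_r. left. apply Rinv_0_lt_compat, INR_S_pos.
    apply Rmult_le_compat_l. lra. apply Rmult_le_compat_l; auto. apply exp_le.
    pose proof (lnS_ge0 N). nra. }
  destruct (functional_choice _ _ _ E) as [f Hf]. exists f. split; auto.
Qed.

Lemma csum_terms_bounded (t : nat -> C) l : Ccvg (csum t) l -> exists M, forall n, Cmod (t n) <= M.
Proof.
  intros H. destruct (H 1 Rlt_0_1) as [N HN].
  assert (F : forall K, exists M, forall n, (n < K)%nat -> Cmod (t n) <= M).
  { induction K as [|K [M IH]]. exists 0. lia. exists (Rmax M (Cmod (t K))).
    intros n Hn. destruct (Nat.eq_dec n K) as [->|E]. apply Rmax_r.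
    eapply Rle_trans; [apply IH; lia|apply Rmax_l]. }
  destruct (F N) as [M HM]. exists (Rmax M 2). intros n.
  destruct (Compare_dec.le_lt_dec N n) as [L|L].
  - eapply Rle_trans; [|apply Rmax_r]. pose proof (HN n L). pose proof (HN (S n) ltac:(lia)).
    simpl csum in H1.
    replace (t n) with ((csum t n + t n - l) - (csum t n - l))%C by ring.
    pose proof (Cmod_sub (csum t n + t n - l) (csum t n - l)). lra.
  - eapply Rle_trans; [apply HM; auto|apply Rmax_l].
Qed.

(** Convergence at the single real point [k] bounds the terms there, which is exactly polynomial
    growth of order [k] of the coefficients. *)
Lemma dirichlet_dseries f : is_dirichlet_series f -> exists b M k, 0 <= k /\ dseries b M k f.
Proof.
  intros [a [th H]]. set (b := fun n => a (S n)).
  assert (H' : forall z, th < Re z -> Ccvg (csum (fun n => b n * npow n z)%C) (f z)).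
  { intros z Hz. apply is_series_Ccvg. apply H. exact Hz. }
  set (k := Rmax 0 (th + 1)).
  assert (Hk : 0 <= k /\ th + 1 <= k) by (split; [apply Rmax_l|apply Rmax_r]).
  assert (Rk : Re k = k) by reflexivity.
  destruct (csum_terms_bounded _ _ (H' k ltac:(rewrite Rk; lra))) as [M HM].
  exists b, M, k. split; [apply Hk|]. split.
  - intros n. specialize (HM n). rewrite Cmod_mult, Cmod_npow, Rk in HM.
    replace (Cmod (b n)) with (Cmod (b n) * exp (- (k * lnS n)) * exp (k * lnS n)).
    apply Rmult_le_compat_r; auto. left; apply exp_pos.
    rewrite Rmult_assoc, <- exp_plus. replace (- (k * lnS n) + k * lnS n) with 0 by ring.
    rewrite exp_0. ring.
  - intros z Hz. apply H'. lra.
Qed.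

Lemma Ccvg_dirichlet (b : nat -> C) (f : C -> C) (x : R) :
  (forall z, x <= Re z -> Ccvg (csum (fun n => b n * npow n z)%C) (f z)) -> is_dirichlet_series f.
Proof.
  intros H. exists (fun n => b (pred n)), x. intros s Hs. apply is_series_Ccvg.
  apply (H s). left. exact Hs.
Qed.

Lemma dseries_dunif b M k f x : dseries b M k f -> k + 2 <= x -> dunif x f.
Proof.
  intros H Hx e He. pose proof (poly_bound_M _ _ _ (proj1 H)).
  destruct (small_inv (2 * M) e) as [N HN]; [lra|auto|].
  exists (dtrunc b N). intros s Hs. rewrite deval_dtrunc. left.
  eapply Rle_lt_trans. apply (dseries_tail_weak b M k f s N H). lra. auto.
Qed.

Definition dneg (l : dpoly) : dpoly := map (fun p => ((- fst p)%C, snd p)) l.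

Lemma deval_dneg l s : deval (dneg l) s = (- deval l s)%C.
Proof. induction l as [|p l IH]; simpl. ring. rewrite IH. ring. Qed.

Lemma dcoef_dneg l n : dcoef (dneg l) n = (- dcoef l n)%C.
Proof. induction l as [|p l IH]; simpl. ring. rewrite IH. destruct Nat.eq_dec; ring. Qed.

Lemma dcoef_app l l' n : dcoef (l ++ l') n = (dcoef l n + dcoef l' n)%C.
Proof. induction l as [|p l IH]; simpl. ring. rewrite IH. ring. Qed.

(** Approximants within [/ 2 ^ j] have coefficients that, by [dcoef_bound], form geometric Cauchy
    sequences. Their distance to the limit is of order [(n + 1)^x / 2 ^ j], summable two units
    further to the right. *)
Lemma dunif_dirichlet x f : dunif x f -> is_dirichlet_series f.
Proof.
  intros H.
  assert (P2 : forall j, 0 < 2 ^ j) by (intros; pos).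
  assert (H' : forall j, exists l, forall s, x <= Re s -> Cmod (f s - deval l s) <= / 2 ^ j).
  { intros j. apply H. apply Rinv_0_lt_compat, P2. }
  destruct (functional_choice _ _ _ H') as [l Hl].
  assert (Hc : forall n, exists b, forall j, Cmod (dcoef (l j) n - b) <= 2 * (2 * exp (x * lnS n)) / 2 ^ j).
  { intros n. apply (C_geom_cauchy (fun j => dcoef (l j) n)).
    { pos. }
    intros j. pose proof (exp_pos (x * lnS n)) as E.
    pose proof (dcoef_bound (l (S j) ++ dneg (l j)) x n (2 * / 2 ^ j)) as B.
    assert (B' : Cmod (dcoef (l (S j) ++ dneg (l j)) n) * exp (- (x * lnS n)) <= 2 * / 2 ^ j).
    { apply B. intros s Hs. rewrite deval_app, deval_dneg.
      pose proof (Hl j s ltac:(lra)) as L1. pose proof (Hl (S j) s ltac:(lra)) as L2.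
      replace (deval (l (S j)) s + - deval (l j) s)%C with ((f s - deval (l j) s) - (f s - deval (l (S j)) s))%C by ring.
      pose proof (Cmod_sub (f s - deval (l j) s) (f s - deval (l (S j)) s)).
      simpl pow in L2. rewrite Rinv_mult in L2. pose proof (Rinv_0_lt_compat _ (P2 j)). lra. }
    rewrite dcoef_app, dcoef_dneg in B'. rewrite exp_Ropp in B'.
    change (dcoef (l (S j)) n + - dcoef (l j) n)%C with (dcoef (l (S j)) n - dcoef (l j) n)%C in B'.
    apply (Rle_div_l _ _ _ E) in B'. lra. }
  destruct (functional_choice _ _ _ Hc) as [b Hb].
  apply (Ccvg_dirichlet b f (x + 2)). intros z Hz e He.
  (* One unit of [/ 2 ^ j] for the approximation of [f], and [2 * 4] for replacing the coefficients
     by their limits. *)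
  destruct (pow2_small 9 e He) as [j Hj].
  destruct (deval_csum (l j)) as [N0 HN0]. exists N0. intros N HN.
  eapply Rle_lt_trans; [|exact Hj].
  eapply Rle_trans. apply (Cmod_tri _ (deval (l j) z)).
  rewrite (Cmod_sym (deval (l j) z)). specialize (Hl j z ltac:(lra)).
  rewrite (HN0 N HN) at 1. rewrite <- csum_minus.
  assert (Q : Cmod (csum (fun k => b k * npow k z - dcoef (l j) k * npow k z)%C N) <= 2 * (4 / 2 ^ j)).
  { apply csum_bound2. apply Rdiv_le_0_compat; auto. lra.
    intros n. replace (b n * npow n z - dcoef (l j) n * npow n z)%C with (- ((dcoef (l j) n - b n) * npow n z))%C by ring.
    rewrite Cmod_opp, Cmod_mult, Cmod_npow.
    apply Rle_trans with (2 * (2 * exp (x * lnS n)) / 2 ^ j * exp (- (Re z * lnS n))).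
    apply Rmult_le_compat_r. left; apply exp_pos. auto.
    replace (2 * (2 * exp (x * lnS n)) / 2 ^ j * exp (- (Re z * lnS n))) with
      (4 / 2 ^ j * (exp (x * lnS n) * exp (- (Re z * lnS n)))) by pos.
    rewrite <- exp_plus. apply Rmult_le_compat_l. apply Rdiv_le_0_compat; auto; lra.
    apply exp_le. pose proof (lnS_ge0 n). nra. }
  lra.
Qed.

(** * Termwise differentiation, leading coefficients and limits of series *)

Lemma exp_lnS n : exp (lnS n) = INR (S n).
Proof. apply exp_ln, INR_S_pos. Qed.

Lemma lnS_le_exp n : lnS n <= exp (lnS n).
Proof. pose proof (exp_ineq1_le (lnS n)). lra. Qed.

Lemma poly_bound_deriv b M k : poly_bound b M k -> poly_bound (fun n => (- lnS n)%R * b n)%C M (k + 1).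
Proof.
  intros H n. rewrite Cmod_mult, Cmod_R, Rabs_Ropp, Rabs_pos_eq by apply lnS_ge0.
  replace ((k + 1) * lnS n) with (lnS n + k * lnS n) by ring. rewrite exp_plus.
  pose proof (lnS_le_exp n). pose proof (lnS_ge0 n).
  replace (M * (exp (lnS n) * exp (k * lnS n))) with (exp (lnS n) * (M * exp (k * lnS n))) by ring.
  apply Rmult_le_compat; auto. apply Cmod_ge_0.
Qed.

(** The second order remainder of a term costs three powers of [n + 1]: two for the squared
    logarithm and one for the exponential, as the increment has modulus less than 1. Summation costs
    two more, and [k + 6] leaves room for all of them. *)
Lemma dseries_deriv b M k f g z : dseries b M k f -> dseries (fun n => (- lnS n)%R * b n)%C M (k + 1) g ->
  k + 6 <= Re z -> cderiv f z (g z).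
Proof.
  intros Hf Hg Hz. assert (HM := poly_bound_M _ _ _ (proj1 Hf)).
  apply cderiv_eps. intros e He. exists (Rmin 1 (e / (2 * M + 1))).
  split. { pos. }
  intros y Hy.
  destruct (Rmin_Rgt_l _ _ _ Hy) as [Y1 Y2].
  set (w := (y - z)%C) in *. assert (Ey : y = (z + w)%C) by (unfold w; ring).
  pose proof (Re_abs w) as RW.
  assert (Ry : Re y = Re z + Re w) by (rewrite Ey; unfold Re; simpl; ring).
  apply Rlt_div_r in Y2; [|lra].
  apply Rle_trans with (2 * M * Cmod w ^ 2); [|nra].
  assert (CV : Ccvg (fun N => csum (fun n => b n * npow n y) N + ((-1)%R * csum (fun n => b n * npow n z) N +
      (- w) * csum (fun n => (- lnS n)%R * b n * npow n z) N))%C (f y + ((-1)%R * f z + (- w) * g z))%C).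
  { apply Ccvg_plus. apply Hf. lra. apply Ccvg_plus; apply Ccvg_scal. apply Hf. lra. apply Hg. lra. }
  pose proof (Ccvg_bound _ _ 0 (2 * M * Cmod w ^ 2) CV) as B.
  replace (f y - f z - g z * w)%C with (f y + ((-1)%R * f z + (- w) * g z) - 0)%C.
  2: { C_ring. }
  apply B. exists O. intros N _.
  rewrite <- !csum_scal, <- !csum_plus.
  match goal with |- Cmod (?a - RtoC 0) <= _ => replace (a - 0)%C with a by ring end.
  replace (2 * M * Cmod w ^ 2) with (2 * (M * Cmod w ^ 2)) by ring.
  apply csum_bound2. { pos. }
  intros n. set (u := (- (w * lnS n))%C).
  assert (Eu : (b n * npow n y + ((-1)%R * (b n * npow n z) + - w * ((- lnS n)%R * b n * npow n z)) =
    b n * npow n z * (Cexp u - 1 - u))%C).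
  { rewrite Ey, npow_plus. rewrite (npow_exp n w). fold u.
    C_ring. }
  rewrite Eu, !Cmod_mult, Cmod_npow. pose proof (Cexp_quad u) as Qd.
  assert (Cu : Cmod u = Cmod w * lnS n).
  { unfold u. rewrite Cmod_opp, Cmod_mult, Cmod_R_pos; auto. apply lnS_ge0. }
  rewrite Cu in Qd. pose proof (proj1 Hf n) as Bn. pose proof (lnS_ge0 n) as L0. pose proof (lnS_le_exp n) as L1.
  assert (L2 : exp (Cmod w * lnS n) <= exp (lnS n)) by (apply exp_le; nra).
  assert (Q2 : Cmod (Cexp u - 1 - u) <= Cmod w ^ 2 * (exp (lnS n) * exp (lnS n) * exp (lnS n))).
  { eapply Rle_trans. apply Qd. rewrite Rpow_mult_distr, Rmult_assoc.
    apply Rmult_le_compat_l. apply pow2_ge_0. pose proof (exp_pos (Cmod w * lnS n)).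
    apply Rmult_le_compat; auto. apply pow2_ge_0. lra. nra. }
  rewrite <- !exp_plus in Q2.
  apply Rle_trans with (M * exp (k * lnS n) * exp (- (Re z * lnS n)) * (Cmod w ^ 2 * exp (lnS n + lnS n + lnS n))).
  { apply Rmult_le_compat; auto. apply Rmult_le_pos. apply Cmod_ge_0. left; apply exp_pos. apply Cmod_ge_0.
    apply Rmult_le_compat_r; auto. left; apply exp_pos. }
  replace (M * exp (k * lnS n) * exp (- (Re z * lnS n)) * (Cmod w ^ 2 * exp (lnS n + lnS n + lnS n)))
   with (M * Cmod w ^ 2 * (exp (k * lnS n) * exp (- (Re z * lnS n)) * exp (lnS n + lnS n + lnS n))) by ring.
  rewrite <- !exp_plus. apply Rmult_le_compat_l. apply Rmult_le_pos; auto. apply pow2_ge_0.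
  apply exp_le. nra.
Qed.

Lemma dseries_holomorphic b M k f z : dseries b M k f -> k + 6 <= Re z -> exists l, cderiv f z l.
Proof.
  intros H Hz. destruct (dseries_exists _ _ _ (poly_bound_deriv b M k (proj1 H))) as [g Hg].
  exists (g z). eapply dseries_deriv; eauto.
Qed.

Lemma Rexp_small (c A e : R) : 0 < c -> 0 <= A -> 0 < e -> exists y0, forall y, y0 <= y -> A * exp (- (c * y)) < e.
Proof.
  intros Hc HA He. exists (A / (c * e)). intros y Hy.
  assert (Hce : 0 < c * e) by nra. apply Rle_div_l in Hy; auto.
  rewrite exp_Ropp. pose proof (exp_ineq1_le (c * y)). pose proof (exp_pos (c * y)).
  apply Rlt_div_l; auto. nra.
Qed.

Lemma dseries_first b M k f z : dseries b M k f -> k + 2 <= Re z ->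
  Cmod (f z - b O) <= M * exp (- ((Re z - k - 2) * ln 2)).
Proof.
  intros H Hz. pose proof (dseries_tail b M k f z 1 H Hz) as T. simpl csum in T. rewrite npow_0 in T.
  replace (0 + b O * 1)%C with (b O) in T by ring. unfold lnS in T. simpl INR in T.
  replace (1 + 1) with 2 in T by ring. lra.
Qed.

Lemma dseries_lim_first b M k f e : dseries b M k f -> 0 < e ->
  exists X, k + 2 <= X /\ forall z, X <= Re z -> Cmod (f z - b O) <= e.
Proof.
  intros H He. pose proof (poly_bound_M _ _ _ (proj1 H)).
  destruct (Rexp_small (ln 2) M e) as [y0 Hy]; auto.
  { rewrite <- ln_1. apply ln_increasing; lra. }
  exists (k + 2 + Rmax 0 y0). pose proof (Rmax_l 0 y0). pose proof (Rmax_r 0 y0). split. lra.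
  intros z Hz. eapply Rle_trans. eapply dseries_first; eauto. lra.
  rewrite (Rmult_comm (Re z - k - 2)). left. apply Hy. lra.
Qed.

(** Convergence of the coefficients is derived, not assumed. By induction on [n], the [n]-th
    coefficient is nearly [(n + 1)^y] times what remains of [f j y] after subtracting the earlier
    terms, for a large real [y]. *)
Lemma dseries_limit (b : nat -> nat -> C) (M k : R) (f : nat -> C -> C) (G : C -> C) :
  (forall j, dseries (b j) M k (f j)) -> (forall z, k + 2 <= Re z -> Ccvg (fun j => f j z) (G z)) ->
  exists b', (forall n, Ccvg (fun j => b j n) (b' n)) /\ dseries b' M k G.
Proof.
  intros Hf HG. assert (HM := poly_bound_M _ _ _ (proj1 (Hf O))).
  assert (HC : forall n, exists l, Ccvg (fun j => b j n) l).
  { intros n. induction n as [n IH] using (well_founded_induction Wf_nat.lt_wf).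
    apply Ccvg_cauchy. intros e He.
    (* The gap between consecutive logarithms: after multiplication by [(n + 1)^y] the tail is at
       most [A * exp (- (c * y))]. *)
    set (c := lnS (S n) - lnS n).
    assert (Hc : 0 < c).
    { unfold c. pose proof (lnS_le n (S n) ltac:(lia)).
      destruct (Rle_lt_or_eq_dec _ _ H) as [L|L]. lra. apply lnS_inj in L. lia. }
    set (A := 2 * (M * exp ((k + 2) * lnS (S n)))).
    destruct (Rexp_small c A (e / 4)) as [y0 Hy0]; auto.
    { pos. } lra.
    (* One abscissa serves all [j], since [M] and [k] are common to the family. *)
    set (y := Rmax (k + 2) y0).
    assert (Hy1 : k + 2 <= y) by apply Rmax_l. specialize (Hy0 y (Rmax_r _ _)).
    assert (Ry : Re y = y) by reflexivity.
    assert (HE : exists L, Ccvg (fun j => Cexp (y * lnS n) * (f j y + (-1)%R * csum (fun m => b j m * npow m y) n))%C L).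
    { destruct (functional_choice _ _ (fun m L => (m < n)%nat -> Ccvg (fun j => b j m) L)) as [l Hl].
      { intros m. destruct (Compare_dec.lt_dec m n) as [Hm|Hm]; [|exists 0; tauto].
        destruct (IH m Hm) as [L HL]. exists L. auto. }
      eexists. apply Ccvg_scal. apply Ccvg_plus. apply HG. rewrite Ry; auto. apply Ccvg_scal.
      apply (Ccvg_csum (fun j m => b j m * npow m y)%C (fun m => npow m y * l m)%C).
      intros m Hm. eapply Ccvg_ext; [|apply Ccvg_scal, Hl, Hm]. intros; apply Cmult_comm. }
    destruct HE as [L HL].
    assert (HA : forall j, Cmod (Cexp (y * lnS n) * (f j y + (-1)%R * csum (fun m => b j m * npow m y) n) - b j n)%C <= e / 4).
    { intros j. pose proof (dseries_tail (b j) M k (f j) y (S n) (Hf j) ltac:(rewrite Ry; auto)) as T.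
      rewrite Ry in T.
      replace (Cexp (y * lnS n) * (f j y + (-1)%R * csum (fun m => b j m * npow m y) n) - b j n)%C
        with (Cexp (y * lnS n) * (f j y - (csum (fun m => b j m * npow m y) n + b j n * npow n y)))%C.
      2: { assert (E : (Cexp (y * lnS n) * npow n y = 1)%C) by apply Cexp_opp.
           transitivity (Cexp (y * lnS n) * (f j y + (-1)%R * csum (fun m => b j m * npow m y) n)
             - b j n * (Cexp (y * lnS n) * npow n y))%C.
           - generalize (csum (fun m => b j m * npow m y)%C n) (Cexp (y * lnS n)) (f j y) (b j n) (npow n y).
             intros. C_ring.
           - rewrite E, Cmult_1_r. reflexivity. }
      rewrite Cmod_mult, Cmod_Cexp. replace (Re (y * lnS n)%C) with (y * lnS n) by Re_ring.
      left. eapply Rle_lt_trans; [|exact Hy0].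
      apply Rle_trans with (exp (y * lnS n) * (2 * (M * exp (- ((y - k - 2) * lnS (S n)))))).
      { apply Rmult_le_compat_l. left; apply exp_pos. eapply Rle_trans. exact T.
        apply Rle_div_l. apply INR_S_pos. pose proof (INR_S_ge1 (S n)).
        pose proof (exp_pos (- ((y - k - 2) * lnS (S n)))).
        assert (0 <= 2 * (M * exp (- ((y - k - 2) * lnS (S n))))) by nra. nra. }
      right. unfold A.
      replace (exp (y * lnS n) * (2 * (M * exp (- ((y - k - 2) * lnS (S n)))))) with
        (2 * M * (exp (y * lnS n) * exp (- ((y - k - 2) * lnS (S n))))) by ring.
      replace (2 * (M * exp ((k + 2) * lnS (S n))) * exp (- (c * y))) with
        (2 * M * (exp ((k + 2) * lnS (S n)) * exp (- (c * y)))) by ring.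
      rewrite <- !exp_plus. f_equal. f_equal. unfold c. ring. }
    destruct (HL (e / 4)) as [N HN]; [lra|]. exists N. intros j Hj.
    pose proof (HN j Hj) as N1. pose proof (HN N (Nat.le_refl _)) as N2.
    pose proof (HA j) as A1. pose proof (HA N) as A2.
    match type of N1 with Cmod (?a - _) < _ => set (X := a) in * end.
    match type of N2 with Cmod (?a - _) < _ => set (Y := a) in * end.
    pose proof (Cmod_tri (b j n) X (b N n)) as T1. pose proof (Cmod_tri X L (b N n)) as T2.
    pose proof (Cmod_tri L Y (b N n)) as T3. rewrite (Cmod_sym (b j n) X) in T1. rewrite (Cmod_sym L Y) in T3.
    lra. }
  destruct (functional_choice _ _ _ HC) as [b' Hb']. exists b'.
  split; auto. split.
  - intros n. replace (b' n) with (b' n - 0)%C by ring. eapply Ccvg_bound. apply Hb'.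
    exists O. intros j _. replace (b j n - 0)%C with (b j n) by ring. apply (proj1 (Hf j)).
  - intros z Hz e He.
    destruct (small_inv (2 * M) e) as [N HN]; [lra|auto|]. exists N. intros n Hn.
    eapply Rle_lt_trans; [|apply (HN n Hn)].
    assert (CV : Ccvg (fun j => csum (fun m => b j m * npow m z) n + (-1)%R * f j z)%C (csum (fun m => b' m * npow m z) n + (-1)%R * G z)%C).
    { apply Ccvg_plus. 2: { apply Ccvg_scal. auto. }
      apply (Ccvg_csum (fun j m => b j m * npow m z)%C). intros m _.
      rewrite (Cmult_comm (b' m)). eapply Ccvg_ext; [|apply Ccvg_scal, Hb']. intros; apply Cmult_comm. }
    replace (csum (fun m => b' m * npow m z) n - G z)%C with (csum (fun m => b' m * npow m z) n + (-1)%R * G z - 0)%C.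
    2: { C_ring. }
    eapply Ccvg_bound. apply CV. exists O. intros j _.
    replace (csum (fun m => b j m * npow m z) n + (-1)%R * f j z - 0)%C with (- (f j z - csum (fun m => b j m * npow m z) n))%C.
    2: { C_ring. }
    rewrite Cmod_opp. apply (dseries_tail_weak (b j) M k (f j)); auto.
Qed.

(** * Coefficients of Dirichlet series with nonnegative real part *)

Lemma halfplane_convex x : Cconvex (fun s => x <= Re s).
Proof.
  intros a b t Ha Hb Ht. unfold seg.
  replace (Re (a + t * (b - a))%C) with ((1 - t) * Re a + t * Re b) by Re_ring. nra.
Qed.

Lemma halfplane_closed x : Cclosed (fun s => x <= Re s).
Proof.
  intros s Hs. apply Rnot_le_lt in Hs. exists (x - Re s). split. lra.
  intros z Hz. pose proof (Re_near z s) as Q. lra.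
Qed.

(** [pick_upper] with the comparison point on the same horizontal line, at the abscissa where the
    series is bounded; imaginary parts cancel and the quotient is at most [4 * S / x]. *)
Lemma bounded_strip f b M k x : pick_ineq f -> nonneg_rhp f -> 0 <= k -> dseries b M k f -> 0 < x ->
  exists B, forall s, x <= Re s -> Cmod (f s) <= B.
Proof.
  intros Hp Hn Hk Hd Hx. pose proof (poly_bound_M _ _ _ (proj1 Hd)) as HM.
  set (S := k + 2). exists ((4 * S / x + 2) * (2 * M)). intros s Hs.
  assert (HS : 0 < 4 * S / x) by (apply Rdiv_lt_0_compat; unfold S; lra).
  destruct (Rle_dec S (Re s)) as [L|L].
  - pose proof (dseries_bounded _ _ _ _ s Hd L). nra.
  - apply Rnot_le_lt in L. set (w := (S, Im s) : C).
    assert (Rw : Re w = S) by reflexivity.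
    pose proof (pick_upper f s w Hp Hn ltac:(lra) ltac:(rewrite Rw; unfold S; lra)) as P.
    assert (B := dseries_bounded _ _ _ _ w Hd ltac:(rewrite Rw; unfold S; lra)).
    assert (E : Cmod (s + Cconj w) ^ 2 = (Re s + S) ^ 2).
    { rewrite Cmod2_alt. unfold w, Re, Im; simpl. ring. }
    rewrite E, Rw in P. eapply Rle_trans. apply P.
    assert (T : (Re s + S) ^ 2 / (Re s * S) <= 4 * S / x).
    { apply Rle_div_l. nra.
      apply Rle_trans with (4 * S * S). nra.
      assert (1 <= Re s / x) by (apply Rle_div_r; lra). nra. }
    pose proof (Cmod_ge_0 (f w)).
    assert (0 <= (Re s + S) ^ 2 / (Re s * S)) by pos.
    apply Rmult_le_compat; lra.
Qed.

Lemma vert_eq (x y : R) : (RtoC x + RtoC y * Ci)%C = (x, y).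
Proof. C_ring. Qed.

(* The means of [f (1 + Re (om (n + 1)^(i y)))] along the line [Re s = 1] have nonnegative real part;
   moving the line to [Re s = k + 2], where the series converges, expresses them by coefficients. *)
Lemma coef_pos_aux (f : C -> C) b M k n (om : C) : hol_rhp f -> nonneg_rhp f -> 0 <= k -> dseries b M k f ->
  (1 <= n)%nat -> Cmod om <= 1 -> 0 <= Re (b O + om * b n * (/ (2 * INR (S n)))%R)%C.
Proof.
  intros Hf Hn Hk Hd Hn1 Hom.
  pose proof (schwarz_pick f Hf Hn) as Hp. pose proof (poly_bound_M _ _ _ (proj1 Hd)) as HM.
  set (S1 := k + 2). assert (HS1 : 2 <= S1) by (unfold S1; lra).
  destruct (bounded_strip f b M k 1 Hp Hn Hk Hd Rlt_0_1) as [Bf HBf].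
  set (L := lnS n). assert (HL : 0 < L) by (apply lnS_pos; auto).
  (* The entire function that equals [1 + Re (om (n + 1)^(i y))] at [s = 1 + i y]; an entire weight
     is what allows the line of integration to be moved. *)
  set (W := fun s : C => (1 + (/2)%R * om * Cexp ((s - 1) * L) + (/2)%R * Cconj om * Cexp ((1 - s) * L))%C).
  set (g := fun s => (f s * W s)%C).
  assert (HWc : forall s, exists l, cderiv W s l).
  { intros s. eexists. apply cderiv_plus. apply cderiv_plus. apply cderiv_const.
    all: apply cderiv_scal.
    apply (cderiv_comp Cexp (fun s => (s - 1) * L)%C); [cder|apply cderiv_Cexp].
    apply (cderiv_comp Cexp (fun s => (1 - s) * L)%C); [cder|apply cderiv_Cexp]. }
  set (BW := 2 + exp ((S1 - 1) * L)).
  assert (HBW0 : 0 < BW). { pose proof (exp_pos ((S1 - 1) * L)). unfold BW. lra. }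
  assert (HBW : forall s, 1 <= Re s <= S1 -> Cmod (W s) <= BW).
  { intros s Hs. eapply Rle_trans. apply Cmod_triangle.
    pose proof (Cmod_triangle 1 ((/2)%R * om * Cexp ((s - 1) * L))) as T.
    rewrite !Cmod_mult, Cmod_1, !Cmod_Cexp, Cmod_R_pos in T by lra.
    rewrite !Cmod_mult, Cmod_Cexp, Cmod_conj, Cmod_R_pos by lra.
    replace (Re ((s - 1) * L)%C) with ((Re s - 1) * L) in T by Re_ring.
    replace (Re ((1 - s) * L)%C) with (- ((Re s - 1) * L)) by Re_ring.
    assert (E1 : exp ((Re s - 1) * L) <= exp ((S1 - 1) * L)) by (apply exp_le; nra).
    assert (E2 : exp (- ((Re s - 1) * L)) <= 1).
    { apply Rle_trans with (exp 0); [apply exp_le; nra|rewrite exp_0; lra]. }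
    pose proof (exp_pos ((Re s - 1) * L)). pose proof (exp_pos (- ((Re s - 1) * L))).
    unfold BW. nra. }
  assert (Hg : forall s, / 2 <= Re s -> exists l, cderiv g s l).
  { intros s Hs. destruct (Hf s ltac:(lra)) as [l Hl]. destruct (HWc s) as [m Hm].
    eexists. apply cderiv_mult; eauto. }
  set (Ga := segint g 1).
  assert (HGa : forall s, / 2 < Re s -> cderiv Ga s (g s)).
  { intros s Hs. apply (segint_cderiv (fun s => /2 <= Re s) g (halfplane_convex _) (halfplane_closed _) Hg 1 s (Re s - /2)).
    simpl. lra. lra. intros z Hz. pose proof (Re_near z s) as Q. lra. }
  (* Along [Re s = 1] the derivative of [- Ci * Ga] is [g], a value of [f] times a nonnegative
     weight. *)
  assert (Line1 : forall T, 0 <= T -> Re (- Ci * Ga (RtoC 1))%C <= Re (- Ci * Ga (1, T))%C).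
  { intros T HT.
    destruct (rderiv_MVT (fun u => Ga (RtoC 1 + u * Ci)%C) (fun u => g (RtoC 1 + u * Ci) * Ci)%C 0 T (- Ci)%C HT) as [y [Hy E]].
    { intros t _. apply rderiv_line. apply HGa. simpl. lra. }
    rewrite !vert_eq in E.
    replace (- Ci * (g (1, y) * Ci))%C with (g (1, y)) in E.
    2: { generalize (g (1, y)). intros c. C_ring. }
    assert (Pg : 0 <= Re (g (1, y))).
    { unfold g, W. pose proof (Hn (1, y) ltac:(simpl; lra)) as Pf.
      assert (Ew : (1 + (/ 2)%R * om * Cexp (((1, y) - 1) * L) + (/ 2)%R * Cconj om * Cexp ((1 - (1, y)) * L))%C
         = RtoC (1 + Re (om * cis (L * y))%C)).
      { replace (((1, y) - 1) * L)%C with ((0, L * y) : C) by (apply C_eq; simpl; ring).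
        replace ((1 - (1, y)) * L)%C with ((0, - (L * y)) : C) by (apply C_eq; simpl; ring).
        unfold cis, Cexp, Re, Im; simpl. rewrite cos_neg, sin_neg, exp_0.
        C_field. }
      rewrite Ew. replace (Re (f (1, y) * RtoC (1 + Re (om * cis (L * y))))%C)
        with (Re (f (1, y)) * (1 + Re (om * cis (L * y))%C)) by Re_ring.
      apply Rmult_le_pos; auto. pose proof (Re_abs (om * cis (L * y))%C) as Q.
      rewrite Cmod_mult, Cmod_cis in Q. lra. }
    assert (Re (- Ci * (Ga (1, T) - Ga (1, 0)))%C >= 0) by nra.
    replace (RtoC 1) with ((1, 0) : C) by reflexivity.
    revert H. generalize (Ga (1, T)) (Ga (1, 0)). intros u v. unfold Re; simpl. lra. }
  (* The horizontal sides of the rectangle have fixed length, so changing the line costs a bounded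
     amount, invisible in the mean. *)
  assert (Shift : forall T, Cmod (Ga (S1, T) - Ga (1, T)) <= Bf * BW * (S1 - 1)).
  { intros T. replace (S1 - 1) with (Cmod ((S1, T) - (1, T))%C).
    2: { replace ((S1, T) - (1, T))%C with (RtoC (S1 - 1)) by (apply C_eq; simpl; ring).
         apply Cmod_R_pos. lra. }
    apply cderiv_MVI with (f' := g); intros t Ht.
    - apply HGa. simpl. nra.
    - unfold g. rewrite Cmod_mult. assert (1 <= Re ((1, T) + t * ((S1, T) - (1, T)))%C <= S1) by (simpl; nra).
      apply Rmult_le_compat; try apply Cmod_ge_0. apply HBf. lra. apply HBW. lra. }
  apply le_epsilon. intros e He.
  destruct (small_inv (2 * M * BW) e) as [N0 HN0]; [nra|auto|].
  set (N := max N0 (S n)).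
  specialize (HN0 N ltac:(unfold N; lia)).
  set (l0 := dline (dtrunc b N) S1).
  set (l := (l0 ++ tscale ((/2)%R * om * exp ((S1 - 1) * L)) L l0 ++ tscale ((/2)%R * Cconj om * exp ((1 - S1) * L)) (- L) l0)%list).
  destruct (tmean_approx l (fun y => - Ci * Ga (RtoC S1 + y * Ci))%C (fun y => - Ci * (g (RtoC S1 + y * Ci) * Ci))%C e) as [M' HM'].
  { intros y _. apply rderiv_scal. apply rderiv_line. apply HGa. simpl. lra. }
  { intros y _. rewrite vert_eq.
    replace (- Ci * (g (S1, y) * Ci))%C with (g (S1, y)).
    2: { generalize (g (S1, y)). intros c. C_ring. }
    unfold l. rewrite !teval_app, !teval_tscale. unfold l0. rewrite teval_dline, deval_dtrunc.
    assert (EW : W (S1, y) = (1 + (/2)%R * om * exp ((S1 - 1) * L) * cis (L * y)%R + (/2)%R * Cconj om * exp ((1 - S1) * L) * cis (- L * y)%R)%C).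
    { unfold W, cis, Cexp, Re, Im; simpl. rewrite exp_0.
      replace ((S1 + - (1)) * L - (y + - 0) * 0) with ((S1 - 1) * L) by ring.
      replace ((S1 + - (1)) * 0 + (y + - 0) * L) with (L * y) by ring.
      replace ((1 + - S1) * L - (0 + - y) * 0) with ((1 - S1) * L) by ring.
      replace ((1 + - S1) * 0 + (0 + - y) * L) with (- L * y) by ring.
      C_ring. }
    set (P := csum (fun n0 => b n0 * npow n0 (S1, y))%C N).
    match goal with |- Cmod ?x <= _ => replace x with ((f (S1, y) - P) * W (S1, y))%C end.
    2: { unfold g. rewrite EW. ring. }
    rewrite Cmod_mult. left. eapply Rle_lt_trans; [|exact HN0].
    replace (2 * M * BW / INR (S N)) with (2 * M / INR (S N) * BW) by pos.
    apply Rmult_le_compat; try apply Cmod_ge_0.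
    apply (dseries_tail_weak b M k f (S1, y) N Hd). simpl. unfold S1. lra.
    apply HBW. simpl. lra. }
  (* At frequency 0 the unshifted copy yields [b O], and the copy shifted by [L] yields [b n] with
     the factor [exp ((S1 - 1) * L)] times [npow n S1], that is [/ INR (S n)]. The third copy yields
     nothing: it would require a frequency [L > 0] in a polynomial whose frequencies are all
     nonpositive. *)
  assert (Emu : tcoef l 0 = (b O + om * b n * (/ (2 * INR (S n)))%R)%C).
  { unfold l. rewrite !tcoef_app, !tcoef_tscale.
    replace (0 - - L) with L by ring. unfold l0. rewrite (tcoef_dline_pos _ _ L HL).
    replace (0 - L) with (- lnS n) by (unfold L; ring). rewrite tcoef_dline.
    replace (tcoef (dline (dtrunc b N) S1) 0) with (tcoef (dline (dtrunc b N) S1) (- lnS 0))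
      by (rewrite lnS_0, Ropp_0; auto).
    rewrite tcoef_dline, npow_0, !dcoef_dtrunc by (unfold N; lia).
    assert (En : (RtoC (exp ((S1 - 1) * L)) * npow n S1)%C = RtoC (/ INR (S n))).
    { rewrite <- exp_lnS, <- exp_Ropp. fold L.
      rewrite npow_exp. unfold Cexp. fold L.
      replace (Re (- (S1 * L))%C) with (- (S1 * L)) by Re_ring.
      replace (Im (- (S1 * L))%C) with 0 by (unfold Im; simpl; ring).
      rewrite cos_0, sin_0. replace (- L) with ((S1 - 1) * L + - (S1 * L)) by ring.
      rewrite exp_plus. C_ring. }
    transitivity (b O + (/2)%R * om * b n * (exp ((S1 - 1) * L) * npow n S1))%C. ring.
    rewrite En. rewrite Rinv_mult, RtoC_mult. ring. }
  rewrite Emu in HM'. set (mu := (b O + om * b n * (/ (2 * INR (S n)))%R)%C) in *.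
  assert (- Re mu <= e); [|lra].
  apply linear_bound with (M' + Bf * BW * (S1 - 1) - Re (- Ci * Ga (RtoC 1))%C).
  intros T HT. specialize (HM' T HT). specialize (Line1 T HT). specialize (Shift T).
  rewrite vert_eq in HM'.
  pose proof (Re_abs (- Ci * Ga (S1, T) - T * mu)%C) as Q1.
  pose proof (Re_abs (- Ci * (Ga (S1, T) - Ga (1, T)))%C) as Q2.
  rewrite Cmod_mult, Cmod_opp, Cmod_Ci in Q2.
  replace (Re (- Ci * Ga (S1, T) - T * mu)%C) with (Re (- Ci * Ga (S1, T))%C - T * Re mu) in Q1 by Re_ring.
  replace (Re (- Ci * (Ga (S1, T) - Ga (1, T)))%C) with (Re (- Ci * Ga (S1, T))%C - Re (- Ci * Ga (1, T))%C) in Q2 by Re_ring.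
  lra.
Qed.

Lemma coef_pos (f : C -> C) b M k n : hol_rhp f -> nonneg_rhp f -> 0 <= k -> dseries b M k f ->
  (1 <= n)%nat -> Cmod (b n) <= 2 * INR (S n) * Re (b O).
Proof.
  intros Hf Hn Hk Hd H1. pose proof (INR_S_pos n) as IP.
  destruct (excluded_middle_informative (b n = 0)) as [E|E].
  - pose proof (coef_pos_aux f b M k n 0 Hf Hn Hk Hd H1) as A. rewrite Cmod_0 in A.
    rewrite E in *. rewrite Cmod_0. replace (b O + 0 * 0 * (/ (2 * INR (S n)))%R)%C with (b O) in A by ring.
    nra.
  - assert (E' : 0 < Cmod (b n)) by (apply Cmod_gt_0; auto).
    (* The unimodular number that turns [b n] into [- |b n|]. *)
    set (om := (- Cconj (b n) * (/ Cmod (b n))%R)%C).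
    pose proof (coef_pos_aux f b M k n om Hf Hn Hk Hd H1) as A.
    assert (Hom : Cmod om <= 1).
    { unfold om. rewrite Cmod_mult, Cmod_opp, Cmod_conj, Cmod_R_pos. right. field. lra.
      left. apply Rinv_0_lt_compat; auto. }
    assert (Eo : (om * b n)%C = RtoC (- Cmod (b n))).
    { unfold om. transitivity (- (b n * Cconj (b n)) * (/ Cmod (b n))%R)%C. ring.
      rewrite <- Cmod2_conj. C_field; lra. }
    rewrite Eo in A. set (I := INR (S n)) in *.
    replace (Re (b O + (- Cmod (b n))%R * (/ (2 * I))%R)%C) with (Re (b O) - Cmod (b n) / (2 * I)) in A
      by (unfold Re; simpl; field; lra).
    assert (Q : Cmod (b n) / (2 * I) <= Re (b O)) by lra.
    apply Rle_div_l in Q; lra.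
Qed.

Lemma cderiv_shift f (z a l : C) : cderiv f (z + a)%C l -> cderiv (fun y => f (y + a)%C) z l.
Proof.
  intros H. eapply cderiv_eq. apply (cderiv_comp f (fun y => y + a)%C). cder. apply H. ring.
Qed.

Lemma dseries_scal b M k f (c : R) : 0 <= c -> dseries b M k f ->
  dseries (fun n => c * b n)%C (c * M) k (fun s => c * f s)%C.
Proof.
  intros Hc [H1 H2]. split.
  - intros n. rewrite Cmod_mult, Cmod_R_pos, Rmult_assoc by auto. apply Rmult_le_compat_l; auto.
  - intros z Hz. specialize (H2 z Hz). apply (Ccvg_scal c) in H2.
    eapply Ccvg_ext; [|exact H2]. intros n. cbv beta. rewrite <- csum_scal. apply csum_ext. intros; ring.
Qed.

Lemma dseries_mono b M M' k f : M <= M' -> dseries b M k f -> dseries b M' k f.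
Proof.
  intros HM [H1 H2]. split; auto. intros n. eapply Rle_trans. apply H1.
  apply Rmult_le_compat_r; auto. left; apply exp_pos.
Qed.

(* The abscissa [8] and the bound do not depend on the abscissa [k + 2] where the expansion is known.
   At [12] the series differs from [b 0] by at most [2^(-4) * 2 |b 0|], hence [|f 12|] controls [|b 0|]. *)
Lemma nonneg_dseries_normal (f : C -> C) b M k : hol_rhp f -> nonneg_rhp f -> 0 <= k -> dseries b M k f ->
  dseries b (6 * Cmod (f 12)) 6 f /\ forall n, (1 <= n)%nat -> Cmod (b n) <= 2 * INR (S n) * Cmod (b O).
Proof.
  intros Hf Hn Hk Hd. pose proof (schwarz_pick f Hf Hn) as Hp.
  assert (Hc : forall n, (1 <= n)%nat -> Cmod (b n) <= 2 * INR (S n) * Cmod (b O)).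
  { intros n H. eapply Rle_trans. eapply coef_pos; eauto. pose proof (INR_S_pos n).
    pose proof (Re_abs (b O)). nra. }
  split; auto.
  pose proof (Cmod_ge_0 (b O)) as B0.
  assert (Hpb : poly_bound b (2 * Cmod (b O)) 1).
  { intros n. rewrite Rmult_1_l, exp_lnS. destruct n as [|n].
    - simpl. lra.
    - specialize (Hc (S n) ltac:(lia)). lra. }
  destruct (dseries_exists _ _ _ Hpb) as [f1 Hf1].
  destruct (bounded_strip f b M k 1 Hp Hn Hk Hd Rlt_0_1) as [Bf HBf].
  assert (Heq : forall s, 7 < Re s -> f s = f1 s).
  { intros s Hs.
    (* The series [f1] has exponent 1, so [dseries_holomorphic] applies to it from abscissa [1 + 6]
       on; the shift moves that half-plane to the right half-plane. *)
    set (D := fun z => (f (z + 7) - f1 (z + 7))%C).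
    assert (Z : D (s - 7)%C = 0).
    { apply (identity_rhp D (Bf + 2 * (2 * Cmod (b O))) (k + 2)).
      - intros z Hz. assert (Rz : Re (z + 7)%C = Re z + 7) by Re_ring.
        destruct (Hf (z + 7)%C ltac:(lra)) as [l Hl].
        destruct (dseries_holomorphic _ _ _ _ (z + 7)%C Hf1 ltac:(lra)) as [m Hm].
        exists (l - m)%C. apply (cderiv_minus (fun z => f (z + 7)%C) (fun z => f1 (z + 7)%C)); apply cderiv_shift; auto.
      - lra.
      - intros z Hz. assert (Rz : Re (z + 7)%C = Re z + 7) by Re_ring.
        eapply Rle_trans. apply Cmod_sub. apply Rplus_le_compat. apply HBf. lra.
        eapply dseries_bounded. apply Hf1. lra.
      - intros z Hz. assert (Rz : Re (z + 7)%C = Re z + 7) by Re_ring.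
        assert (C1 := proj2 Hd (z + 7)%C ltac:(lra)). assert (C2 := proj2 Hf1 (z + 7)%C ltac:(lra)).
        unfold D. rewrite (Ccvg_unique _ _ _ C1 C2). ring.
      - unfold Re in *; simpl; lra. }
    unfold D in Z. replace (s - 7 + 7)%C with s in Z by ring. apply Cminus_0_eq. auto. }
  assert (Hd6 : dseries b (2 * Cmod (b O)) 6 f).
  { split.
    - intros n. eapply Rle_trans. apply Hpb. apply Rmult_le_compat_l. lra.
      apply exp_le. pose proof (lnS_ge0 n). lra.
    - intros z Hz. rewrite Heq by lra. apply Hf1. lra. }
  eapply dseries_mono; [|exact Hd6].
  assert (F : Cmod (f 12 - b O) <= 2 * Cmod (b O) * exp (- ((Re 12 - 6 - 2) * ln 2))).
  { apply (dseries_first _ _ _ _ _ Hd6). simpl. lra. }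
  replace (- ((Re 12 - 6 - 2) * ln 2)) with (- ln 2 + - ln 2 + - ln 2 + - ln 2) in F by (simpl; ring).
  rewrite !exp_plus, exp_Ropp, exp_ln in F by lra.
  pose proof (Cmod_sub_ge (b O) (f 12)) as Q. rewrite Cmod_sym in Q. lra.
Qed.

(** * From the semigroup to its Koenigs function *)

Lemma holomorphic_cderiv (h : C -> C) : holomorphic_on right_half_plane h ->
  forall s, 0 < Re s -> cderiv h s (C_derive h s).
Proof.
  intros H s Hs. apply cderiv_is_derive. apply C_derive_correct. exact s. apply H. exact Hs.
Qed.

Lemma hol_rhp_holomorphic (f : C -> C) : hol_rhp f <-> holomorphic_on right_half_plane f.
Proof.
  split; intros H s Hs.
  - destruct (H s Hs) as [l Hl]. exists l. apply cderiv_is_derive. auto.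
  - destruct (H s Hs) as [l Hl]. exists l. apply cderiv_is_derive. auto.
Qed.

(** The hypothesis gives [Re (Phi (1/4)) < 1/2]. A factor [c = 0] contradicts the range condition of
    the class, and [c >= 2] contradicts Julia's lemma, which would give [Re (Phi (1/4)) >= 1/2].
    With [c = 1] Julia's lemma is the nonnegativity of the real part. *)
Lemma gordon_near_id (Phi : C -> C) : gordon_hedenmalm Phi ->
  Cmod (Phi (RtoC (/ 4)) - RtoC (/ 4)) < / 4 ->
  let f := fun s => (Phi s - s)%C in
  hol_rhp f /\ nonneg_rhp f /\ exists b M k, 0 <= k /\ dseries b M k f.
Proof.
  intros [Hh [Hpos [c [phi [Hd [He Hc]]]]]] Hq f.
  apply hol_rhp_holomorphic in Hh.
  set (q := RtoC (/ 4)) in *. assert (Rq : Re q = / 4) by reflexivity.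
  assert (Hq0 : 0 < Re q) by pos.
  pose proof (Re_abs (Phi q - q)%C) as Q.
  replace (Re (Phi q - q)%C) with (Re (Phi q) - / 4) in Q by pos.
  destruct (dirichlet_dseries phi Hd) as [b [M [k [Hk Hds]]]].
  assert (Hc0 : c <> 0%nat).
  { intros E. specialize (Hc E q Hq0). unfold half_plane in Hc. lra. }
  assert (Hp : pick_ineq Phi). { apply schwarz_pick; auto. intros s Hs. left. apply Hpos. exact Hs. }
  assert (J : forall s, 0 < Re s -> INR c * Re s <= Re (Phi s)).
  { apply (julia_lemma Phi (INR c) (2 * M) (k + 2) Hp). exact Hpos.
    intros x Hx. rewrite He. 2: { unfold right_half_plane, half_plane. simpl. lra. }
    replace (INR c * x + phi x - INR c * x)%C with (phi x) by ring.
    eapply dseries_bounded. apply Hds. simpl. lra. }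
  assert (Hc1 : c = 1%nat).
  { destruct c as [|[|c]]; auto; [tauto|]. exfalso. specialize (J q Hq0). rewrite Rq, !S_INR in J.
    pose proof (pos_INR c). lra. }
  subst c. simpl INR in *.
  split; [|split].
  - intros s Hs. destruct (Hh s Hs) as [l Hl]. eexists. apply cderiv_minus. apply Hl. apply cderiv_id.
  - intros s Hs. specialize (J s Hs). unfold f.
    replace (Re (Phi s - s)%C) with (Re (Phi s) - Re s) by Re_ring. lra.
  - exists b, M, k. split; auto. split. apply Hds. intros z Hz. unfold f.
    rewrite He. 2: { unfold right_half_plane, half_plane. lra. }
    replace (1 * z + phi z - z)%C with (phi z) by ring. apply Hds. auto.
Qed.

Lemma Ccompact_single (p : C) : Ccompact (fun s => s = p).
Proof.
  intros I U HU Hc. destruct (Hc p eq_refl) as [i Hi]. exists (i :: nil)%list.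
  intros s ->. exists i. split; simpl; auto.
Qed.

Lemma at_right_ex (P : R -> Prop) : at_right 0 P -> exists d, 0 < d /\ forall t, 0 < t -> t < d -> P t.
Proof.
  intros [d Hd]. exists d. split. apply cond_pos. intros t H1 H2. apply Hd; auto.
  unfold ball; simpl. unfold AbsRing_ball, abs, minus, plus, opp; simpl.
  rewrite Rabs_pos_eq; lra.
Qed.

Lemma Ccvg_Cmod_le x y l m (c : R) : Ccvg x l -> Ccvg y m -> 0 <= c ->
  (forall j, Cmod (x j) <= c * Cmod (y j)) -> Cmod l <= c * Cmod m.
Proof.
  intros Hx Hy Hc H. apply le_epsilon. intros e He.
  destruct (Hx (e / 2)) as [N HN]; [lra|].
  destruct (Hy (e / (2 * (c + 1)))) as [N' HN']. { pos. }
  specialize (HN (max N N') ltac:(lia)). specialize (HN' (max N N') ltac:(lia)). specialize (H (max N N')).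
  apply Rlt_div_r in HN'; [|lra].
  pose proof (Cmod_sub_ge l (x (max N N'))) as A. rewrite Cmod_sym in A.
  pose proof (Cmod_sub_ge (y (max N N')) m) as B.
  nra.
Qed.

Lemma Ccvg_Re_ge0 x l : Ccvg x l -> (forall j, 0 <= Re (x j)) -> 0 <= Re l.
Proof.
  intros Hx H. apply Rnot_lt_le. intros Hl. destruct (Hx (- Re l)) as [N HN]; [lra|].
  specialize (HN N (Nat.le_refl _)). specialize (H N). pose proof (Re_near (x N) l) as Q. lra.
Qed.

Lemma ccont_Ccvg f s x : ccont f s -> Ccvg x s -> Ccvg (fun j => f (x j)) (f s).
Proof.
  intros Hf Hx e He. destruct (Hf e He) as [d [Hd H]]. destruct (Hx d Hd) as [N HN].
  exists N. intros n Hn. auto.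
Qed.

Lemma Re_inv_ge0 (a b : C) : (a * b = 1)%C -> 0 <= Re b -> 0 <= Re a.
Proof.
  intros E Hb. assert (H : (a * (b * Cconj b) = Cconj b)%C).
  { rewrite Cmult_assoc, E. ring. }
  rewrite <- Cmod2_conj in H. apply (f_equal Re) in H.
  replace (Re (a * RtoC (Cmod b ^ 2))%C) with (Re a * Cmod b ^ 2) in H by Re_ring.
  replace (Re (Cconj b)) with (Re b) in H by reflexivity.
  assert (P : 0 < Cmod b ^ 2).
  { apply pow_lt. apply Cmod_gt_0. intros Z. rewrite Z, Cmult_0_r in E.
    apply (f_equal Re) in E. simpl in E. lra. }
  apply Rnot_lt_le. intros L. nra.
Qed.

Section KoenigsDerivative.
Variables (h : C -> C) (Phi : R -> C -> C).
Hypothesis Hh : forall s, 0 < Re s -> cderiv h s (C_derive h s).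
Hypothesis Hinj : forall s w, 0 < Re s -> 0 < Re w -> h s = h w -> s = w.
Hypothesis HG : forall t, 0 <= t -> gordon_hedenmalm (Phi t).
Hypothesis Hlim : forall s e, 0 < Re s -> 0 < e ->
  exists d, 0 < d /\ forall t, 0 < t -> t < d -> Cmod (Phi t s - s) < e.
Hypothesis Hk : forall s, 0 < Re s -> forall t, 0 <= t -> h (Phi t s) = (h s + t)%C.

(** All times stay below the threshold [t0] attached to the point [1/4], so that [gordon_near_id]
    applies to every one of them. *)
Lemma displacement_sequence : exists t : nat -> R, (forall j, 0 < t j) /\
  (forall s, 0 < Re s -> Ccvg (fun j => Phi (t j) s) s) /\
  (forall j, let f := fun s => (Phi (t j) s - s)%C in
    hol_rhp f /\ nonneg_rhp f /\ exists b M k, 0 <= k /\ dseries b M k f).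
Proof.
  destruct (Hlim (RtoC (/ 4)) (/ 4)) as [t0 [Ht0 H0]]; [simpl; lra|lra|].
  assert (Hj : forall j, 0 < t0 / (INR (S j) + 1) /\ t0 / (INR (S j) + 1) < t0).
  { intros j. pose proof (INR_S_ge1 j). split. apply Rdiv_lt_0_compat; lra.
    apply Rlt_div_l; nra. }
  exists (fun j => t0 / (INR (S j) + 1)). split; [apply Hj|]. split.
  - intros s Hs e He. destruct (Hlim s e Hs He) as [d [Hd H]].
    destruct (small_inv t0 d) as [N HN]; [lra|auto|]. exists N. intros n Hn. apply H. apply Hj.
    eapply Rlt_trans; [|apply (HN n Hn)]. pose proof (INR_S_ge1 n).
    apply Rmult_lt_compat_l; auto. apply Rinv_lt_contravar; nra.
  - intros j. destruct (Hj j). apply gordon_near_id. apply HG. lra. apply H0; auto.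
Qed.

Lemma koenigs_derivative_aux : is_dirichlet_series (C_derive h) /\
  forall s, 0 < Re s -> 0 <= Re (C_derive h s) /\ C_derive h s <> RtoC 0.
Proof.
  destruct displacement_sequence as [t [Ht [Hc Hf]]].
  set (h' := C_derive h) in *.
  set (F := fun j s => ((/ t j)%R * (Phi (t j) s - s))%C).
  assert (Hit : forall j, 0 < / t j) by (intros; pos).
  assert (HF : forall j, hol_rhp (F j) /\ nonneg_rhp (F j)).
  { intros j. destruct (Hf j) as [H1 [H2 _]]. split.
    - intros s Hs. destruct (H1 s Hs) as [l Hl]. eexists. apply cderiv_scal. apply Hl.
    - intros s Hs. specialize (H2 s Hs). unfold F.
      replace (Re ((/ t j)%R * (Phi (t j) s - s))%C) with (/ t j * Re (Phi (t j) s - s)%C) by Re_ring.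
      specialize (Hit j). apply Rmult_le_pos; lra. }
  (* For the slope function [q] of [h] at [s], the relation [h (Phi t s) = h s + t] becomes the
     exact identity [q (Phi t s) * F = 1], where [q (Phi t s)] tends to [h' s]. *)
  assert (Hq : forall s, 0 < Re s -> exists q : C -> C, q s = h' s /\ ccont q s /\
     forall j, (q (Phi (t j) s) * F j s = 1)%C).
  { intros s Hs. destruct (Hh s Hs) as [q [E1 [E2 E3]]]. exists q. split; auto. split; auto.
    intros j. pose proof (E3 (Phi (t j) s)) as E. rewrite Hk in E by pos.
    unfold F. transitivity ((/ t j)%R * (q (Phi (t j) s) * (Phi (t j) s - s)))%C. ring.
    replace (q (Phi (t j) s) * (Phi (t j) s - s))%C with (RtoC (t j)).
    - rewrite <- RtoC_mult. f_equal. field. apply Rgt_not_eq, Ht.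
    - transitivity (h s + t j - h s)%C. ring. rewrite E. ring. }
  assert (Hn : nonneg_rhp h').
  { intros s Hs. destruct (Hq s Hs) as [q [E1 [E2 E3]]]. rewrite <- E1.
    apply (Ccvg_Re_ge0 (fun j => q (Phi (t j) s))). apply ccont_Ccvg; auto.
    intros j. apply (Re_inv_ge0 _ (F j s)); auto. apply HF. auto. }
  assert (Hp : pick_ineq h') by (apply (pick_derivative h); auto).
  (* By [pick_zero] a single zero of [h'] makes [h'] vanish identically, and [h] would be
     constant. *)
  assert (Hn0 : forall s, 0 < Re s -> h' s <> RtoC 0).
  { intros s Hs E.
    assert (Hz : forall z, 0 < Re z -> h' z = 0).
    { intros z Hz. rewrite <- E. apply pick_zero; auto. rewrite E. reflexivity. }
    assert (h 1 = h 2).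
    { symmetry. apply Cminus_0_eq, Cmod_zero_le.
      apply Rle_trans with (0 * Cmod (2 - 1)); [|lra].
      assert (Rt : forall t : R, 0 <= t <= 1 -> 0 < Re (1 + t * (2 - 1))%C) by (intros; simpl; lra).
      apply cderiv_MVI with (f' := h'); intros u Hu.
      apply Hh. auto. rewrite Hz by auto. rewrite Cmod_0. lra. }
    apply Hinj in H; [|simpl; lra|simpl; lra]. apply (f_equal Re) in H. simpl in H. lra. }
  split; [|intros; split; auto].
  set (G := fun s => (/ h' s)%C).
  assert (HFG : forall s, 0 < Re s -> Ccvg (fun j => F j s) (G s)).
  { intros s Hs. destruct (Hq s Hs) as [q [E1 [E2 E3]]].
    assert (CV : Ccvg (fun j => (/ q (Phi (t j) s))%C) (/ q s)%C).
    { apply (ccont_Ccvg (fun z => / q z)%C s (fun j => Phi (t j) s)); auto.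
      apply ccont_inv; auto. rewrite E1. auto. }
    rewrite E1 in CV. eapply Ccvg_ext; [|exact CV]. intros j. cbv beta. specialize (E3 j). assert (q (Phi (t j) s) <> 0).
    { intros Z. rewrite Z, Cmult_0_l in E3. apply (f_equal Re) in E3. simpl in E3. lra. }
    rewrite <- (Cmult_1_r (/ q (Phi (t j) s))), <- E3. field. auto. }
  assert (Hser : forall j, exists b, dseries b (6 * Cmod (F j 12)) 6 (F j) /\
    forall n, (1 <= n)%nat -> Cmod (b n) <= 2 * INR (S n) * Cmod (b O)).
  { intros j. destruct (Hf j) as [_ [_ [b [M [k [Hk0 Hd]]]]]].
    exists (fun n => (/ t j)%R * b n)%C.
    apply (nonneg_dseries_normal (F j) (fun n => (/ t j)%R * b n)%C (/ t j * M) k (proj1 (HF j)) (proj2 (HF j)) Hk0).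
    apply dseries_scal. left; auto. apply Hd. }
  (* From index [N] on the values at 12 are bounded, which makes [P] a common bound for the
     coefficients of all the series. *)
  destruct (HFG 12 ltac:(simpl; lra) 1 Rlt_0_1) as [N HN].
  set (P := 6 * (Cmod (G 12) + 1)).
  destruct (functional_choice _ _ _ Hser) as [b0 Hser']. set (b := fun j => b0 (N + j)%nat).
  assert (Hb : forall j, dseries (b j) P 6 (F (N + j)%nat) /\
    forall n, (1 <= n)%nat -> Cmod (b j n) <= 2 * INR (S n) * Cmod (b j O)).
  { intros j. destruct (Hser' (N + j)%nat) as [H1 H2].
    split; auto. eapply dseries_mono; [|exact H1]. unfold P. specialize (HN (N + j)%nat ltac:(lia)).
    pose proof (Cmod_sub_ge (F (N + j)%nat 12) (G 12)). lra. }
  destruct (dseries_limit b P 6 (fun j => F (N + j)%nat) G) as [b' [Hb' Hd']].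
  { intros j. apply Hb. }
  { intros z Hz e He. destruct (HFG z ltac:(lra) e He) as [N' HN']. exists N'. intros n Hle. apply HN'. lia. }
  (* The inequality between the coefficients passes to the limit: if [b' O] were 0, all coefficients
     would be, and [1 / h'] would vanish at 8, where its series converges. *)
  assert (Hb0 : b' O <> 0).
  { intros Z.
    assert (Hz : forall n, b' n = 0).
    { intros n. destruct n as [|n]; auto. apply Cmod_zero_le.
      assert (Q : Cmod (b' (S n)) <= 2 * INR (S (S n)) * Cmod (b' O)).
      { apply (Ccvg_Cmod_le (fun j => b j (S n)) (fun j => b j O)); auto.
        pose proof (INR_S_pos (S n)). lra. intros j. apply Hb. lia. }
      rewrite Z, Cmod_0, Rmult_0_r in Q. auto. }
    assert (G 8 = 0).
    { apply (Ccvg_unique (csum (fun n => b' n * npow n 8)%C)). apply Hd'. simpl. lra.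
      intros e He. exists O. intros n _. rewrite (csum_ext _ (fun _ => RtoC 0)).
      rewrite csum_0, Cmod_diff_0. auto. intros k _. rewrite Hz. ring. }
    assert (h' 8 <> 0) by (apply Hn0; simpl; lra).
    unfold G in H. pose proof (Cinv_r (h' 8) H0) as I. rewrite H, Cmult_0_r in I.
    apply (f_equal Re) in I. simpl in I. lra. }
  destruct (dseries_lim_first b' P 6 G (Cmod (b' O) / 2) Hd') as [X [HX HGX]].
  { apply Cmod_gt_0 in Hb0. lra. }
  apply (dunif_dirichlet X).
  apply dunif_ext with (f := fun s => (/ G s)%C).
  - intros s Hs. unfold G. assert (h' s <> 0) by (apply Hn0; lra). field. auto.
  - apply dunif_inv with (c := b' O); auto. lra. eapply dseries_dunif; eauto.
Qed.

End KoenigsDerivative.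

Lemma koenigs_derivative (h : C -> C) : holomorphic_on right_half_plane h ->
  (exists Phi : R -> C -> C, continuous_semigroup Phi /\ koenigs_function Phi h) ->
  is_dirichlet_series (C_derive h) /\
  forall s : C, right_half_plane s -> 0 <= Re (C_derive h s) /\ C_derive h s <> RtoC 0.
Proof.
  intros Hh [Phi [[HG [H0 [_ Hlim]]] [_ [[_ Hinj] Hk]]]].
  apply (koenigs_derivative_aux h Phi); auto.
  - apply holomorphic_cderiv. auto.
  - intros s e Hs He.
    destruct (at_right_ex _ (Hlim (fun z => z = s) (Ccompact_single s) ltac:(intros z ->; exact Hs) e He)) as [d [Hd H]].
    exists d. split; auto. intros t Ht1 Ht2. specialize (H t Ht1 Ht2 s eq_refl).
    rewrite H0 in H by exact Hs. exact H.
Qed.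

(** * From the Koenigs function to the semigroup *)

Lemma Re_seg_ge x a b (t : R) : x <= Re a -> x <= Re b -> 0 <= t <= 1 -> x <= Re (a + t * (b - a))%C.
Proof.
  intros Ha Hb Ht.
  replace (Re (a + t * (b - a))%C) with ((1 - t) * Re a + t * Re b) by Re_ring. nra.
Qed.

Lemma Ccompact_rhp K : Ccompact K -> (forall s, K s -> 0 < Re s) ->
  exists x, 0 < x /\ forall s, K s -> x <= Re s.
Proof.
  intros HK Hp.
  destruct (HK nat (fun n s => / INR (S n) < Re s)) as [l Hl].
  - intros n s Hs. set (I := / INR (S n)) in *. assert (P : 0 < Re s - I) by lra.
    exists (mkposreal _ P). intros y [Hy _]. unfold ball in Hy; simpl in Hy.
    unfold AbsRing_ball, abs, minus, plus, opp in Hy; simpl in Hy.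
    apply Rabs_lt_between in Hy. unfold Re in *. lra.
  - intros s Hs. destruct (small_inv 1 (Re s)) as [n Hn]; [lra|auto|].
    exists n. specialize (Hn n (Nat.le_refl _)). lra.
  - exists (/ INR (S (list_max l))). split. apply Rinv_0_lt_compat, INR_S_pos.
    intros s Hs. destruct (Hl s Hs) as [n [Hn Hlt]].
    assert (n <= list_max l)%nat.
    { pose proof (proj1 (list_max_le l (list_max l)) (Nat.le_refl _)) as F.
      rewrite Forall_forall in F. auto. }
    left. eapply Rle_lt_trans; [|exact Hlt]. apply Rinv_le_contravar. apply INR_S_pos.
    apply le_INR. lia.
Qed.

Section Inverse.
Variable h h' : C -> C.
Hypothesis Hh : forall s, 0 < Re s -> cderiv h s (h' s).
Hypothesis Hn : nonneg_rhp h'.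
Hypothesis Hn0 : forall s, 0 < Re s -> h' s <> RtoC 0.

(** Pairing [h w - h s = t] with the conjugate of [w - s] gives
    [t (Re w - Re s) = Re (h' z) |w - s|^2] for some [z] on the segment. *)
Lemma translate_Re s w t : 0 < Re s -> 0 < Re w -> 0 < t -> h w = (h s + RtoC t)%C -> Re s <= Re w.
Proof.
  intros Hs Hw Ht E.
  destruct (cderiv_MVT h h' s w (Cconj (w - s))) as [u [Hu Q]].
  { intros u Hu. apply Hh. apply Rlt_le_trans with (Rmin (Re s) (Re w)).
    apply Rmin_glb_lt; auto. apply Re_seg_ge; auto. apply Rmin_l. apply Rmin_r. }
  assert (P : 0 <= Re (h' (s + u * (w - s))%C)).
  { apply Hn. apply Rlt_le_trans with (Rmin (Re s) (Re w)).
    apply Rmin_glb_lt; auto. apply Re_seg_ge; auto. apply Rmin_l. apply Rmin_r. }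
  replace (h w - h s)%C with (RtoC t) in Q by (rewrite E; ring).
  replace (Re (Cconj (w - s) * (h' (s + u * (w - s)) * (w - s)))%C)
    with (Re (h' (s + u * (w - s))%C) * (Re (w - s)%C ^ 2 + Im (w - s)%C ^ 2)) in Q by Re_ring.
  replace (Re (Cconj (w - s) * t)%C) with (t * (Re w - Re s)) in Q by Re_ring.
  nra.
Qed.

(** The Noshiro-Warschawski argument, in quantitative form. *)
Lemma strong_mono x m s w : 0 < x -> (forall z, x <= Re z -> m <= Re (h' z)) ->
  x <= Re s -> x <= Re w -> m * Cmod (w - s) <= Cmod (h w - h s).
Proof.
  intros Hx Hm Hs Hw.
  destruct (cderiv_MVT h h' s w (Cconj (w - s))) as [u [Hu Q]].
  { intros u Hu. apply Hh. apply Rlt_le_trans with x; auto. apply Re_seg_ge; auto. }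
  assert (P : m <= Re (h' (s + u * (w - s))%C)). { apply Hm. apply Re_seg_ge; auto. }
  replace (Re (Cconj (w - s) * (h' (s + u * (w - s)) * (w - s)))%C)
    with (Re (h' (s + u * (w - s))%C) * Cmod (w - s) ^ 2) in Q by (rewrite Cmod2_alt; unfold Re, Im; simpl; ring).
  pose proof (Re_abs (Cconj (w - s) * (h w - h s))%C) as A. rewrite Cmod_mult, Cmod_conj in A.
  pose proof (Cmod_ge_0 (w - s)). destruct (Rle_lt_or_eq_dec _ _ H) as [L|L].
  - apply Rmult_le_reg_l with (Cmod (w - s)); auto. nra.
  - rewrite <- L, Rmult_0_r. apply Cmod_ge_0.
Qed.

(** Stated for [h] rather than as a lower bound of [Re h']: when [h'] is an imaginary constant, its
    real part is 0 but this property still holds. *)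
Definition lower_lip (x m : R) : Prop := forall s w, x <= Re s -> x <= Re w ->
  m * Cmod (w - s) <= Cmod (h w - h s).

(* Since [h'] does not vanish, a positive [|h - T|] has no interior minimum. *)
Lemma local_solve x m s t : 0 < x -> 0 < m -> lower_lip x m ->
  2 * x <= Re s -> 0 <= t -> t <= m * x / 4 -> exists w, x <= Re w /\ h w = (h s + RtoC t)%C.
Proof.
  intros Hx Hm Hmz Hs Ht Htm.
  set (K := fun z => Cmod (z - s) <= x). set (T := (h s + RtoC t)%C).
  assert (HK : forall z, K z -> x <= Re z).
  { intros z Kz. unfold K in Kz. pose proof (Re_near z s) as Q. lra. }
  assert (Ks : K s) by (unfold K; rewrite Cmod_diff_0; lra).
  destruct (extreme_value K (fun z => - ((h z - T) * Cconj (h z - T)))%C (x + Cmod s) s Ks (cball_bounded s x)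
    (cball_closed s x)) as [p [Kp Hp0]].
  { intros z Kz. apply ccont_opp. apply (ccont_normsq (fun z => h z - T)%C).
    apply ccont_plus; [|apply ccont_const]. eapply cderiv_ccont. apply Hh. specialize (HK z Kz). lra. }
  assert (Hp : forall z, K z -> Cmod (h p - T) <= Cmod (h z - T)).
  { intros z Kz. specialize (Hp0 z Kz). rewrite <- !Cmod2_conj, <- !RtoC_opp in Hp0. simpl in Hp0.
    pose proof (Cmod_ge_0 (h z - T)). nra. }
  assert (Hts : Cmod (h s - T) = t).
  { unfold T. replace (h s - (h s + t))%C with (- RtoC t)%C by ring. rewrite Cmod_opp, Cmod_R_pos; auto. }
  assert (Hpt : Cmod (h p - T) <= t). { specialize (Hp s Ks). lra. }
  (* Both [h p] and [h s] are within [t] of [T], and [2 * t <= m * x / 2], so the minimizer lies in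
     the open disc. *)
  assert (Hin : Cmod (p - s) < x).
  { pose proof (Hmz s p (HK s Ks) (HK p Kp)) as Q.
    pose proof (Cmod_tri (h p) T (h s)) as A. rewrite (Cmod_sym T), Hts in A.
    nra. }
  exists p. split; auto. fold T. apply NNPP. intros Hne.
  set (v := (h p - T)%C) in *.
  assert (Hv : 0 < Cmod v). { apply Cmod_gt_0. apply Cminus_neq_0. auto. }
  pose proof (HK p Kp) as Rp.
  set (l := h' p). assert (Hl : l <> 0) by (apply Hn0; lra).
  assert (Hl0 : 0 < Cmod l) by (apply Cmod_gt_0; auto).
  pose proof (Hh p ltac:(lra)) as Q. rewrite cderiv_eps in Q. fold l in Q.
  destruct (Q (Cmod l / 2)) as [d [Hd H]]; [lra|].
  set (A := Cmod v / Cmod l). assert (HA : 0 < A) by pos.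
  set (eta := Rmin (/ 2) (Rmin d (x - Cmod (p - s)) / (2 * A))).
  assert (He : 0 < eta) by pos.
  assert (He2 : eta <= / 2) by apply Rmin_l.
  assert (He3 : eta <= Rmin d (x - Cmod (p - s)) / (2 * A)) by apply Rmin_r.
  apply Rle_div_r in He3; [|lra].
  (* A damped Newton step towards [T]. The damping keeps [z] in the disc and in the range where the
     linearization error is at most [eta * Cmod v / 2], so [|h z - T| <= (1 - eta / 2) |v|],
     contrary to minimality. *)
  set (z := (p - eta * (v / l))%C).
  assert (Ez : (z - p = - (eta * (v / l)))%C) by (unfold z; ring).
  assert (Cz : Cmod (z - p) = eta * A).
  { rewrite Ez, Cmod_opp, Cmod_mult, Cmod_R_pos, Cmod_div by pos. reflexivity. }
  pose proof (Rmin_l d (x - Cmod (p - s))). pose proof (Rmin_r d (x - Cmod (p - s))).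
  specialize (H z ltac:(lra)).
  assert (Kz : K z). { unfold K. pose proof (Cmod_tri z p s). lra. }
  specialize (Hp z Kz). fold v in Hp.
  replace (h z - h p - l * (z - p))%C with ((h z - T) - (1 - eta)%R * v)%C in H.
  2: { rewrite Ez. unfold v. rewrite RtoC_minus. field. auto. }
  pose proof (Cmod_sub_ge (h z - T) ((1 - eta)%R * v)) as B. rewrite Cmod_mult, Cmod_R_pos in B by lra.
  assert (E : Cmod l / 2 * (eta * A) = eta * Cmod v / 2) by (unfold A; field; lra).
  nra.
Qed.

Hypothesis Hlip : forall x, 0 < x -> exists m, 0 < m /\ lower_lip x m.

(** A step of [local_solve] only guarantees abscissa [x], half of what the next step requires;
    [translate_Re] shows that the real part has in fact not decreased, so one step length [tau]
    serves throughout. *)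
Lemma global_solve s t :
  0 < Re s -> 0 <= t -> exists w, 0 < Re w /\ h w = (h s + RtoC t)%C.
Proof.
  intros Hs Ht. set (x := Re s / 2). assert (Hx : 0 < x) by pos.
  destruct (Hlip x Hx) as [m [Hm Hmz]].
  set (tau := m * x / 4). assert (Htau : 0 < tau). { unfold tau. nra. }
  assert (I : forall n t, 0 <= t -> t <= INR n * tau -> exists w, 2 * x <= Re w /\ h w = (h s + RtoC t)%C).
  { induction n as [|n IH]; intros u Hu Hu'.
    - simpl in Hu'. exists s. split. unfold x. lra. replace u with 0 by lra. ring.
    - rewrite S_INR in Hu'. destruct (Rle_dec u (INR n * tau)) as [L|L]; [auto|].
      apply Rnot_le_lt in L. destruct (Rle_dec u tau) as [L2|L2].
      + destruct (local_solve x m s u) as [w [Hw E]]; auto. unfold x; lra.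
        destruct (Rle_lt_or_eq_dec _ _ Hu) as [Hu1|Hu1].
        * exists w. split; auto. pose proof (translate_Re s w u Hs ltac:(lra) Hu1 E). unfold x. lra.
        * exists s. split. unfold x; lra. rewrite <- Hu1. ring.
      + destruct (IH (u - tau)) as [w1 [Hw1 E1]]; [lra|lra|].
        destruct (local_solve x m w1 tau) as [w [Hw E]]; auto. lra. unfold tau; lra.
        exists w. split. pose proof (translate_Re w1 w tau ltac:(lra) ltac:(lra) Htau E). lra.
        rewrite E, E1. rewrite RtoC_minus. ring. }
  destruct (nfloor_ex (t / tau)) as [n [_ Hnn]]. { pos. }
  destruct (I (S n) t Ht) as [w [Hw E]].
  { rewrite S_INR. apply Rlt_div_l in Hnn; auto. lra. }
  exists w. split; auto. lra.
Qed.

Lemma lower_lip_inj s w : 0 < Re s -> 0 < Re w -> h s = h w -> s = w.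
Proof.
  intros Hs Hw E. destruct (Hlip (Rmin (Re s) (Re w))) as [m [Hm H]]. apply Rmin_glb_lt; auto.
  specialize (H w s (Rmin_r _ _) (Rmin_l _ _)). rewrite E, Cmod_diff_0 in H.
  apply Cminus_0_eq, Cmod_zero_le. nra.
Qed.

(** The choice is harmless on the half-plane for [t >= 0]: [global_solve] gives a solution there and
    [lower_lip_inj] its uniqueness. *)
Definition flow (t : R) (s : C) : C :=
  epsilon (inhabits (RtoC 0)) (fun w => 0 < Re w /\ h w = (h s + RtoC t)%C).

Lemma flow_spec t s : 0 < Re s -> 0 <= t -> 0 < Re (flow t s) /\ h (flow t s) = (h s + RtoC t)%C.
Proof.
  intros Hs Ht.
  apply (epsilon_spec (inhabits (RtoC 0)) (fun w => 0 < Re w /\ h w = (h s + RtoC t)%C)). apply global_solve; auto.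
Qed.

Lemma flow_0 s : 0 < Re s -> flow 0 s = s.
Proof.
  intros Hs. destruct (flow_spec 0 s Hs (Rle_refl 0)) as [H1 H2].
  apply lower_lip_inj; auto. rewrite H2. ring.
Qed.

Lemma flow_Re t s : 0 < Re s -> 0 <= t -> Re s <= Re (flow t s).
Proof.
  intros Hs Ht. destruct (Rle_lt_or_eq_dec _ _ Ht) as [L|L].
  - destruct (flow_spec t s Hs Ht). apply (translate_Re s (flow t s) t); auto.
  - rewrite <- L, flow_0; auto. lra.
Qed.

Lemma flow_plus t u s : 0 < Re s -> 0 <= t -> 0 <= u -> flow t (flow u s) = flow (t + u) s.
Proof.
  intros Hs Ht Hu. destruct (flow_spec u s Hs Hu) as [A1 A2].
  destruct (flow_spec t (flow u s) A1 Ht) as [B1 B2].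
  destruct (flow_spec (t + u) s Hs ltac:(lra)) as [C1 C2].
  apply lower_lip_inj; auto. rewrite B2, A2, C2, RtoC_plus. ring.
Qed.

Lemma flow_near x : 0 < x -> exists m, 0 < m /\ forall t s, 0 <= t -> x <= Re s -> m * Cmod (flow t s - s) <= t.
Proof.
  intros Hx. destruct (Hlip x Hx) as [m [Hm H]]. exists m. split; auto. intros t s Ht Hs.
  pose proof (flow_Re t s ltac:(lra) Ht). destruct (flow_spec t s ltac:(lra) Ht) as [_ E].
  specialize (H s (flow t s) Hs ltac:(lra)). rewrite E in H.
  replace (h s + t - h s)%C with (RtoC t) in H by ring. rewrite Cmod_R_pos in H; auto.
Qed.

(** Continuity comes from the lower Lipschitz bound. The slope function is then the quotient of the
    slope functions of [h] at [s] and at [flow t s], the latter composed with the flow. *)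
Lemma flow_hol t : 0 <= t -> hol_rhp (flow t).
Proof.
  intros Ht s Hs. destruct (flow_spec t s Hs Ht) as [W1 W2]. set (w := flow t s) in *.
  destruct (Hlip (Re s / 2)) as [m [Hm HL]]; [lra|].
  pose proof (flow_Re t s Hs Ht) as Rw. fold w in Rw.
  assert (Hz : forall z, Cmod (z - s) < Re s / 2 -> 0 < Re z /\ Re s / 2 <= Re (flow t z)).
  { intros z Hz. pose proof (Re_near z s) as Q.
    assert (0 < Re z) by lra. pose proof (flow_Re t z H Ht). split; lra. }
  assert (Hc : ccont (flow t) s).
  { intros e He. pose proof (Hh s Hs) as Q. apply cderiv_ccont in Q.
    destruct (Q (m * e)) as [d [Hd H]]. { pos. }
    exists (Rmin d (Re s / 2)). split. { pos. }
    intros z Hzz.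
    destruct (Rmin_Rgt_l _ _ _ Hzz) as [Z1 Z2].
    destruct (Hz z Z2) as [P1 P2]. destruct (flow_spec t z P1 Ht) as [_ E].
    specialize (H z Z1). fold w. specialize (HL w (flow t z) ltac:(lra) P2).
    rewrite E, W2 in HL. replace (h z + t - (h s + t))%C with (h z - h s)%C in HL by ring.
    apply Rmult_lt_reg_l with m; auto. lra. }
  destruct (Hh s Hs) as [q [_ [Q2 Q3]]]. destruct (Hh w W1) as [p [P1 [P2 P3]]].
  assert (Hpc : ccont (fun z => p (flow t z)) s) by (apply ccont_comp; auto).
  assert (Hpw : p w <> 0) by (rewrite P1; auto).
  destruct (Hpc (Cmod (p w))) as [d [Hd H]]. { apply Cmod_gt_0; auto. }
  exists (q s * / p w)%C.
  apply cderiv_ext_loc with (f := fun z => (w + q z * / p (flow t z) * (z - s))%C) (r := Rmin d (Re s / 2)).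
  { pos. }
  - intros z Hzz.
    destruct (Rmin_Rgt_l _ _ _ Hzz) as [Z1 Z2].
    specialize (H z Z1). fold w in H.
    assert (Hpz : p (flow t z) <> 0).
    { intros Z. rewrite Z in H. replace (0 - p w)%C with (- p w)%C in H by ring. rewrite Cmod_opp in H. lra. }
    destruct (Hz z Z2) as [A1 A2]. destruct (flow_spec t z A1 Ht) as [_ E].
    pose proof (P3 (flow t z)) as E2. rewrite E, W2, (Q3 z) in E2.
    assert (E3 : (q z * (z - s) = p (flow t z) * (flow t z - w))%C).
    { transitivity (h s + q z * (z - s) + t - (h s + t))%C. ring. rewrite E2. ring. }
    transitivity (w + (q z * (z - s)) * / p (flow t z))%C. ring. rewrite E3. field. auto.
  - exists (fun z => q z * / p (flow t z))%C. split. reflexivity. split.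
    + apply ccont_mult; auto. apply ccont_inv; auto.
    + intros z. fold w. ring.
Qed.

Lemma flow_koenigs : (forall t, 0 <= t -> is_dirichlet_series (fun s => flow t s - s)%C) ->
  continuous_semigroup flow /\ koenigs_function flow h.
Proof.
  intros HD. split; [split; [|split; [|split]]|split; [|split]].
  - intros t Ht. split; [|split].
    + apply hol_rhp_holomorphic, flow_hol. auto.
    + intros s Hs. apply flow_spec; auto.
    + exists 1%nat, (fun s => flow t s - s)%C. split; auto. split.
      * intros s _. simpl. ring.
      * intros; discriminate.
  - intros s Hs. apply flow_0. exact Hs.
  - intros t u Ht Hu s Hs. apply flow_plus; auto.
  - intros K HK HKp e He. destruct (Ccompact_rhp K HK HKp) as [x [Hx HKx]].
    destruct (flow_near x Hx) as [m [Hm H]].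
    assert (P : 0 < m * e) by pos.
    exists (mkposreal _ P). intros t Ht Ht0 s Ks.
    unfold ball in Ht; simpl in Ht. unfold AbsRing_ball, abs, minus, plus, opp in Ht; simpl in Ht.
    rewrite Rabs_pos_eq in Ht by lra.
    rewrite (flow_0 s) by (apply HKp; auto). specialize (H t s ltac:(lra) (HKx s Ks)).
    apply Rmult_lt_reg_l with m; auto. lra.
  - intros t Ht s Hs E. destruct (flow_spec t s Hs ltac:(lra)) as [_ E2]. rewrite E in E2.
    assert (RtoC t = 0). { transitivity (h s + t - h s)%C. ring. rewrite <- E2. ring. }
    apply RtoC_inj in H. lra.
  - split. apply hol_rhp_holomorphic. intros s Hs. exists (h' s). auto.
    intros s w Hs Hw. apply lower_lip_inj; auto.
  - intros s Hs t Ht. apply flow_spec; auto.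
Qed.

(** * The displacement of the flow as a Dirichlet series *)

Variables (b : nat -> C) (M k : R).
Hypothesis Hk : 0 <= k.
Hypothesis Hser : dseries b M k h'.
Hypothesis Hb0 : b O <> 0.

Lemma primitive_series : exists E c C0, dseries c (2 * M) k E /\
  (forall s, k + 6 <= Re s -> cderiv E s (h' s - b O)%C) /\
  forall s, k + 6 <= Re s -> h s = (b O * s + E s + C0)%C.
Proof.
  (* Termwise antiderivatives; the constant term of [h'] is left out, as it integrates to
     [b O * s]. *)
  set (c := fun n => if Nat.eq_dec n 0 then RtoC 0 else ((- / lnS n)%R * b n)%C).
  assert (HM := poly_bound_M _ _ _ (proj1 Hser)).
  assert (Hc : poly_bound c (2 * M) k).
  { intros n. unfold c. destruct Nat.eq_dec as [E|E].
    - rewrite Cmod_0. apply Rmult_le_pos. lra. left; apply exp_pos.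
    (* The smallest divisor is [ln 2 > / 2], whence the factor 2 in [2 * M]. *)
    - assert (L2 : / 2 < lnS n).
      { apply Rlt_le_trans with (ln 2). apply ln_lt_2.
        apply (lnS_le 1 n). lia. }
      rewrite Cmod_mult, Cmod_R, Rabs_Ropp, Rabs_pos_eq.
      2: pos.
      rewrite Rmult_assoc. apply Rmult_le_compat; [left; apply Rinv_0_lt_compat; lra|apply Cmod_ge_0| |apply Hser].
      rewrite <- (Rinv_inv 2) at 1. apply Rinv_le_contravar; lra. }
  destruct (dseries_exists _ _ _ Hc) as [E HE]. exists E, c.
  assert (HcE : forall s, k + 6 <= Re s -> cderiv E s (h' s - b O)%C).
  { destruct (dseries_exists _ _ _ (poly_bound_deriv _ _ _ Hc)) as [g Hg].
    intros s Hs. replace (h' s - b O)%C with (g s). eapply dseries_deriv; eauto.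
    apply (Ccvg_unique _ _ _ (proj2 Hg s ltac:(lra))).
    pose proof (Ccvg_plus _ _ _ _ (proj2 Hser s ltac:(lra)) (Ccvg_const (- b O)%C)) as CV.
    intros e He. destruct (CV e He) as [N HN]. exists (S N). intros n Hnn.
    specialize (HN n ltac:(lia)).
    replace (csum (fun n => (- lnS n)%R * c n * npow n s)%C n) with (csum (fun n => b n * npow n s)%C n + - b O)%C; auto.
    clear HN. destruct n as [|n]. lia. clear Hnn. induction n as [|n IH].
    - unfold c; simpl. rewrite npow_0. ring.
    - change (csum (fun n => b n * npow n s)%C (S n) + b (S n) * npow (S n) s + - b O =
        csum (fun n => (- lnS n)%R * c n * npow n s)%C (S n) + (- lnS (S n))%R * c (S n) * npow (S n) s)%C.
      rewrite <- IH. unfold c at 1. destruct Nat.eq_dec as [E0|E0]. discriminate.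
      pose proof (lnS_pos (S n) ltac:(lia)).
      transitivity (csum (fun n0 : nat => (b n0 * npow n0 s)%C) (S n) + - b O + ((- lnS (S n))%R * (- / lnS (S n))%R) * b (S n) * npow (S n) s)%C; [|ring].
      rewrite <- RtoC_mult. replace (- lnS (S n) * - / lnS (S n)) with 1 by (field; lra). ring. }
  set (p := RtoC (k + 6)). exists (h p - b O * p - E p)%C. split; auto. split; auto.
  intros s Hs. set (D := fun z => (h z - b O * z - E z)%C).
  assert (D s = D p).
  { apply Cminus_0_eq, Cmod_zero_le. apply Rle_trans with (0 * Cmod (s - p)); [|lra].
    assert (Rp : k + 6 <= Re p) by (unfold p; simpl; lra).
    apply cderiv_MVI with (f' := fun _ => RtoC 0); intros t Ht; pose proof (Re_seg_ge (k + 6) p s t Rp Hs Ht) as Q.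
    - eapply cderiv_eq. apply cderiv_minus. apply cderiv_minus. apply Hh. lra.
      apply cderiv_scal, cderiv_id. apply HcE. auto. ring.
    - rewrite Cmod_0. lra. }
  unfold D in H. rewrite <- H. ring.
Qed.

(* The displacement [flow t s - s] is the limit of the chord iteration
   [phi |-> (t + E s - E (s + phi)) / b 0], where [h s = b 0 * s + E s + const]. *)
Lemma flow_dirichlet t : 0 <= t -> is_dirichlet_series (fun s => flow t s - s)%C.
Proof.
  intros Ht. destruct primitive_series as [E [c [C0 [HE [HEd HhE]]]]].
  pose proof Hb0 as Hb1. apply Cmod_gt_0 in Hb1.
  destruct (dseries_lim_first b M k h' (Cmod (b O) / 2) Hser) as [X [HX1 HX]]; [lra|].
  destruct (flow_near 1 Rlt_0_1) as [m [Hm Hnear]].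
  set (rho := t / m). assert (Hrho : 0 <= rho) by pos.
  set (Y := Rmax X (k + 6)). assert (HY1 : X <= Y) by apply Rmax_l. assert (HY2 : k + 6 <= Y) by apply Rmax_r.
  (* The iterates stay within [rho] of a displacement with nonnegative real part, so this margin
     keeps [s + phi j s] in [Re >= Y], where [E] has its series and [h'] is close to [b O]. *)
  set (sg := Y + rho). assert (Hsg : 0 <= sg) by (unfold sg; lra).
  set (psi := fun s => (flow t s - s)%C).
  assert (Hpsi : forall s, sg <= Re s -> 0 <= Re (psi s) /\ Cmod (psi s) <= rho /\
     (b O * psi s = t + E s - E (s + psi s))%C).
  { intros s Hs. assert (Hs1 : 1 <= Re s) by (unfold sg in Hs; lra).
    pose proof (flow_Re t s ltac:(lra) Ht) as R1. destruct (flow_spec t s ltac:(lra) Ht) as [_ F].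
    split; [|split].
    - unfold psi. replace (Re (flow t s - s)%C) with (Re (flow t s) - Re s) by Re_ring. lra.
    - apply Rle_div_r; auto. unfold psi. specialize (Hnear t s Ht Hs1). lra.
    - unfold psi. replace (s + (flow t s - s))%C with (flow t s) by ring.
      rewrite !HhE in F by (unfold sg in Hs; lra).
      transitivity (b O * flow t s + E (flow t s) + C0 - (b O * s + E s + C0) + E s - E (flow t s))%C. ring.
      rewrite F. ring. }
  set (phi := fix phi (j : nat) : C -> C := match j with
    | O => fun _ => RtoC 0
    | S j => fun s => (/ b O * (t + E s - E (s + phi j s)))%C end).
  assert (HY : forall j s, sg <= Re s -> Cmod (phi j s - psi s) <= rho / 2 ^ j -> Y <= Re (s + phi j s)%C).
  { intros j s Hs H. destruct (Hpsi s Hs) as [A1 _].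
    assert (P2 : 1 <= 2 ^ j) by (apply pow_R1_Rle; lra).
    assert (rho / 2 ^ j <= rho) by (apply Rle_div_l; nra).
    pose proof (Re_near (phi j s) (psi s)) as Q.
    replace (Re (s + phi j s)%C) with (Re s + Re (phi j s)) by Re_ring. unfold sg in Hs. lra. }
  assert (Hphi : forall j s, sg <= Re s -> Cmod (phi j s - psi s) <= rho / 2 ^ j).
  { induction j as [|j IH]; intros s Hs; destruct (Hpsi s Hs) as [A1 [A2 A3]].
    - simpl. replace (0 - psi s)%C with (- psi s)%C by ring. rewrite Cmod_opp. lra.
    - specialize (IH s Hs). simpl phi. pose proof (HY j s Hs IH) as Y1.
      assert (P2 : 0 < 2 ^ j) by pos.
      assert (Y2 : Y <= Re (s + psi s)%C).
      { replace (Re (s + psi s)%C) with (Re s + Re (psi s)) by Re_ring. unfold sg in Hs. lra. }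
      replace (/ b O * (t + E s - E (s + phi j s)) - psi s)%C with (/ b O * (E (s + psi s) - E (s + phi j s)))%C.
      2: { transitivity (/ b O * (t + E s - E (s + phi j s) - (t + E s - E (s + psi s))))%C. ring.
           rewrite <- A3. field. auto. }
      rewrite Cmod_mult, Cmod_inv by auto.
      (* The derivative of [E] is [h' - b O], at most half of [|b O|] here; dividing by [b O] leaves
         the contraction factor [1/2]. *)
      assert (MV : Cmod (E (s + psi s) - E (s + phi j s))%C <= Cmod (b O) / 2 * Cmod ((s + psi s) - (s + phi j s))).
      { apply cderiv_MVI with (f' := fun z => (h' z - b O)%C); intros u Hu;
          pose proof (Re_seg_ge Y _ _ u Y1 Y2 Hu).
        apply HEd. lra. apply HX. lra. }
      replace ((s + psi s) - (s + phi j s))%C with (psi s - phi j s)%C in MV by ring.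
      rewrite Cmod_sym in IH.
      apply Rle_trans with (/ Cmod (b O) * (Cmod (b O) / 2 * (rho / 2 ^ j))).
      { apply Rmult_le_compat_l. left. apply Rinv_0_lt_compat; auto. eapply Rle_trans. apply MV.
        apply Rmult_le_compat_l; lra. }
      right. simpl. field. lra. }
  assert (HD : forall j, dunif sg (phi j)).
  { induction j as [|j IH]. apply dunif_const.
    apply dunif_mult; auto. apply dunif_const. apply dunif_minus; auto.
    apply dunif_plus. apply dunif_const. eapply dseries_dunif. apply HE. unfold sg; lra.
    assert (HM2 := poly_bound_M _ _ _ (proj1 HE)).
    apply dunif_lim. intros e He. destruct (small_inv (2 * (2 * M)) e) as [N HN]; [lra|auto|].
    exists (fun s => csum (fun n => c n * npow n (s + phi j s))%C N). split.
    - apply (dunif_csum sg (fun n s => c n * npow n (s + phi j s))%C). intros n.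
      apply dunif_mult; auto. apply dunif_const.
      apply dunif_ext with (f := fun s => (npow n s * Cexp (((- lnS n)%R) * phi j s))%C).
      { intros s _. rewrite npow_plus, (npow_exp n (phi j s)). f_equal. f_equal. rewrite RtoC_opp. ring. }
      apply dunif_mult; auto. apply dunif_npow. apply dunif_exp; auto. apply dunif_mult; auto. apply dunif_const.
    - intros s Hs. left. eapply Rle_lt_trans; [|apply (HN N (Nat.le_refl _))].
      apply (dseries_tail_weak c (2 * M) k E); auto. specialize (HY j s Hs (Hphi j s Hs)). lra. }
  apply (dunif_dirichlet sg). apply dunif_lim. intros e He.
  destruct (pow2_small rho e He) as [j Hj]. exists (phi j). split; auto.
  intros s Hs. rewrite Cmod_sym. specialize (Hphi j s Hs). lra.
Qed.

End Inverse.

(** Far to the right [Re h'] is at least [Re (b O) / 2]. [pick_lower] with a point [w] on the same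
    horizontal line, at abscissa [X], carries this back to abscissa [x] at the price of a factor
    [x / (4 * X)]. *)
Lemma Re_derivative_lower_bound (h' : C -> C) b M k : pick_ineq h' -> nonneg_rhp h' -> 0 <= k -> dseries b M k h' ->
  0 < Re (b O) -> forall x, 0 < x -> exists m, 0 < m /\ forall z, x <= Re z -> m <= Re (h' z).
Proof.
  intros Hp Hn Hk Hd Hb x Hx.
  destruct (dseries_lim_first b M k h' (Re (b O) / 2) Hd) as [X [HX1 HX]]; [lra|].
  assert (HXb : forall z, X <= Re z -> Re (b O) / 2 <= Re (h' z)).
  { intros z Hz. specialize (HX z Hz). pose proof (Re_near (h' z) (b O)) as Q. lra. }
  exists (Rmin (Re (b O) / 2) (x * Re (b O) / (8 * X))). split.
  { pos. }
  intros z Hz. destruct (Rle_dec X (Re z)) as [L|L].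
  - eapply Rle_trans; [apply Rmin_l|]. apply HXb. auto.
  - apply Rnot_le_lt in L. eapply Rle_trans; [apply Rmin_r|].
    set (w := (X, Im z) : C). assert (Rw : Re w = X) by reflexivity.
    pose proof (pick_lower h' z w Hp Hn ltac:(lra) ltac:(rewrite Rw; lra)) as P.
    specialize (HXb w ltac:(rewrite Rw; lra)).
    assert (E : Cmod (z + Cconj w) ^ 2 = (Re z + X) ^ 2).
    { rewrite Cmod2_alt. unfold w, Re, Im; simpl. ring. }
    pose proof (Hn z ltac:(lra)) as Nz.
    assert (P1 : Re z * X * Re (h' w) <= Re (h' z) * (4 * (X * X))).
    { eapply Rle_trans. exact P. apply Rmult_le_compat_l; auto. nra. }
    apply Rle_div_l. lra.
    assert (x * X * (Re (b O) / 2) <= Re z * X * Re (h' w)).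
    { apply Rmult_le_compat; try lra. nra. apply Rmult_le_compat_r; lra. }
    apply Rmult_le_reg_l with (X / 2). lra. nra.
Qed.

Lemma derivative_koenigs (h : C -> C) : holomorphic_on right_half_plane h ->
  is_dirichlet_series (C_derive h) ->
  (forall s : C, right_half_plane s -> 0 <= Re (C_derive h s) /\ C_derive h s <> RtoC 0) ->
  exists Phi : R -> C -> C, continuous_semigroup Phi /\ koenigs_function Phi h.
Proof.
  intros Hh HD Hp. set (h' := C_derive h) in *.
  assert (Hcd : forall s, 0 < Re s -> cderiv h s (h' s)) by (apply holomorphic_cderiv; auto).
  assert (Hn : nonneg_rhp h') by (intros s Hs; apply Hp; auto).
  assert (Hn0 : forall s, 0 < Re s -> h' s <> RtoC 0) by (intros s Hs; apply Hp; auto).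
  assert (Hpick : pick_ineq h') by (apply (pick_derivative h); auto).
  destruct (dirichlet_dseries h' HD) as [b [M [k [Hk Hd]]]].
  (* [coef_pos] requires a holomorphic function on the whole half-plane, and [h'] is known to be one
     only where its series can be differentiated; hence the translate by [k + 6]. *)
  set (S1 := RtoC (k + 6)). assert (RS : Re S1 = k + 6) by reflexivity.
  assert (HM := poly_bound_M _ _ _ (proj1 Hd)).
  set (f1 := fun z => h' (z + S1)%C).
  assert (Rf : forall z, Re (z + S1)%C = Re z + (k + 6)) by pos.
  assert (Hd1 : dseries (fun n => b n * npow n S1)%C M 0 f1).
  { split.
    - intros n. rewrite Cmod_mult, Cmod_npow, RS.
      apply Rle_trans with (M * exp (k * lnS n) * exp (- ((k + 6) * lnS n))).
      apply Rmult_le_compat_r. left; apply exp_pos. apply Hd.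
      rewrite Rmult_assoc, <- exp_plus. apply Rmult_le_compat_l; auto. apply exp_le.
      pose proof (lnS_ge0 n). nra.
    - intros z Hz. pose proof (proj2 Hd (z + S1)%C ltac:(rewrite Rf; lra)) as CV.
      eapply Ccvg_ext; [|exact CV]. intros n. apply csum_ext. intros j _. rewrite npow_plus. ring. }
  assert (Hcoef : forall n, (1 <= n)%nat -> Cmod (b n * npow n S1) <= 2 * INR (S n) * Re (b O)).
  { intros n Hn1. replace (Re (b O)) with (Re (b O * npow 0 S1)%C).
    2: { rewrite npow_0. f_equal. ring. }
    apply (coef_pos f1 (fun n => b n * npow n S1)%C M 0 n); auto.
    - intros s Hs. destruct (dseries_holomorphic b M k h' (s + S1)%C Hd ltac:(rewrite Rf; lra)) as [l Hl].
      exists l. apply cderiv_shift. auto.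
    - intros s Hs. apply Hn. rewrite Rf. lra.
    - lra. }
  assert (HRe : 0 <= Re (b O)).
  { specialize (Hcoef 1%nat (Nat.le_refl _)). pose proof (Cmod_ge_0 (b 1%nat * npow 1 S1)).
    pose proof (INR_S_pos 1). nra. }
  assert (Hmain : b O <> 0 /\ forall x, 0 < x -> exists m, 0 < m /\ lower_lip h x m).
  { destruct (Rle_lt_or_eq_dec _ _ HRe) as [L|L].
    - pose proof (Re_derivative_lower_bound h' b M k Hpick Hn Hk Hd L) as LB. split.
      + intros Z. rewrite Z in L. simpl in L. lra.
      + intros x Hx. destruct (LB x Hx) as [m [Hm HLB]]. exists m. split; auto.
        intros s w Hs Hw. apply (strong_mono h h' Hcd x); auto.
    (* With [Re (b O) = 0] the coefficient bound annihilates every other coefficient, so [h'] equals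
       the imaginary number [b O] at [S1], and [pick_zero] spreads this over the half-plane. *)
    - assert (Hbn : forall n, (1 <= n)%nat -> b n = 0).
      { intros n Hn1. specialize (Hcoef n Hn1).
        rewrite Cmod_mult, Cmod_npow in Hcoef. apply Cmod_zero_le.
        pose proof (exp_pos (- (Re S1 * lnS n))). nra. }
      assert (E1 : h' S1 = b O).
      { apply (Ccvg_unique (csum (fun n => b n * npow n S1)%C)). apply Hd. lra.
        intros e He. exists 1%nat. intros n Hn1. destruct n as [|n]. lia. clear Hn1.
        replace (csum (fun n => b n * npow n S1)%C (S n)) with (b O). rewrite Cmod_diff_0; auto.
        induction n as [|n IH]. simpl. rewrite npow_0. ring.
        change (b O = csum (fun n => b n * npow n S1)%C (S n) + b (S n) * npow (S n) S1)%C.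
        rewrite <- IH, (Hbn (S n)) by lia. ring. }
      assert (Ec : forall s, 0 < Re s -> h' s = b O).
      { intros s Hs. rewrite <- E1. apply pick_zero; auto. rewrite RS; lra. rewrite E1. auto. }
      assert (B0 : b O <> 0). { rewrite <- E1. apply Hn0. lra. }
      assert (Hlin : forall s w, 0 < Re s -> 0 < Re w -> (h w - h s = b O * (w - s))%C).
      { intros s w Hs Hw. set (D := fun z => (h z - b O * z)%C).
        assert (ED : D w = D s).
        { apply Cminus_0_eq, Cmod_zero_le. apply Rle_trans with (0 * Cmod (w - s)); [|lra].
          assert (Hm : 0 < Rmin (Re s) (Re w)) by pos.
          apply cderiv_MVI with (f' := fun _ => RtoC 0); intros u Hu;
            pose proof (Re_seg_ge _ s w u (Rmin_l (Re s) (Re w)) (Rmin_r _ _) Hu).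
          - eapply cderiv_eq. apply cderiv_minus. apply Hcd. lra. apply cderiv_scal, cderiv_id.
            rewrite Ec by lra. ring.
          - rewrite Cmod_0. lra. }
        unfold D in ED. transitivity (h w - b O * w - (h s - b O * s) + b O * (w - s))%C. ring.
        rewrite ED. ring. }
      (* [h] is affine with slope [b O], so the Lipschitz bound is an equality. *)
      split; auto. intros x Hx. exists (Cmod (b O)). split. apply Cmod_gt_0; auto.
      intros s w Hs Hw. rewrite Hlin by lra. rewrite Cmod_mult. lra. }
  destruct Hmain as [B0 HL]. exists (flow h).
  apply (flow_koenigs h h'); auto. intros t Ht.
  apply (flow_dirichlet h h' Hcd Hn Hn0 HL b M k); auto.
Qed.

Theorem corollary6p8 :
  forall h : C -> C,
    holomorphic_on right_half_plane h ->
    ((exists Phi : R -> C -> C,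
        continuous_semigroup Phi /\ koenigs_function Phi h)
     <->
     (is_dirichlet_series (C_derive h) /\
      forall s : C, right_half_plane s ->
        0 <= Re (C_derive h s) /\ C_derive h s <> RtoC 0)).
Proof.
  intros h Hh. split.
  - apply koenigs_derivative. exact Hh.
  - intros [HD Hp]. apply derivative_koenigs; assumption.
Qed.
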